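(* Let $\nu\in\mathbb{N}$, let $H_1,\ldots,H_\nu\in\mathbb{R}$, let $\gamma_1,\ldots,\gamma_\nu\in\mathbb{T}$ be distinct, and let $f:\mathbb{T}\to\mathbb{R}$ be given by $$f(x)=\left(\sum_{i=1}^{\nu}H_i\right)\left(\iota(x)-\tfrac12\right)+\sum_{i=1}^{\nu}H_i\left(\mathbf{1}_{[0,\gamma_i)}(x)-\iota(\gamma_i)\right).$$ Then for $\mu$-almost every $\alpha\in\mathbb{T}$, with $\iota(\alpha)=[0;a_1,a_2,\ldots]$, and for any $x_0\in\mathbb{T}$, there exists an increasing sequence $(n_\ell)_{\ell\in\mathbb{N}}$ of positive integers such that the following holds: 1. For every $\ell\in\mathbb{N}$, $q_{n_\ell}$ is a denominator of a convergent of $\alpha$. 2. $\displaystyle\lim_{\ell\to\infty}\frac{\sum_{i=1}^{n_\ell}a_i}{a_{n_\ell+1}}=0$. 3. The limits (in $\mathbb{T}$) $$\overline{x_0}:=\lim_{\ell\to\infty}q_{n_\ell}x_0,\qquad\overline{\gamma_i}:=\lim_{\ell\to\infty}q_{n_\ell}\gamma_i,\quad i=1,\ldots,\nu,$$ exist and satisfy $\overline{\gamma_i}\ne\overline{\gamma_1}$ for all $i=2,\ldots,\nu$. If $\gamma_1\ne0$, then $\overline{\gamma_1}\ne0$. 4. We have $$\lim_{\ell\to\infty}\ \sup_{c\in[0,1]}\left|\frac{S_{\lfloor c\,a_{n_\ell+1}\rfloor q_{n_\ell}}(f,\alpha,x_0)}{a_{n_\ell+1}}-\left(\left(\sum_{i=1}^{\nu}H_i\right)\left(\int_0^c\iota(y+\overline{x_0})\,dy-\frac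 c2\right)+\sum_{i=1}^{\nu}H_i\left(\int_0^c\mathbf{1}_{[0,\overline{\gamma_i}]}(y+\overline{x_0})\,dy-c\,\iota(\overline{\gamma_i})\right)\right)\right|=0.$$
   Context: $\mathbb{T}=\mathbb{R}/\mathbb{Z}$ with normalized Haar measure $\mu$; $\iota:\mathbb{T}\to[0,1)$ is the map $x+\mathbb{Z}\mapsto\{x\}=x-\lfloor x\rfloor$. For $b,x\in\mathbb{T}$, $\mathbf{1}_{[0,b)}(x)$ means $\mathbf{1}_{[0,\iota(b))}(\iota(x))$ and $\mathbf{1}_{[0,b]}(x)$ means $\mathbf{1}_{[0,\iota(b)]}(\iota(x))$. For $y\in\mathbb{R}$ and $a\in\mathbb{T}$, $y+a$ means $(y+\mathbb{Z})+a\in\mathbb{T}$; for $n\in\mathbb{N}$, $na$ is the $n$-fold sum in $\mathbb{T}$. For $\alpha,x_0\in\mathbb{T}$, the Birkhoff sum is $S_N(f,\alpha,x_0)=\sum_{k=0}^{N-1}f(x_0+k\alpha)$, with $S_0=0$. For $\alpha\in\mathbb{T}$ with $\iota(\alpha)$ irrational, $[0;a_1,a_2,\ldots]$ is the continued fraction expansion of $\iota(\alpha)$ (so $a_k=a_k(\alpha)$ are positive integers), and the convergents are $p_k/q_k=[0;a_1,\ldots,a_k]$, where $p_0=0$, $p_1=1$, $q_0=1$, $q_1=a_1$, $p_{k+1}=a_{k+1}p_k+p_{k-1}$, $q_{k+1}=a_{k+1}q_k+q_{k-1}$ for $k\ge1$. *)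

(* Defs.v *)
From HB Require Import structures.
From mathcomp Require Import all_boot all_order all_algebra.
From mathcomp Require Import generic_quotient ring_quotient archimedean.
From mathcomp Require Import all_classical all_reals all_analysis measurable_realfun.

Set Implicit Arguments.
Unset Strict Implicit.
Unset Printing Implicit Defensive.

Import Order.TTheory GRing.Theory Num.Theory.
Import numFieldTopology.Exports numFieldNormedType.Exports.

Local Open Scope classical_set_scope.
Local Open Scope ring_scope.

Section Circle.
Variable R : realType.

Definition integers : {pred R} := fun x => x \is a Num.int.

Fact integers_zmod_closed : zmod_closed integers.
Proof. by split; [exact: rpred0|move=> x y; exact: rpredB]. Qed.

HB.instance Definition _ :=
  GRing.isZmodClosed.Build R integers integers_zmod_closed.

(* R/Z with its quotient group structure, the quotient topology, and the
   Borel sigma-algebra of that topology. *)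
Definition circle : Type := quotient_topology (@Quotient.quot R integers).

HB.instance Definition _ := Topological.on circle.
HB.instance Definition _ := Pointed.on circle.
HB.instance Definition _ := Quotient.on circle.

HB.instance Definition _ := @GRing.isZmodule.Build circle
  _ _ _ (@Quotient.addqA R integers) (@Quotient.addqC R integers)
  (@Quotient.add0q R integers) (@Quotient.addNq R integers).

HB.instance Definition _ :=
  Measurable.copy circle (g_sigma_algebraType (@open circle)).

Definition circle_proj (x : R) : circle := \pi_circle%qT x.

(* The representative in [0, 1[; by circle_rep_proj it does not depend on the
   representative chosen by repr. *)
Definition circle_rep (x : circle) : R := repr x - (Num.floor (repr x))%:~R.

Lemma circle_projP x y :
  circle_proj x = circle_proj y <-> x - y \is a Num.int.
Proof.
rewrite -[x - y \is a Num.int]/(x - y \in integers) Quotient.idealrBE.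
by split=> [xy|/eqtype.eqP xy]; [apply/eqtype.eqP; exact: xy|exact: xy].
Qed.

Lemma circle_projD : {morph circle_proj : x y / x + y}.
Proof. exact: (@Quotient.pi_add R integers). Qed.

Lemma circle_proj_continuous : continuous circle_proj.
Proof. exact: pi_continuous. Qed.

Lemma circle_rep_proj x : circle_rep (circle_proj x) = x - (Num.floor x)%:~R.
Proof.
have /circle_projP/intrP[m rE] :
    circle_proj (repr (circle_proj x)) = circle_proj x by exact: reprK.
have -> : circle_rep (circle_proj x) = repr (circle_proj x) -
  (Num.floor (repr (circle_proj x)))%:~R by [].
have -> : repr (circle_proj x) = x + m%:~R by rewrite -rE addrC subrK.
by rewrite floorDrz ?intr_int// intrKfloor rmorphD/= opprD addrACA subrr addr0.
Qed.

Lemma circle_repK : cancel circle_rep circle_proj.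
Proof.
move=> x; rewrite -[RHS](@reprK _ circle); apply/circle_projP.
by rewrite /circle_rep addrAC subrr add0r rpredN intr_int.
Qed.

Lemma measurable_circle_proj :
  measurable_fun [set: measurableTypeR R] circle_proj.
Proof.
apply: (@measurability _ _ _ _ _ _ (@open circle)) => //.
by move=> _ [B oB <-]; rewrite setTI; exact: open_measurable.
Qed.

(* Normalized Haar measure, as the image of Lebesgue measure on [0, 1[. *)
Definition circle_haar : set circle -> \bar R :=
  pushforward (mrestr (@lebesgue_measure R) (measurable_itv `[0, 1[))
    circle_proj.

Let haar0 : circle_haar set0 = 0%E.
Proof. by rewrite /circle_haar /pushforward preimage_set0 measure0. Qed.

Let haar_ge0 A : (0 <= circle_haar A)%E.
Proof. by rewrite /circle_haar /pushforward; exact: measure_ge0. Qed.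

Let haar_sigma_additive : semi_sigma_additive circle_haar.
Proof.
pose P : measurableTypeR R -> circle := circle_proj.
have mP : measurable_fun setT P by exact: measurable_circle_proj.
pose M : {mfun measurableTypeR R >-> circle} := mfun_Sub (mem_set mP).
exact: (@measure_semi_sigma_additive _ _ _
  (pushforward (mrestr (@lebesgue_measure R) (measurable_itv `[0, 1[)) M)).
Qed.

HB.instance Definition _ := isMeasure.Build _ _ _ circle_haar
  haar0 haar_ge0 haar_sigma_additive.

Let haar_setT : circle_haar [set: circle] = 1%E.
Proof.
rewrite /circle_haar /pushforward preimage_setT /mrestr setTI.
by rewrite lebesgue_measure_itv/= lte_fin ltr01 oppr0 adde0.
Qed.

HB.instance Definition _ :=
  Measure_isProbability.Build _ _ _ circle_haar haar_setT.

End Circle.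

Section BirkhoffSum.
Variable R : realType.

Definition circle_itvco (b x : circle R) : R :=
  \1_(`[0, circle_rep b[ : set R) (circle_rep x).

Definition circle_itvcc (b x : circle R) : R :=
  \1_(`[0, circle_rep b] : set R) (circle_rep x).

Definition birkhoff_sum (N : nat) (f : circle R -> R) (alpha x0 : circle R) :
    R :=
  \sum_(0 <= k < N) f (x0 + alpha *+ k).

End BirkhoffSum.

Section ContinuedFractions.
Variable R : realType.

Definition gauss_map (x : R) : R := x^-1 - (Num.floor x^-1)%:~R.

(* Partial quotients of x in [0, 1[, produced by iterating the Gauss map; the
   value at index 0 is the integer part a_0 = 0.  For rational x the algorithm
   terminates and the convention 0^-1 = 0 makes all later values 0. *)
Definition cf_digit (x : R) (k : nat) : nat :=
  if k is k'.+1 then Num.truncn (iter k' gauss_map x)^-1 else 0%N.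

Fixpoint cf_den (a : nat -> nat) (k : nat) : nat :=
  match k with
  | 0 => 1
  | k1.+1 => match k1 with
             | 0 => a 1
             | k2.+1 => a k * cf_den a k1 + cf_den a k2
             end
  end%N.

(* cf_value [:: a_1; ...; a_k] = [0; a_1, ..., a_k] *)
Fixpoint cf_value (s : seq nat) : R :=
  if s is a :: s' then (a%:R + cf_value s')^-1 else 0.

Definition convergent (x : R) (k : nat) : R :=
  cf_value [seq cf_digit x i | i <- iota 1 k].

(* q is the denominator, in lowest terms, of some convergent of x *)
Definition convergent_denominator (x : R) (q : nat) : Prop :=
  exists k p : nat,
    [/\ (0 < q)%N, coprime p q & convergent x k = p%:R / q%:R].

End ContinuedFractions.

(* Main.v *)
Require Import Defs.
From HB Require Import structures.
From mathcomp Require Import all_boot all_order all_algebra.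
From mathcomp Require Import archimedean.
From mathcomp Require Import all_classical all_reals all_analysis.
From mathcomp Require Import measurable_realfun ring lra zify.

Set Implicit Arguments.
Unset Strict Implicit.
Unset Printing Implicit Defensive.

Import Order.TTheory GRing.Theory Num.Theory.
Import numFieldTopology.Exports numFieldNormedType.Exports.

Local Open Scope classical_set_scope.
Local Open Scope ring_scope.

(** Since [1_[0,b)(x) - b = {x - b} - {x}], the function is [f(x) = sum_i
    H_i ({x - gamma_i} - 1/2)], so that everything reduces to the sawtooth
    [g(x) = {x} - 1/2]. Its periodic primitive [saw(x) = ({x}^2 - {x})/2] is
    Lipschitz, and the limit in the theorem is the sum over [i] of [H_i
    (saw(z_i + c) - saw(z_i))], where [z_i] is the limit of [q_n (x_0 -
    gamma_i)].

    Birkhoff sums. Let [n] be even, [q = q_n], [p = p_n], [a = a_(n+1)] and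
    [theta = q (q alpha - p)], which lies between [1/(a+2)] and [1/a]. The
    points [w + k p/q] with [k < q] have the fractional parts of a
    progression of step [1/q], so [sum_(k<q) g(w + k alpha)] equals [g(q w)]
    up to [theta] plus the number of integers in [(q w, q w + theta]]. For
    consecutive blocks of length [q] these counts telescope, and [sum_(j<m)
    theta g(u + j theta)] is a Riemann sum of the derivative of [saw]. Hence
    the sum over [m q] terms, divided by [a], is [saw(q w + m theta) - saw(q
    w)] up to [O(1/a)], uniformly in [m <= a] ([sum_fpart_saw]). Parity
    matters: for odd [n] the points move backwards.

    Metric part. It remains to find, for almost every [alpha], infinitely
    many even [n] such that [a_(n+1)] is much larger than [S_n = a_1 + ... +
    a_n], while [q_n d] stays away from the integers for each of the
    finitely many differences [d] that must survive in the limit. Given the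
    first [n] digits, the digit [a_(n+1)] is at least [b] with conditional
    probability between [1/b] and [2/b]. Two consequences are used.

    - The events of a first success at time [n] are disjoint, and each
      opportunity with [S_n <= s] leads to a success with probability at
      least [1/(K s)]. On the set of failures, the expected sum of [1/(K
      s_n)] over the opportunities is therefore at most one
      ([sum_opportunity]).
    - Outside a small proportion of each cylinder, [S_n = O(n log n)] and
      [log q_n = O(n)] ([mu_tame]).

    Opportunities are frequent ([many_good]). Two digits suffice to make
    [q_n] congruent to one modulo a given [V], which settles the rational
    [d]. For irrational [d], the [q] with [q d] near an integer are far
    apart, and [q] is a denominator with probability [O(1/q)]. As the sum of
    [1/(n log n)] diverges, successes cover a fixed proportion of every
    cylinder ([mu_failure_cyl]), and a covering argument makes the set of
    failures null ([ae_success]).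

    The sequence of the theorem is extracted from these successes by
    compactness, once for [x_0] and all the [gamma_i]. *)

(** * Continued fractions and Moebius maps *)

Section ContinuedFractionAlgebra.
Variable R : realType.
Implicit Types (a b : nat -> nat) (x y s t : R).

(** The pair of [p_n] and [p_(n-1)], started at [p_(-1) = 1] so that one
    recursion serves all [n]. *)
Fixpoint cf_nums a n : nat * nat :=
  if n is m.+1 then
    ((a n * (cf_nums a m).1 + (cf_nums a m).2)%N, (cf_nums a m).1)
  else (0%N, 1%N).

(** The denominator [q_(n-1)], with [q_(-1) = 0]. *)
Definition cf_den_pred a n : nat := if n is m.+1 then cf_den a m else 0%N.

Lemma cf_denS a n :
  cf_den a n.+1 = (a n.+1 * cf_den a n + cf_den_pred a n)%N.
Proof. by case: n => [|n] //=; rewrite muln1 addn0. Qed.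

Lemma cf_den_gt0 a n : (forall i, 0 < a i.+1)%N -> (0 < cf_den a n)%N.
Proof.
move=> a0; elim: n => [//|n IH]; rewrite cf_denS.
by rewrite ltn_addr// muln_gt0 a0.
Qed.

Lemma cf_den_pred_le a n : (forall i, 0 < a i.+1)%N ->
  (cf_den_pred a n <= cf_den a n)%N.
Proof.
move=> a0; case: n => [//|n]; rewrite cf_denS /=.
by rewrite (leq_trans _ (leq_addr _ _))// leq_pmull.
Qed.

Lemma cf_den_ltS a n : (forall i, 0 < a i.+1)%N ->
  (cf_den a n.+1 < cf_den a n.+2)%N.
Proof.
move=> a0; rewrite [in X in (_ < X)%N]cf_denS /=.
rewrite -addn1 leq_add// ?cf_den_gt0//.
by rewrite leq_pmull.
Qed.

Lemma cf_den_ge a n : (forall i, 0 < a i.+1)%N -> (n <= cf_den a n)%N.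
Proof.
move=> a0; case: n => [//|n]; elim: n => [|n IH]; first by rewrite cf_den_gt0.
by rewrite (leq_ltn_trans IH)// cf_den_ltS.
Qed.

Lemma cf_den_mono a m n : (forall i, 0 < a i.+1)%N -> (m <= n)%N ->
  (cf_den a m <= cf_den a n)%N.
Proof.
move=> a0; elim: n => [|n IH]; first by rewrite leqn0 => /eqP->.
rewrite leq_eqVlt => /predU1P[->//|]; rewrite ltnS => /IH/leq_trans; apply.
exact: (@cf_den_pred_le a n.+1).
Qed.

Lemma cf_den_inj a m n : (forall i, 0 < a i.+1)%N ->
  cf_den a m.+1 = cf_den a n.+1 -> m = n.
Proof.
move=> a0; wlog mn : m n / (m <= n)%N.
  by move=> W; case/orP: (leq_total m n) => [|+ /esym] => /W /[apply].
move: mn; rewrite leq_eqVlt => /predU1P[->//|mn] E.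
have := cf_den_ltS m a0; rewrite E.
by rewrite ltnNge cf_den_mono.
Qed.

Lemma cf_den_ext a b n : (forall i, (0 < i <= n)%N -> a i = b i) ->
  cf_den a n = cf_den b n /\ cf_den_pred a n = cf_den_pred b n.
Proof.
elim: n => [//|n IH] ab; have [|E1 E2] := IH.
  by move=> i /andP[i0 ni]; rewrite ab// i0 ltnW.
by rewrite !cf_denS E1 E2 ab ?ltnS ?leqnn.
Qed.

Lemma cf_nums_ext a b n : (forall i, (0 < i <= n)%N -> a i = b i) ->
  cf_nums a n = cf_nums b n.
Proof.
elim: n => [//|n IH] ab /=; rewrite IH ?ab ?ltnS ?leqnn//.
by move=> i /andP[i0 ni]; rewrite ab// i0 ltnW.
Qed.

Lemma cf_det (T : comNzRingType) a n :
  (cf_nums a n).2%:R * (cf_den a n)%:R -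
  (cf_nums a n).1%:R * (cf_den_pred a n)%:R = (- 1) ^+ n :> T.
Proof.
elim: n => [|n IH]; first by rewrite /= mul1r mul0r subr0.
rewrite exprS -IH cf_denS /= !natrD !natrM; ring.
Qed.

(** Such a divisor also divides the determinant, which is [1] or [-1]. *)
Lemma cf_det_unit a n (d : nat) :
  (d %| (cf_den a n))%N -> (d %| (cf_nums a n).1)%N || (d %| cf_den_pred a n)%N
    ->
  d = 1%N.
Proof.
move=> dq dp; suff : (d %| 1)%N by rewrite dvdn1 => /eqP.
have : (d%:Z %| (- 1) ^+ n)%Z.
  rewrite -(cf_det int a n) !natz -!PoszM; apply: rpredB.
    by rewrite -[_ \in _]/(d %| _)%N dvdn_mull.
  rewrite -[_ \in _]/(d %| _)%N.
  by case/orP: dp => dp; rewrite ?(dvdn_mulr _ dp)// dvdn_mull.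
by rewrite dvdzE abszX exp1n.
Qed.

Lemma cf_coprime a n : coprime (cf_nums a n).1 (cf_den a n).
Proof.
apply/eqP; apply: (@cf_det_unit a n _ (dvdn_gcdr _ _)).
by rewrite dvdn_gcdl.
Qed.

Lemma cf_den_coprime a n : coprime (cf_den a n) (cf_den_pred a n).
Proof.
apply/eqP; apply: (@cf_det_unit a n _ (dvdn_gcdl _ _)).
by rewrite dvdn_gcdr orbT.
Qed.

(** The number [[0; a_1, ..., a_n + t]], which is the inverse branch of the
    [n]-th iterate of the Gauss map on a cylinder. *)
Definition mobius a n t : R :=
  ((cf_nums a n).1%:R + t * (cf_nums a n).2%:R) /
  ((cf_den a n)%:R + t * (cf_den_pred a n)%:R).

Lemma mobius_den_gt0 a n t : (forall i, 0 < a i.+1)%N -> 0 <= t ->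
  0 < (cf_den a n)%:R + t * (cf_den_pred a n)%:R :> R.
Proof.
by move=> a0 t0; rewrite ltr_pwDl ?mulr_ge0// ltr0n cf_den_gt0.
Qed.

Lemma mobiusS a n t : (forall i, 0 < a i.+1)%N -> 0 <= t ->
  mobius a n.+1 t = mobius a n ((a n.+1)%:R + t)^-1.
Proof.
move=> a0 t0.
have at0 : 0 < (a n.+1)%:R + t by rewrite ltr_pwDl// ltr0n.
have d0 := mobius_den_gt0 n.+1 a0 t0.
have atV0 : 0 <= ((a n.+1)%:R + t)^-1 by rewrite invr_ge0 ltW.
have d1 := mobius_den_gt0 n a0 atV0.
have -> : mobius a n ((a n.+1)%:R + t)^-1 =
  (((a n.+1)%:R + t) * (cf_nums a n).1%:R + (cf_nums a n).2%:R) /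
  (((a n.+1)%:R + t) * (cf_den a n)%:R + (cf_den_pred a n)%:R).
  rewrite /mobius; field; rewrite !gt_eqF//=.
  have : 0 < ((a n.+1)%:R + t) * ((cf_den a n)%:R + ((a n.+1)%:R + t)^-1 *
    (cf_den_pred a n)%:R) by rewrite mulr_gt0.
  by rewrite mulrDr mulrA divff ?mul1r ?gt_eqF.
rewrite /mobius cf_denS /= !natrD !natrM; congr (_ / _); ring.
Qed.

Lemma cf_value_foldr a n :
  cf_value R [seq a i | i <- iota 1 n] =
  foldr (fun k v => (k%:R + v)^-1) 0 [seq a i | i <- iota 1 n].
Proof. by elim: (map _ _) => //= k s ->. Qed.

(** The induction peels digits from the right: [n+1] digits with tail [t] are
    [n] digits with tail [1/(a_(n+1) + t)], which is the recursion of
    [mobius]. *)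
Lemma foldr_mobius a n t : (forall i, 0 < a i.+1)%N -> 0 <= t ->
  foldr (fun k v => (k%:R + v)^-1) t [seq a i | i <- iota 1 n] = mobius a n t.
Proof.
move=> a0; elim: n t => [|n IH] t t0.
  by rewrite /mobius /= mulr1 mulr0 add0r addr0 divr1.
rewrite mobiusS// -IH ?invr_ge0 ?addr_ge0//.
have -> : iota 1 n.+1 = iota 1 n ++ [:: n.+1] by rewrite -(addn1 n) iotaD add1n
  addn1.
by rewrite map_cat foldr_cat.
Qed.

(** The numbers all of whose Gauss iterates stay in the open unit interval. *)
Definition irr01 : set R := `]0, 1[%classic `&` @irrational R.

Lemma irrational_neq (r : R) (n : int) (d : nat) : irrational r ->
  r <> n%:~R / d%:R.
Proof. by move=> ir e; apply: ir; apply/rationalP; exists n, d. Qed.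

Lemma irrationalV x : irrational x -> irrational x^-1.
Proof.
by move=> ix [r _ e]; apply: ix; exists r^-1 => //; rewrite fmorphV/= e invrK.
Qed.

Lemma irrationalDz x (m : int) : irrational x -> irrational (x + m%:~R).
Proof.
move=> ix [r _ e]; apply: ix; exists (r - m%:~R) => //.
by rewrite rmorphB/= e ratr_int addrK.
Qed.

Lemma irr01_gauss x : irr01 x -> irr01 (gauss_map x).
Proof.
move=> [/= /[!in_itv]/= /andP[x0 x1] ix]; rewrite /gauss_map.
have ig : irrational (x^-1 - (Num.floor x^-1)%:~R).
  by rewrite -mulrNz; apply: irrationalDz; exact: irrationalV.
have /andP[f1 f2] := floor_itv x^-1.
split => //=; rewrite in_itv/= lt_neqAle subr_ge0 f1 andbT.
apply/andP; split; last by rewrite ltrBlDl -[X in _ + X]/(1%:~R) -intrD.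
by apply/eqP => e; apply: (@irrational_neq _ 0 1 ig); rewrite -e mul0r.
Qed.

Lemma irr01_iter x n : irr01 x -> irr01 (iter n (@gauss_map R) x).
Proof. by move=> Ox; elim: n => // n /irr01_gauss. Qed.

Lemma irr01_gt0 x : irr01 x -> 0 < x.
Proof. by case; rewrite /= in_itv/= => /andP[]. Qed.

Lemma irr01_lt1 x : irr01 x -> x < 1.
Proof. by case; rewrite /= in_itv/= => /andP[]. Qed.

Lemma truncn_floorR y : 0 <= y -> (Num.truncn y)%:R = (Num.floor y)%:~R :> R.
Proof.
move=> y0; rewrite truncn_floor y0.
by rewrite -[in RHS](@gez0_abs (Num.floor y)) ?floor_ge0.
Qed.

Lemma cf_digitE x n : irr01 x ->
  (iter n (@gauss_map R) x)^-1 =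
  (cf_digit x n.+1)%:R + iter n.+1 (@gauss_map R) x.
Proof.
move=> /(@irr01_iter _ n)/irr01_gt0 t0 /=.
by rewrite truncn_floorR ?invr_ge0 ?ltW// /gauss_map addrC subrK.
Qed.

Lemma cf_digit_gt0 x : irr01 x -> forall i, (0 < cf_digit x i.+1)%N.
Proof.
move=> Ox i /=; have Oi := irr01_iter i Ox; have t0 := irr01_gt0 Oi.
rewrite -(ltr_nat R) truncn_floorR ?invr_ge0 ?ltW//.
by rewrite (ltr_int R 0) floor_gt0 invf_ge1 ?ltW // irr01_lt1.
Qed.

Lemma cf_tail_mobius x n : irr01 x ->
  x = mobius (cf_digit x) n (iter n (@gauss_map R) x).
Proof.
move=> Ox; have a0 := cf_digit_gt0 Ox.
elim: n => [|n {1}->]; first by rewrite /mobius /= mulr1 mulr0 add0r addr0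
  divr1.
rewrite mobiusS//; last by rewrite ltW// irr01_gt0//; exact: (irr01_iter n.+1).
by rewrite -cf_digitE// invrK.
Qed.

(** With [cf_tail_mobius], this makes [mobius a n] a bijection from the open
    unit interval to the numbers that start with the digits [a_1, ..., a_n]. *)
Lemma mobius_digits a n s : (forall i, 0 < a i.+1)%N -> 0 < s < 1 ->
  (forall i, (0 < i <= n)%N -> cf_digit (mobius a n s) i = a i) /\
  iter n (@gauss_map R) (mobius a n s) = s.
Proof.
move=> a0; elim: n s => [|n IH] s /andP[s0 s1].
  split; first by case.
  by rewrite /mobius /= mulr1 mulr0 add0r addr0 divr1.
have as0 : 0 < (a n.+1)%:R + s by rewrite ltr_pwDl ?ltr0n// ltW.
have as1 : 1 < (a n.+1)%:R + s.
  by rewrite ltr_pwDr// (ler_nat R 1) a0.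
rewrite mobiusS ?(ltW s0)//; have [|IH1 IH2] := IH ((a n.+1)%:R + s)^-1.
  by rewrite invr_gt0 as0 invf_lt1.
have dS : cf_digit (mobius a n ((a n.+1)%:R + s)^-1) n.+1 = a n.+1.
  rewrite /= IH2 invrK; apply: truncn_def.
  by rewrite lerDl ltW//= -natr1 ltrD2l.
split.
  move=> i /andP[i0]; rewrite leq_eqVlt => /predU1P[->//|].
  by rewrite ltnS => ni; apply: IH1; rewrite i0.
rewrite iterS IH2 /gauss_map invrK.
have -> : Num.floor ((a n.+1)%:R + s) = (a n.+1)%:Z.
  by apply: floor_def; rewrite intrD -pmulrn lerDl ltW//= ltrD2l.
by rewrite -pmulrn addrC addKr.
Qed.

Lemma convergentE x n : irr01 x ->
  convergent x n = (cf_nums (cf_digit x) n).1%:R / (cf_den (cf_digit x) n)%:R.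
Proof.
move=> Ox; rewrite /convergent cf_value_foldr foldr_mobius//; last first.
  exact: cf_digit_gt0.
by rewrite /mobius !mul0r !addr0.
Qed.

End ContinuedFractionAlgebra.

(** * Lebesgue measure of cylinders *)

Section GaussPartition.
Variable R : realType.
Implicit Types (a : nat -> nat) (x y s t : R) (A B E F : set R) (n : nat).

(** A probability on the reals with values in the field, so that estimates can
    be handled by linear arithmetic; the rational points carry no mass. *)
Definition mu A : R := fine (lebesgue_measure (A `&` @irr01 R)).

Lemma measurable_irrational : measurable (@irrational R).
Proof.
apply: measurableC; apply: countable_measurable => //.
exact: sub_countable (card_image_le _ _) (countableP _).
Qed.

Lemma measurable_irr01 : measurable (@irr01 R).
Proof. by apply: measurableI => //; exact: measurable_irrational. Qed.

Lemma lebesgue_irrational A : measurable A ->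
  lebesgue_measure (A `&` @irrational R) = lebesgue_measure A.
Proof.
move=> mA; have mI := measurable_irrational.
have mQ : measurable (@rational R).
  by rewrite -[rational]setCK; exact: measurableC.
rewrite (measureDI (@lebesgue_measure R) mA mI).
rewrite [X in (X + _)%E](_ : _ = 0%E) ?add0e//.
apply/eqP; rewrite eq_le measure_ge0 andbT -(lebesgue_measure_rat R).
apply: le_measure; rewrite ?inE//; first exact: measurableD.
by move=> r [_ /contrapT].
Qed.

Lemma muE A : measurable A -> (mu A)%:E = lebesgue_measure (A `&` @irr01 R).
Proof.
move=> mA; rewrite /mu fineK// ge0_fin_numE//.
apply: (@le_lt_trans _ _ (lebesgue_measure `]0%R, 1%R[%classic)).
  apply: le_measure; rewrite ?inE//;
    first exact: measurableI mA measurable_irr01.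
  by move=> r [_ []].
by rewrite lebesgue_measure_itv/= lte01 sube0 ltry.
Qed.

Lemma mu_ge0 A : 0 <= mu A. Proof. by rewrite fine_ge0. Qed.

Lemma mu_irr01 : mu (@irr01 R) = 1.
Proof.
apply: EFin_inj; rewrite muE ?setIid; last exact: measurable_irr01.
by rewrite lebesgue_irrational// lebesgue_measure_itv/= lte01 sube0.
Qed.

Lemma mu_mono A B : measurable A -> measurable B -> A `&` @irr01 R `<=` B ->
  mu A <= mu B.
Proof.
move=> mA mB AB; rewrite -lee_fin !muE//; apply: le_measure.
- by rewrite inE; exact: measurableI mA measurable_irr01.
- by rewrite inE; exact: measurableI mB measurable_irr01.
- by move=> r Ar; split; [exact: AB|case: Ar].
Qed.

Lemma mu_split A B : measurable A -> measurable B ->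
  mu A = mu (A `&` B) + mu (A `\` B).
Proof.
move=> mA mB; apply: EFin_inj; rewrite EFinD !muE//; last 2 first.
- exact: measurableD.
- exact: measurableI.
rewrite (measureDI (@lebesgue_measure R) (measurableI _ _ mA measurable_irr01)
  mB) addeC.
by congr (_ + _)%E; congr lebesgue_measure; apply/seteqP; split=> z /=; tauto.
Qed.

(** The sum starts at an arbitrary [m] because [q_0 = q_1] may happen, so that
    events on the denominators can overlap at the start. *)
Lemma mu_sum_disjoint A (F : nat -> set R) m N :
  measurable A -> (forall i, measurable (F i)) ->
  (forall i j r, (m <= i)%N -> (i < j)%N -> (j < N)%N -> F i r -> ~ F j r) ->
  \sum_(m <= i < N) mu (A `&` F i) <= mu A.
Proof.
move=> mA mF; elim: N A mA => [|N IH] A mA dF.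
  by rewrite big_geq// mu_ge0.
have [mN|Nm] := leqP m N; last by rewrite big_geq// mu_ge0.
rewrite big_nat_recr//= (mu_split mA (mF N)) addrC lerD2l.
apply: le_trans (IH _ (measurableD mA (mF N)) _); last first.
  by move=> i j r mi ij jN; apply: dF => //; exact: ltnW.
rewrite big_nat [leRHS]big_nat; apply: ler_sum => i /andP[mi iN].
apply: mu_mono.
- exact: measurableI.
- by apply: measurableI => //; exact: measurableD.
- by move=> r [[Ar Fi] _]; do 2?split => //; exact: (dF i N).
Qed.

(** By induction on the list: on [F i] the remaining events still count to [k
    - 1], and outside they count to [k]. For [k = 1] this is the union bound. *)
Lemma mu_markov (I : Type) (s : seq I) (F : I -> set R) B k :
  measurable B -> (forall i, measurable (F i)) ->
  (forall r, B r -> irr01 r -> (k <= \sum_(i <- s) `[< F i r >])%N) ->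
  k%:R * mu B <= \sum_(i <- s) mu (B `&` F i).
Proof.
move=> mB mF; elim: s B k mB => [|i s IH] B k mB kB.
  rewrite big_nil; have [->|k0] := posnP k; first by rewrite mul0r.
  rewrite [mu B](_ : _ = 0) ?mulr0//.
  apply/eqP; rewrite eq_le mu_ge0 andbT.
  have -> : 0 = mu set0 by rewrite /mu set0I measure0.
  apply: mu_mono => // r [Br Or]; have := kB r Br Or.
  by rewrite big_nil leqn0 => /eqP e; rewrite e in k0.
rewrite big_cons (mu_split mB (mF i)) mulrDr.
have mBi : measurable (B `&` F i) by exact: measurableI.
have mBDi : measurable (B `\` F i) by exact: measurableD.
have h1 : k.-1%:R * mu (B `&` F i) <= \sum_(j <- s) mu ((B `&` F i) `&` F j).
  apply: IH => // r [Br Fi] Or; have := kB r Br Or.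
  by rewrite big_cons asboolT//= add1n; case: (k).
have h2 : k%:R * mu (B `\` F i) <= \sum_(j <- s) mu ((B `\` F i) `&` F j).
  apply: IH => // r [Br Fi] Or; have := kB r Br Or.
  by rewrite big_cons asboolF.
have h3 : \sum_(j <- s) mu ((B `&` F i) `&` F j) +
  \sum_(j <- s) mu ((B `\` F i) `&` F j) = \sum_(j <- s) mu (B `&` F j).
  rewrite -big_split/=; apply: eq_bigr => j _.
  rewrite (mu_split (measurableI _ _ mB (mF j)) (mF i)).
  by congr (mu _ + mu _); apply/seteqP; split=> z /=; tauto.
rewrite -h3 addrA; apply: lerD => //.
have : k%:R <= 1 + k.-1%:R :> R by case: (k) => [|k'] /=; rewrite ?nat1r ?addr0.
move=> /(ler_wpM2r (mu_ge0 (B `&` F i))) /le_trans; apply.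
by rewrite mulrDl mul1r lerD2l.
Qed.

(** The cylinder of order [n] around [x]. *)
Definition cyl x n : set R :=
  [set y | irr01 y /\ forall i, (0 < i <= n)%N -> cf_digit y i = cf_digit x i].

Lemma cyl_self x n : irr01 x -> cyl x n x. Proof. by []. Qed.

(** The factor [(-1)^n] is the determinant of the convergents; its sign tells
    on which side of [p_n/q_n] the cylinder lies. *)
Lemma mobius_sub a n t : (forall i, 0 < a i.+1)%N -> 0 <= t ->
  mobius a n t - (cf_nums a n).1%:R / (cf_den a n)%:R =
  (- 1) ^+ n * (t / ((cf_den a n)%:R * ((cf_den a n)%:R + t * (cf_den_pred a
    n)%:R))).
Proof.
move=> a0 t0; rewrite -(cf_det R a n) /mobius.
have d0 := mobius_den_gt0 n a0 t0.
have q0 : 0 < (cf_den a n)%:R :> R by rewrite ltr0n cf_den_gt0.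
by field; rewrite !gt_eqF.
Qed.

Lemma cyl_length_lt (q q' s t : R) : 0 < q -> 0 <= q' -> 0 <= s -> 0 <= t ->
  (s / (q * (q + s * q')) < t / (q * (q + t * q'))) = (s < t).
Proof.
move=> q0 q'0 s0 t0.
have d1 : 0 < q * (q + s * q') by rewrite mulr_gt0// ltr_pwDl// mulr_ge0.
have d2 : 0 < q * (q + t * q') by rewrite mulr_gt0// ltr_pwDl// mulr_ge0.
rewrite ltr_pdivrMr// mulrAC ltr_pdivlMr//.
rewrite -subr_gt0 -[RHS]subr_gt0.
have -> : t * (q * (q + s * q')) - s * (q * (q + t * q')) = (q * q) * (t - s).
  by ring.
by rewrite pmulr_rgt0// mulr_gt0.
Qed.

(** Solving [u = t / (q (q + t q'))] for [t]; the bound on [u] keeps the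
    solution in range. *)
Lemma mobius_onto a n t y : (forall i, 0 < a i.+1)%N -> 0 < t ->
  let q : R := (cf_den a n)%:R in let q' : R := (cf_den_pred a n)%:R in
  0 < (- 1) ^+ n * (y - (cf_nums a n).1%:R / q) < t / (q * (q + t * q')) ->
  exists2 s, 0 < s < t & y = mobius a n s.
Proof.
move=> a0 t0 q q'.
have q0 : 0 < q by rewrite ltr0n cf_den_gt0.
have q'0 : 0 <= q' by [].
set u : R := (- 1) ^+ n * _ => /andP[u0 ut].
have uE : (- 1) ^+ n * u = y - (cf_nums a n).1%:R / q.
  by rewrite /u mulrA -expr2 sqrr_sign mul1r.
clearbody u.
have d2 : 0 < q * (q + t * q').
  by rewrite mulr_gt0// ltr_pwDl// mulr_ge0// ltW.
move: ut; rewrite ltr_pdivlMr// => ut.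
have qqu : 0 < q * q * u by rewrite !mulr_gt0.
have d1 : 0 < 1 - q * q' * u.
  have : 0 < t * (1 - q * q' * u) by lra.
  by rewrite pmulr_rgt0.
pose s := q * q * u / (1 - q * q' * u).
have s0 : 0 < s by exact: divr_gt0.
exists s; first by rewrite s0 ltr_pdivrMr//=; lra.
apply: (@addIr _ (- ((cf_nums a n).1%:R / q))).
rewrite (mobius_sub n a0 (ltW s0)) -/q -/q'.
have -> : s / (q * (q + s * q')) = u.
  rewrite /s; field; rewrite !gt_eqF//=.
  have -> : q * (1 - q * q' * u) + q * q * u * q' = q by ring.
  by [].
by rewrite uE.
Qed.

(** The Moebius map is monotone, so fixing the digits and bounding the tail
    describes an interval with endpoint [p_n/q_n]. *)
Lemma cyl_itv x n t : irr01 x -> 0 < t <= 1 ->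
  let q : R := (cf_den (cf_digit x) n)%:R in
  let q' : R := (cf_den_pred (cf_digit x) n)%:R in
  cyl x n `&` [set y | iter n (@gauss_map R) y < t] =
  @irr01 R `&` [set y | 0 < (- 1) ^+ n *
      (y - (cf_nums (cf_digit x) n).1%:R / q) < t / (q * (q + t * q'))].
Proof.
move=> Ox /andP[t0 t1] q q'; have a0 := cf_digit_gt0 Ox.
have q0 : 0 < q by rewrite ltr0n cf_den_gt0.
have q'0 : 0 <= q' by [].
have sg : (- 1) ^+ n * (- 1) ^+ n = 1 :> R by rewrite -expr2 sqrr_sign.
apply/seteqP; split => y /=.
  move=> [[Oy xy] yt]; split=> //.
  have s0 : 0 < iter n (@gauss_map R) y by apply: irr01_gt0; exact: irr01_iter.
  have := mobius_sub n (cf_digit_gt0 Oy) (ltW s0).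
  rewrite -(cf_tail_mobius n Oy); have [-> ->] := cf_den_ext xy.
  rewrite (cf_nums_ext xy) -/q -/q' => ->; rewrite mulrA sg mul1r.
  rewrite cyl_length_lt// ?yt ?(ltW s0) ?(ltW t0)// divr_gt0//.
  by rewrite mulr_gt0// ltr_pwDl// mulr_ge0// ltW.
move=> [Oy /(mobius_onto a0 t0)[s /andP[s0 st] ys]].
have s01 : 0 < s < 1 by rewrite s0 (lt_le_trans st).
have [h1 h2] := mobius_digits n a0 s01; rewrite -ys in h1 h2.
by rewrite h2.
Qed.

Lemma mobius_01 a n s : (forall i, 0 < a i.+1)%N -> 0 < s < 1 ->
  0 < mobius a n s < 1.
Proof.
move=> a0; elim: n s => [|n IH] s s01.
  by rewrite /mobius /= mulr1 mulr0 add0r addr0 divr1.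
have /andP[s0 s1] := s01.
rewrite mobiusS ?ltW// IH// invr_gt0 ltr_pwDl ?ltr0n ?ltW//=.
by rewrite invf_lt1 ltr_pwDr ?(ler_nat R 1) ?a0// ltW.
Qed.

Lemma lebesgue_signed_itv n (c r : R) :
  measurable [set y : R | 0 < (- 1) ^+ n * (y - c) < r] /\
  (0 < r -> lebesgue_measure [set y : R | 0 < (- 1) ^+ n * (y - c) < r] = r%:E).
Proof.
have [/= no|/= ne] := boolP (odd n); rewrite -signr_odd.
  have -> : [set y : R | 0 < (- 1) ^+ odd n * (y - c) < r] = `]c - r,
    c[%classic.
    apply/seteqP; split=> y /=; rewrite in_itv/= no expr1; lra.
  split=> // r0; rewrite lebesgue_measure_itv/= lte_fin ltrBlDr ltrDl r0.
  by rewrite -EFinB subKr.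
have -> : [set y : R | 0 < (- 1) ^+ odd n * (y - c) < r] = `]c, c + r[%classic.
  apply/seteqP; split=> y /=; rewrite in_itv/= (negbTE ne) expr0; lra.
split=> // r0; rewrite lebesgue_measure_itv/= lte_fin ltrDl r0.
by rewrite -EFinB addrC addKr.
Qed.

Lemma measurable_cyl_tail x n t : irr01 x -> 0 < t <= 1 ->
  measurable (cyl x n `&` [set y | iter n (@gauss_map R) y < t]).
Proof.
move=> Ox t01; rewrite (cyl_itv n Ox t01); apply: measurableI.
  exact: measurable_irr01.
by have [] := lebesgue_signed_itv n ((cf_nums (cf_digit x) n).1%:R / (cf_den
  (cf_digit x) n)%:R)
  (t / ((cf_den (cf_digit x) n)%:R * ((cf_den (cf_digit x) n)%:R + t *
    (cf_den_pred (cf_digit x) n)%:R))).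
Qed.

Lemma cyl_tail1 x n :
  cyl x n = cyl x n `&` [set y | iter n (@gauss_map R) y < 1].
Proof.
apply/seteqP; split => y; last by case.
by move=> h; split=> //=; apply: irr01_lt1; apply: irr01_iter; case: h.
Qed.

Lemma measurable_cyl x n : irr01 x -> measurable (cyl x n).
Proof.
by move=> Ox; rewrite cyl_tail1; apply: measurable_cyl_tail => //;
  rewrite ltr01 lexx.
Qed.

(** This is the conditional distribution of the tail given the digits, from
    which all the probability estimates follow. *)
Lemma mu_cyl_tail x n t : irr01 x -> 0 < t <= 1 ->
  let q : R := (cf_den (cf_digit x) n)%:R in
  let q' : R := (cf_den_pred (cf_digit x) n)%:R in
  mu (cyl x n `&` [set y | iter n (@gauss_map R) y < t]) =
  t / (q * (q + t * q')).
Proof.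
move=> Ox t01 q q'; apply: EFin_inj; rewrite muE;
  last exact: measurable_cyl_tail.
rewrite (cyl_itv n Ox t01) -/q -/q' setIC setIA setIid.
set S := [set y | _].
have [mS lS] := lebesgue_signed_itv n ((cf_nums (cf_digit x) n).1%:R / q) (t /
  (q * (q + t * q'))).
have a0 := cf_digit_gt0 Ox.
have q0 : 0 < q by rewrite ltr0n cf_den_gt0.
have /andP[t0 t1] := t01.
have d2 : 0 < q * (q + t * q').
  by rewrite mulr_gt0// ltr_pwDl// mulr_ge0// ltW.
rewrite -lS ?divr_gt0// -(lebesgue_irrational mS).
congr lebesgue_measure; apply/seteqP; split => y; first by case=> -[_ ? ?].
move=> [Sy iy]; split=> //; split=> //=; rewrite in_itv/=.
have [s /andP[s0 st] ->] := mobius_onto a0 t0 Sy.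
by rewrite mobius_01// s0 (lt_le_trans st).
Qed.

Lemma mu_cyl x n : irr01 x ->
  let q : R := (cf_den (cf_digit x) n)%:R in
  let q' : R := (cf_den_pred (cf_digit x) n)%:R in
  mu (cyl x n) = (q * (q + q'))^-1.
Proof.
move=> Ox q q'; rewrite cyl_tail1 mu_cyl_tail//; last by rewrite ltr01 lexx.
by rewrite !mul1r.
Qed.

End GaussPartition.

(** * Events that depend on finitely many digits *)

Section AdaptedEvents.
Variable R : realType.
Implicit Types (a : nat -> nat) (x y s t : R) (A B E F : set R) (n : nat).

(** Membership depends on the first [n] digits only: these are the events of
    the [n]-th sigma-algebra of the natural filtration. *)
Definition adapted n A :=
  (forall x, A x -> irr01 x) /\ (forall x y, A x -> cyl x n y -> A y).

(** A number that encodes the first [n] digits, which indexes the countable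
    partition into cylinders. *)
Definition digit_code n x : nat := pickle [seq cf_digit x i | i <- iota 1 n].

Lemma digit_codeP n x y : irr01 y -> digit_code n y = digit_code n x <->
  cyl x n y.
Proof.
move=> Oy; split => [/(pcan_inj (@pickleK _)) e|[_ xy]].
  split=> // i /andP[i0 ni]; have := congr1 (nth 0%N ^~ i.-1) e.
  have ii : (i.-1 < n)%N by rewrite prednK.
  by rewrite !(nth_map 0%N) ?size_iota// nth_iota// add1n prednK.
congr pickle; apply/eq_in_map => i; rewrite mem_iota => /andP[i1 ni].
by apply: xy; rewrite i1.
Qed.

Lemma adapted_piece n A k : adapted n A ->
  A `&` [set y | digit_code n y = k] = set0 \/
  exists2 x, A x & A `&` [set y | digit_code n y = k] = cyl x n.
Proof.
move=> [AO Acyl]; set P := _ `&` _.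
have [[x [Ax xk]]|nx] := pselect (exists x, P x); last first.
  by left; apply/seteqP; split=> // x Px; case: nx; exists x.
right; exists x => //; apply/seteqP; split => y.
  by move=> [Ay yk]; apply/digit_codeP; [exact: AO|rewrite yk xk].
move=> h; split; first exact: Acyl h.
by move/digit_codeP : (h) => /= ->//; case: h.
Qed.

(** Countably many cylinders of order [n] cover, and each is an interval up to
    rational points. *)
Lemma adapted_measurable n A : adapted n A -> measurable A.
Proof.
move=> adA; have -> : A = \bigcup_k (A `&` [set y | digit_code n y = k]).
  apply/seteqP; split => y; first by move=> Ay; exists (digit_code n y).
  by case=> k _ [].
apply: bigcup_measurable => k _.
have [->//|[x Ax ->]] := adapted_piece k adA.
by apply: measurable_cyl; case: adA => AO _; exact: AO.
Qed.

Lemma adapted_cyl x n : adapted n (cyl x n).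
Proof.
split; first by move=> y [].
by move=> y z [Oy xy] [Oz yz]; split=> // i ni; rewrite yz// xy.
Qed.

Lemma adapted_le m n A : (m <= n)%N -> adapted m A -> adapted n A.
Proof.
move=> mn [AO Ac]; split=> // x y Ax [Oy xy]; apply: Ac Ax _; split=> // i.
by move=> /andP[i0 im]; rewrite xy// i0 (leq_trans im).
Qed.

Lemma adaptedI n A B : adapted n A -> adapted n B -> adapted n (A `&` B).
Proof.
move=> [AO Ac] [BO Bc]; split; first by move=> x [/AO].
by move=> x y [Ax Bx] xy; split; [exact: Ac xy|exact: Bc xy].
Qed.

Lemma adapted_pred n (P : (nat -> nat) -> Prop) :
  (forall a b, (forall i, (0 < i <= n)%N -> a i = b i) -> P a -> P b) ->
  adapted n [set x : R | irr01 x /\ P (cf_digit x)].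
Proof.
move=> Pext; split; first by move=> x [].
move=> x y [Ox Px] [Oy xy]; split=> //; apply: Pext Px => i ni.
by rewrite xy.
Qed.

(** Sum over the countably many cylinders that make up the event: a
    conditional inequality on each of them integrates. *)
Lemma mu_adapted_le n A E F (c : R) : adapted n A -> 0 <= c ->
  measurable E -> measurable F ->
  (forall x, A x -> mu (cyl x n `&` E) <= c * mu (cyl x n `&` F)) ->
  mu (A `&` E) <= c * mu (A `&` F).
Proof.
move=> adA c0 mE mF AEF; have mA := adapted_measurable adA.
pose D k := A `&` [set y | digit_code n y = k].
have mD k : measurable (D k).
  rewrite /D; have [->//|[x Ax ->]] := adapted_piece k adA.
  by apply: measurable_cyl; case: adA => AO _; exact: AO.
have sumD G : measurable G ->
    (mu (A `&` G))%:E = (\sum_(0 <= k <oo) (mu (D k `&` G))%:E)%E.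
  move=> mG; rewrite muE; last exact: measurableI.
  rewrite (eq_eseriesr (g := fun k =>
    lebesgue_measure (D k `&` G `&` @irr01 R)));
    last by move=> k _; rewrite muE//; exact: measurableI.
  have -> : A `&` G `&` @irr01 R = \bigcup_k (D k `&` G `&` @irr01 R).
    apply/seteqP; split => y; first by move=> [[Ay Gy] Oy];
      exists (digit_code n y).
    by case=> k _ [[[Ay _] Gy] Oy].
  have mDG k : measurable (D k `&` G `&` @irr01 R).
    by apply: measurableI; [exact: measurableI|exact: measurable_irr01].
  rewrite (measure_bigcup (@lebesgue_measure R) [set: nat]
    (fun k => D k `&` G `&` @irr01 R)).
  - by apply: eq_eseriesl => k; rewrite in_setT.
  - by move=> k _; exact: (mDG k).
  move=> i j _ _ [y [[[[_ yi] _] _] [[[_ yj] _] _]]].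
  by rewrite -yi -yj.
rewrite -lee_fin EFinM !sumD// -nneseriesZl; last by move=> k _;
  rewrite lee_fin mu_ge0.
apply: lee_nneseries => k _; first by rewrite lee_fin mu_ge0.
rewrite -EFinM lee_fin.
have [e|[x Ax e]] := adapted_piece k adA; rewrite -/(D k) in e; rewrite e.
  by rewrite !set0I /mu set0I measure0 mulr0.
exact: AEF.
Qed.

Definition digit_ge n b : set R := [set y | irr01 y /\
  (b <= cf_digit y n.+1)%N].

Lemma adapted_digit_ge n b : adapted n.+1 (digit_ge n b).
Proof.
by apply: (@adapted_pred _ (fun a => (b <= a n.+1)%N)) => a a' <-//;
  rewrite ltnS leqnn.
Qed.

Lemma measurable_digit_ge n b : measurable (digit_ge n b).
Proof. exact: adapted_measurable (adapted_digit_ge n b). Qed.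
Hint Resolve measurable_digit_ge : core.

(** The reciprocal of the [n]-th tail has integer part [a_(n+1)];
    irrationality excludes equality. *)
Lemma digit_geE n b : (0 < b)%N -> digit_ge n b =
  @irr01 R `&` [set y | iter n (@gauss_map R) y < b%:R^-1].
Proof.
move=> b0; apply/seteqP; split => y /= [Oy h]; split=> //;
  have Ot := irr01_iter n Oy; have t0 := irr01_gt0 Ot;
  have ne : iter n (@gauss_map R) y != b%:R^-1.
- by case: Ot => _ ir; apply/eqP => e; apply: (@irrational_neq _ _ 1 b ir);
  rewrite mul1r.
- rewrite lt_neqAle ne -[leLHS]invrK lef_pV2 ?posrE ?invr_gt0 ?ltr0n//.
  apply: le_trans (_ : (cf_digit y n.+1)%:R <= _); first by rewrite ler_nat.
  by rewrite cf_digitE// lerDl ltW// irr01_gt0//; exact: (irr01_iter n.+1).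
- by case: Ot => _ ir; apply/eqP => e; apply: (@irrational_neq _ _ 1 b ir);
  rewrite mul1r.
- rewrite -ltnS -(ltr_nat R) -natr1.
  have : b%:R < (iter n (@gauss_map R) y)^-1 by rewrite -[ltLHS]invrK ltf_pV2
    ?posrE ?invr_gt0 ?ltr0n.
  rewrite cf_digitE//; move=> /lt_le_trans; apply.
  by rewrite lerD2l ltW// irr01_lt1//; exact: (irr01_iter n.+1).
Qed.

Lemma mu_cyl_digit_ge x n b : irr01 x -> (0 < b)%N ->
  let q : R := (cf_den (cf_digit x) n)%:R in
  let q' : R := (cf_den_pred (cf_digit x) n)%:R in
  mu (cyl x n `&` digit_ge n b) = b%:R^-1 / (q * (q + b%:R^-1 * q')).
Proof.
move=> Ox b0 q q'; rewrite digit_geE// setIA.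
have -> : cyl x n `&` @irr01 R = cyl x n.
  by apply/seteqP; split => y; [case|move=> h; split=> //; case: h].
by rewrite mu_cyl_tail// invr_gt0 ltr0n b0 invf_le1 ?ltr0n// ler1n.
Qed.

Lemma mu_digit_ge_upper n A b : adapted n A -> (0 < b)%N ->
  mu (A `&` digit_ge n b) <= 2 / b%:R * mu A.
Proof.
move=> adA b0; rewrite -[X in _ * mu X](setIT A).
have mA := adapted_measurable adA.
apply: (mu_adapted_le adA) => // x Ax; have Ox : irr01 x by case: adA => + _;
  exact.
rewrite setIT mu_cyl_digit_ge// mu_cyl//.
have a0 := cf_digit_gt0 Ox.
set q : R := (cf_den _ _)%:R; set q' : R := (cf_den_pred _ _)%:R.
have q0 : 0 < q by rewrite ltr0n cf_den_gt0.
have q'0 : 0 <= q' by [].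
have qq' : q' <= q by rewrite ler_nat cf_den_pred_le.
have bV : 0 < b%:R^-1 :> R by rewrite invr_gt0 ltr0n.
have bq : 0 <= b%:R^-1 * q' by rewrite mulr_ge0// ltW.
rewrite [2 / _]mulrC -mulrA ler_pM2l//.
rewrite ler_pdivlMr ?mulr_gt0 ?ltr_pwDl// mulrC ler_pdivrMr ?mulr_gt0
  ?ltr_pwDl//.
rewrite mulrCA ler_pM2l//; lra.
Qed.

Lemma mu_digit_ge_lower n A b : adapted n A -> (0 < b)%N ->
  mu A <= b%:R * mu (A `&` digit_ge n b).
Proof.
move=> adA b0; rewrite -[X in mu X <= _](setIT A).
have mA := adapted_measurable adA.
apply: (mu_adapted_le adA) => // x Ax; have Ox : irr01 x by case: adA => + _;
  exact.
rewrite setIT mu_cyl_digit_ge// mu_cyl//.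
have a0 := cf_digit_gt0 Ox.
set q : R := (cf_den _ _)%:R; set q' : R := (cf_den_pred _ _)%:R.
have q0 : 0 < q by rewrite ltr0n cf_den_gt0.
have q'0 : 0 <= q' by [].
have bn0 : b%:R != 0 :> R by rewrite pnatr_eq0 -lt0n.
have bV : 0 < b%:R^-1 :> R by rewrite invr_gt0 ltr0n.
have bV1 : b%:R^-1 <= 1 :> R by rewrite invf_le1 ?ltr0n// ler1n.
have bq : 0 <= b%:R^-1 * q' by rewrite mulr_ge0// ltW.
rewrite mulrA divff// mul1r lef_pV2 ?posrE ?mulr_gt0 ?ltr_pwDl//.
by rewrite ler_pM2l// lerD2l ler_piMl.
Qed.

End AdaptedEvents.

(** * Markov's inequality for digits *)

Section DigitSums.
Variable R : realType.
Implicit Types (a : nat -> nat) (x y s t : R) (A B E F I : set R) (m n : nat).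

Definition digit_sum a n : nat := (\sum_(1 <= i < n.+1) a i)%N.

Lemma digit_sumS a n : digit_sum a n.+1 = (digit_sum a n + a n.+1)%N.
Proof. by rewrite /digit_sum big_nat_recr. Qed.

Lemma digit_sum_mono a m n : (m <= n)%N -> (digit_sum a m <= digit_sum a n)%N.
Proof.
elim: n => [|n IH]; first by rewrite leqn0 => /eqP->.
rewrite leq_eqVlt => /predU1P[->//|]; rewrite ltnS => /IH/leq_trans; apply.
by rewrite digit_sumS leq_addr.
Qed.

Lemma digit_sum_ge a n : (forall i, 0 < a i.+1)%N -> (n <= digit_sum a n)%N.
Proof.
move=> a0; elim: n => // n IH; rewrite digit_sumS -[leqLHS]addn1.
by rewrite leq_add// a0.
Qed.

Lemma digit_sum_ext a b n : (forall i, (0 < i <= n)%N -> a i = b i) ->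
  digit_sum a n = digit_sum b n.
Proof.
by move=> ab; apply: eq_big_nat => i /andP[i0 ni]; rewrite ab// i0 -ltnS.
Qed.

(** The expected number of pairs of a time in [[m, n)] and a threshold [b] of
    [ts] reached by the next digit is at most [sum 2/b] per unit of time. *)
Lemma markov_digits I B m n k (ts : seq nat) :
  adapted m I -> measurable B -> B `<=` I -> all (leq 1) ts ->
  (forall y, B y ->
    (k <= \sum_(m <= i < n) count (fun b => (b <= cf_digit y i.+1)%N) ts)%N) ->
  k%:R * mu B <= (n - m)%:R * (\sum_(b <- ts) 2 / b%:R) * mu I.
Proof.
move=> adI mB BI ts1 kB; have mI := adapted_measurable adI.
pose F (ib : nat * nat) := @digit_ge R ib.1 ib.2.
have mF ib : measurable (F ib) by exact: measurable_digit_ge.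
have := @mu_markov R _ [seq (i, b) | i <- index_iota m n, b <- ts] F B k mB mF.
move=> /(_ _)/le_trans; apply.
  move=> y By Oy; rewrite big_allpairs_dep/=; apply: leq_trans (kB y By) _.
  apply: leq_sum => i _; rewrite -sum1_count big_mkcond/=.
  apply: leq_sum => b _; case: ifP => // bi.
  by rewrite /F/digit_ge/= asboolT.
rewrite big_allpairs_dep/= -mulrA -[X in X%:R](size_iota m) -/(index_iota m n).
rewrite -sum1_size natr_sum mulr_suml big_nat [leRHS]big_nat.
apply: ler_sum => i /andP[mi ni]; rewrite mul1r mulr_suml.
rewrite big_seq [leRHS]big_seq; apply: ler_sum => b /(allP ts1) b0.
apply: le_trans (mu_digit_ge_upper (adapted_le mi adI) b0).
by apply: mu_mono; [exact: measurableI|exact: measurableI (mF (i, b))|move=>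
  y [[By Fy] _]; split; [exact: BI|]].
Qed.

(** A bounded digit is the number of thresholds that it reaches. *)
Lemma count_leq_iota k r : (k < 2 ^ r)%N ->
  count (fun b => (b <= k)%N) (index_iota 1 (2 ^ r)) = k.
Proof.
move=> kr; rewrite /index_iota -(subnKC kr).
have -> : (k.+1 + (2 ^ r - k.+1) - 1 = k + (2 ^ r - k.+1))%N by rewrite addSn
  subn1.
rewrite iotaD count_cat.
have /eqP -> : count (fun b => (b <= k)%N) (iota 1 k) == size (iota 1 k).
  by rewrite -all_count; apply/allP => i; rewrite mem_iota add1n ltnS =>
    /andP[].
rewrite size_iota; apply/eqP; rewrite -[X in _ == X]addn0 eqn_add2l -leqn0
  leqNgt -has_count.
apply/hasPn => i; rewrite mem_iota add1n => /andP[+ _].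
by rewrite -ltnNge.
Qed.

(** The logarithm of a bounded digit is the number of powers of two that it
    reaches. *)
Lemma count_pow2 k r : (0 < k < 2 ^ r)%N ->
  (k.+1 <= 2 ^ (count (fun b => (b <= k)%N) [seq (2 ^ j)%N | j <- index_iota 1
    r]).+1)%N.
Proof.
move=> /andP[k0 kr]; rewrite count_map.
have lk : (trunc_log 2 k < r)%N by rewrite -(@ltn_exp2l 2)// (leq_ltn_trans _
  kr)// trunc_logP.
apply: leq_trans (trunc_log_ltn k (isT : (1 < 2)%N)) _.
rewrite leq_exp2l// ltnS /index_iota.
have rE : (r - 1 = trunc_log 2 k + (r - (trunc_log 2 k).+1))%N by rewrite
  subn1; lia.
rewrite rE iotaD count_cat; apply: leq_trans (leq_addr _ _).
have /eqP -> : count (preim (fun j => 2 ^ j)%N (fun b =>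
  (b <= k)%N)) (iota 1 (trunc_log 2 k))
    == size (iota 1 (trunc_log 2 k)).
  rewrite -all_count; apply/allP => j; rewrite mem_iota add1n ltnS =>
    /andP[_ jk] /=.
  apply: leq_trans (trunc_logP (isT : (1 < 2)%N) k0).
  by rewrite leq_exp2l.
by rewrite size_iota.
Qed.

Lemma sum_inv_pow2 r : \sum_(1 <= b < 2 ^ r) (b%:R^-1 : R) <= r%:R.
Proof.
elim: r => [|r IH]; first by rewrite expn0 big_geq.
rewrite (@big_cat_nat _ _ _ (2 ^ r))/= ?expn_gt0 ?leq_exp2l//.
rewrite -natr1; apply: lerD => //.
apply: (@le_trans _ _ (\sum_(2 ^ r <= b < 2 ^ r.+1) ((2 ^ r)%:R^-1 : R))).
  rewrite big_nat [leRHS]big_nat; apply: ler_sum => b /andP[rb _].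
  by rewrite lef_pV2 ?posrE ?ltr0n ?expn_gt0 ?(leq_trans _ rb) ?expn_gt0//
    ler_nat.
rewrite sumr_const_nat expnS mul2n -addnn addnK.
by rewrite -[X in X *+ _]mulr1 -mulrnAr mulVf// pnatr_eq0 -lt0n expn_gt0.
Qed.

Lemma sum_inv_geom r :
  \sum_(b <- [seq (2 ^ j)%N | j <- index_iota 1 r]) (2 / b%:R : R) <= 2.
Proof.
rewrite big_map; suff : \sum_(1 <= j < r) (2 / (2 ^ j)%:R : R) <= 2 - 4 * (2 ^
  r)%:R^-1 *+ (0 < r).
  by move/le_trans; apply; rewrite lerBlDr lerDl mulrn_wge0 ?mulr_ge0.
elim: r => [|r IH]; first by rewrite big_geq// mulr0n subr0.
case: r IH => [|r] IH; first by rewrite big_geq//= expn1 mulr1n; lra.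
rewrite big_nat_recr//=.
apply: le_trans (lerD IH (lexx _)) _;
  rewrite /= !mulr1n ![(2 ^ r.+2)%N]expnS natrM.
have : (2 ^ r.+1)%:R != 0 :> R by rewrite pnatr_eq0 -lt0n expn_gt0.
move=> n0; rewrite invfM; lra.
Qed.

End DigitSums.

(** * Typical growth of digit sums and denominators *)

Section Growth.
Variable R : realType.
Implicit Types (a : nat -> nat) (x y s t : R) (A B E F I : set R) (m n : nat).

Lemma digit_sum_split a m n : (m <= n)%N ->
  digit_sum a n = (digit_sum a m + \sum_(m <= i < n) a i.+1)%N.
Proof.
move=> mn; rewrite /digit_sum (@big_cat_nat _ _ _ m.+1)//=; congr addn.
by rewrite big_add1.
Qed.

(** Each step multiplies the denominator by at most [a_(i+1) + 1]. *)
Lemma cf_den_growth a m n (l : nat -> nat) : (forall i, 0 < a i.+1)%N ->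
  (m <= n)%N ->
  (forall i, (m <= i < n)%N -> (a i.+1).+1 <= 2 ^ (l i).+1)%N ->
  (cf_den a n <= cf_den a m * 2 ^ ((n - m) + \sum_(m <= i < n) l i))%N.
Proof.
move=> a0; elim: n => [|n IH] mn al.
  by move: mn; rewrite leqn0 => /eqP->; rewrite big_geq// muln1.
move: mn; rewrite leq_eqVlt => /predU1P[->|];
  first by rewrite subnn big_geq// muln1.
rewrite ltnS => mn; rewrite big_nat_recr// subSn// addSn -addnS -addnS addnA.
rewrite expnD mulnA.
apply: (@leq_trans (cf_den a n * (a n.+1).+1)).
  rewrite cf_denS mulnSr mulnC leq_add2l; exact: cf_den_pred_le.
apply: leq_mul; last by rewrite al// mn ltnSn.
by apply: IH => // i /andP[mi ni]; rewrite al// mi ltnW.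
Qed.

(** A digit sum of [n] terms has infinite mean, so it is truncated: with high
    probability no digit reaches [2^r], and then the sum and the logarithm of
    the denominator are counts of thresholds below [2^r], to which Markov's
    inequality applies. *)
Lemma mu_growth I m n (s0 Q0 r L1 L2 : nat) : adapted m I -> (m <= n)%N ->
  (0 < r)%N ->
  (forall y, I y -> (digit_sum (cf_digit y) m <= s0)%N /\
    (cf_den (cf_digit y) m <= Q0)%N) ->
  mu (I `&` [set y | irr01 y /\ ((s0 + L1 < digit_sum (cf_digit y) n)%N \/
     (Q0 * 2 ^ (n + L2) < cf_den (cf_digit y) n)%N)]) <=
  n%:R * (2 / (2 ^ r)%:R + 2 * r%:R / L1.+1%:R + 2 / L2.+1%:R) * mu I.
Proof.
move=> adI mn r0 Ib; set B := I `&` _.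
pose Big := [set y : R | irr01 y /\ exists2 i,
  (m <= i < n)%N & (2 ^ r <= cf_digit y i.+1)%N].
pose Sum := [set y : R | irr01 y /\ (L1 < \sum_(m <= i < n) cf_digit y i.+1)%N].
have adB : adapted n B.
  apply: adaptedI; first exact: adapted_le adI.
  apply: (@adapted_pred _ _ (fun a =>
    (s0 + L1 < digit_sum a n)%N \/ (Q0 * 2 ^ (n + L2) < cf_den a n)%N)).
  by move=> a b ab; rewrite (digit_sum_ext ab) (cf_den_ext ab).1.
have adBig : adapted n Big.
  apply: (@adapted_pred _ _ (fun a => exists2 i,
    (m <= i < n)%N & (2 ^ r <= a i.+1)%N)).
  by move=> a b ab [i mi ri]; exists i => //; rewrite -ab//; case/andP: mi.
have adSum : adapted n Sum.
  apply: (@adapted_pred _ _ (fun a => (L1 < \sum_(m <= i < n) a i.+1)%N)).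
  move=> a b ab; rewrite (@eq_big_nat _ _ _ _ _ _ (b \o S))//.
  by move=> i mi /=; rewrite ab//; case/andP: mi.
have mB := adapted_measurable adB.
have mBig := adapted_measurable adBig; have mSum := adapted_measurable adSum.
have mB1 : measurable (B `&` Big) by exact: measurableI.
have mB2 : measurable (B `\` Big) by exact: measurableD.
have mB3 : measurable ((B `\` Big) `&` Sum) by exact: measurableI.
have mB4 : measurable ((B `\` Big) `\` Sum) by exact: measurableD.
have small y i : (B `\` Big) y -> (m <= i < n)%N ->
  (0 < cf_digit y i.+1 < 2 ^ r)%N.
  move=> [[Iy [Oy _]] nb] mi; rewrite cf_digit_gt0//= ltnNge; apply/negP => ri.
  by apply: nb; split=> //; exists i.
have nm : (n - m)%:R <= n%:R :> R by rewrite ler_nat leq_subr.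
have fin (u v w : R) k : k.+1%:R * u <= (n - m)%:R * v * mu I -> 0 <= v ->
  v <= w ->
    u <= n%:R * (w / k.+1%:R) * mu I.
  move=> h v0 vw; rewrite mulrA [_ / _]mulrC -2!mulrA -ler_pdivrMl ?invr_gt0//
    invrK.
  apply: le_trans h _; rewrite mulrA; apply: ler_wpM2r; first exact: mu_ge0.
  by apply: ler_pM.
rewrite (mu_split mB mBig) (mu_split mB2 mSum) 2!mulrDr 2!mulrDl -addrA.
apply: lerD; [|apply: lerD].
- have := @markov_digits _ I _ m n 1 [:: (2 ^ r)%N] adI mB1.
  move=> /(_ _ _ _)/(fin _ _ (2 / (2 ^ r)%:R) 0%N); rewrite divr1; apply => //.
  + by move=> y [[]].
  + by rewrite /= expn_gt0.
  + move=> y [_ [Oy [i mi ri]]]; rewrite (bigD1_seq i) ?mem_index_iota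
    ?iota_uniq//=.
    by rewrite ri.
  + by rewrite big_seq1 divr_ge0.
  + by rewrite big_seq1.
- have := @markov_digits _ I _ m n L1.+1 (index_iota 1 (2 ^ r)) adI mB3.
  move=> /(_ _ _ _)/(fin _ _ (2 * r%:R)); apply => //.
  + by move=> y [[[]]].
  + by apply/allP => b; rewrite mem_index_iota => /andP[].
  + move=> y [yB [Oy yS]]; apply: leq_trans yS _;
    rewrite big_nat [leqRHS]big_nat.
    apply: leq_sum => i mi; rewrite count_leq_iota//.
    by case/andP: (small _ _ yB mi).
  + by apply: sumr_ge0 => b _; rewrite divr_ge0.
  + by rewrite -mulr_sumr ler_pM2l// sum_inv_pow2.
- have := @markov_digits _ I _ m n L2.+1 [seq (2 ^ j)%N | j <- index_iota 1 r]
  adI mB4.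
  move=> /(_ _ _ _)/(fin _ _ 2); apply => //.
  + by move=> y [[[]]].
  + by apply/allP => b /mapP[j _ ->]; rewrite expn_gt0.
  + move=> y [yB nS]; have [[Iy [Oy yb]] _] := yB.
    have [h1 h2] := Ib y Iy; have a0 := cf_digit_gt0 Oy.
    case: yb => [|yb].
      rewrite (digit_sum_split _ mn) ltnNge leq_add//.
      by rewrite leqNgt; apply/negP => h; apply: nS.
    rewrite leqNgt; apply/negP; rewrite ltnS => h; move: yb; rewrite ltnNge =>
      /negP; apply.
    apply: leq_trans (cf_den_growth a0 mn _) _.
    * by move=> i mi; apply: (@count_pow2 _ r); exact: small.
    * by apply: leq_mul => //; rewrite leq_exp2l// leq_add// leq_subr.
  + by apply: sumr_ge0 => b _; rewrite divr_ge0.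
  + exact: sum_inv_geom.
Qed.

(** The size at time [2^(J+1)] that is typical up to the constant [C]: [n log
    n] for the digit sum and exponential for the denominator. *)
Definition tame C J a : Prop :=
  (digit_sum a (2 ^ J.+1) <= C * (J * 2 ^ J))%N /\
  (cf_den a (2 ^ J.+1) <= 2 ^ (C * 2 ^ J))%N.

Lemma tame_ext C J a b :
  (forall i, (0 < i <= 2 ^ J.+1)%N -> a i = b i) -> tame C J a -> tame C J b.
Proof. by move=> ab; rewrite /tame (digit_sum_ext ab) (cf_den_ext ab).1. Qed.

(** The bound holds with the same [C] on every cylinder; only the threshold
    [J0] depends on the cylinder, since it absorbs the initial digits. *)
Lemma mu_tame (eta : R) : 0 < eta -> exists2 C, (0 < C)%N &
  forall x m, irr01 x -> exists J0, forall J, (J0 <= J)%N ->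
  mu (cyl x m `&` [set y | irr01 y /\
    ~ tame C J (cf_digit y)]) <= eta * mu (cyl x m).
Proof.
move=> eta0.
(* The three error terms are each made at most [eta/3]: large digits by [h],
   the digit sum and the denominator by [C1]. *)
have [h hE] : exists h, 12 / eta <= (2 ^ h)%:R.
  exists (Num.truncn (12 / eta)).+1; apply: le_trans (ltW (truncnS_gt _)) _.
  by rewrite ler_nat ltnW// ltn_expl.
pose C1 := (Num.truncn (12 * (1 + h%:R) / eta)).+1.
have C1E : 12 * (1 + h%:R) / eta <= C1%:R by exact: ltW (truncnS_gt _).
exists (C1 + 3)%N => [|x m Ox]; first by rewrite addnS.
set s0 := digit_sum (cf_digit x) m; set Q0 := cf_den (cf_digit x) m.
exists (maxn 1 (maxn m (maxn s0 Q0))) => J.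
rewrite !geq_max => /and4P[J1 Jm Js JQ].
have J2J : (J < 2 ^ J)%N by rewrite ltn_expl.
have mJ : (m <= 2 ^ J.+1)%N.
  by rewrite (leq_trans Jm)// (leq_trans (ltnW J2J))// leq_exp2l.
have Jh : (0 < J + h)%N by rewrite ltn_addr.
have Ib y : cyl x m y ->
    (digit_sum (cf_digit y) m <= s0)%N /\ (cf_den (cf_digit y) m <= Q0)%N.
  by move=> [_ xy]; rewrite (digit_sum_ext xy) (cf_den_ext xy).1.
have adT : adapted (2 ^ J.+1) [set y : R | irr01 y /\
  ~ tame (C1 + 3) J (cf_digit y)].
  apply: (@adapted_pred _ _ (fun a => ~ tame (C1 + 3) J a)) => a b ab na nb.
  by apply: na; apply: tame_ext nb => i /ab.
have mT := adapted_measurable adT.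
have mI := measurable_cyl m Ox.
have G := mu_growth (C1 * (J * 2 ^ J)) (C1 * 2 ^ J) (adapted_cyl x m) mJ Jh Ib.
apply: le_trans (le_trans _ G) _.
  apply: mu_mono; first exact: measurableI.
    apply: (@adapted_measurable _ (2 ^ J.+1)).
    apply: adaptedI; first exact: adapted_le (adapted_cyl x m).
    apply: (@adapted_pred _ _ (fun a =>
      (s0 + C1 * (J * 2 ^ J) < digit_sum a (2 ^ J.+1))%N \/
      (Q0 * 2 ^ (2 ^ J.+1 + C1 * 2 ^ J) < cf_den a (2 ^ J.+1))%N)).
    by move=> a b ab; rewrite (digit_sum_ext ab) (cf_den_ext ab).1.
  move=> y [[yI [Oy nt]] _]; split=> //; split=> //.
  apply: contrapT => /not_orP[/negP + /negP]; rewrite -!leqNgt => h1 h2;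
    apply: nt; split.
    apply: leq_trans h1 _; rewrite mulnDl addnC leq_add2l.
    apply: leq_trans Js _; rewrite (leq_trans (leq_pmulr _ (_ : 0 < 2 ^
      J)%N))//.
      by rewrite expn_gt0.
    by rewrite leq_pmull.
  apply: leq_trans h2 _; apply: (@leq_trans (2 ^ J * 2 ^ (2 ^ J.+1 + C1 * 2 ^
    J))).
    by rewrite leq_mul// (leq_trans JQ)// ltnW.
  rewrite -expnD leq_exp2l// mulnDl addnA [X in (_ <= X)%N]addnC leq_add2r
    expnS.
  by rewrite (mulSn 2) leq_add2r ltnW.
apply: ler_wpM2r; first exact: mu_ge0.
have D1 : 1 <= (2 ^ J)%:R :> R by rewrite ler1n expn_gt0.
have J1' : 1 <= J%:R :> R by rewrite ler1n.
have h0 : 0 <= h%:R :> R by [].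
have C0 : 0 < C1%:R :> R by rewrite ltr0n.
rewrite expnS expnD !natrM -![(C1 * _).+1%:R]natr1 !natrM natrD.
move: D1 J1' h0 C0 hE C1E.
set D : R := (2 ^ J)%:R; set J' : R := J%:R; set h' : R := h%:R; set H : R :=
  (2 ^ h)%:R.
set C : R := C1%:R => D1 J1' h0 C0 hE C1E.
have {}hE : 12 <= H * eta by rewrite -ler_pdivrMr.
have {}C1E : 12 * (1 + h') <= C * eta by rewrite -ler_pdivrMr.
have H0 : 0 < H by rewrite ltr0n expn_gt0.
have D0 : 0 < D by lra.
have Ce : 0 < C * eta by rewrite mulr_gt0.
have d2 : 0 < C * (J' * D) + 1 by rewrite ltr_wpDl// !mulr_ge0//; lra.
have d3 : 0 < C * D + 1 by rewrite ltr_wpDl// !mulr_ge0//; lra.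
have t1 : 2 * D * (2 / (D * H)) <= eta / 3.
  have -> : 2 * D * (2 / (D * H)) = 4 / H by field; rewrite !gt_eqF.
  by rewrite ler_pdivrMr//; lra.
have t2 : 2 * D * (2 * (J' + h') / (C * (J' * D) + 1)) <= eta / 3.
  rewrite mulrA ler_pdivrMr//.
  have JD : 0 <= J' * D by rewrite mulr_ge0//; lra.
  have e1 : 12 * (1 + h') * (J' * D) <= C * eta * (J' * D) by rewrite ler_wpM2r.
  have e2 : D * h' <= D * h' * J' by rewrite ler_peMr// mulr_ge0//; lra.
  lra.
have t3 : 2 * D * (2 / (C * D + 1)) <= eta / 3.
  rewrite mulrA ler_pdivrMr//.
  have e1 : 12 * (1 + h') * D <= C * eta * D by rewrite ler_wpM2r//; lra.
  have e2 : 0 <= D * h' by rewrite mulr_ge0//; lra.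
  lra.
lra.
Qed.

End Growth.

(** * Denominators in the residue class of one *)

Section Residues.
Variable R : realType.
Implicit Types (a : nat -> nat) (x y : R) (A B E F I : set R) (m n : nat).

(** Take for [b] the largest divisor of [V] that is coprime to [q']: each
    prime factor of [V] divides exactly one of [b] and [q']. *)
Lemma coprime_shift V q q' : (0 < V)%N -> (0 < q')%N -> coprime q q' ->
  exists2 b, (0 < b <= V)%N & coprime (b * q + q') V.
Proof.
move=> V0 q'0 qq'; pose b := partn V (negn (\pi(q'))).
exists b; first by rewrite part_gt0 dvdn_leq ?dvdn_part.
rewrite coprime_has_primes ?addn_gt0 ?q'0 ?orbT//.
apply/hasPn => p; rewrite mem_primes => /and3P[pp _ pV]; apply/negP => /=.
rewrite mem_primes => /and3P[_ _ pbq].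
have pb : (p %| b)%N = ~~ (p %| q')%N.
  have : (p \in primes b) = (p \in primes V) && (p \notin primes q').
    by rewrite primes_part mem_filter andbC.
  by rewrite !mem_primes pp V0 pV q'0 part_gt0.
have [pq'|pq'] := boolP (p %| q')%N.
  have : (p %| b * q)%N by rewrite -(dvdn_addl _ pq').
  rewrite Euclid_dvdM// pb pq'/= => pq.
  have : (p %| gcdn q q')%N by rewrite dvdn_gcd pq.
  by rewrite (eqP qq') dvdn1 => /eqP p1; rewrite p1 in pp.
by move: pbq; rewrite dvdn_addr ?(negbTE pq')// dvdn_mulr// pb pq'.
Qed.

Lemma residue_one V u q : (0 < V)%N -> (0 < u)%N -> coprime u V ->
  exists2 b, (0 < b <= V)%N & (b * u + q = 1 %[mod V])%N.
Proof.
move=> V0 u0 uV; have [k j kj _] := egcdnP V u0; rewrite (eqP uV) in kj.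
pose c := ((k * (1 + (V - 1) * q)) %% V)%N.
have cE : (c * u + q = 1 %[mod V])%N.
  rewrite -modnDml -modnMml modn_mod modnMml modnDml.
  have -> : (k * (1 + (V - 1) * q) * u + q = 1 + V * (j * (1 + (V - 1) * q) +
    q))%N.
    rewrite mulnAC kj; case: V V0 {uV kj c} => // V _; rewrite subn1/=; lia.
  by rewrite mulnC addnC modnMDl.
have cV : (c < V)%N by rewrite ltn_pmod.
have [c0|c0] := posnP c; last by exists c => //; rewrite c0 ltnW.
exists V; first by rewrite V0 leqnn.
by move: cE; rewrite c0 mul0n add0n => <-; rewrite mulnC modnMDl.
Qed.

Lemma rational_gauss x : rational x -> rational (gauss_map x).
Proof.
move=> [r _ <-]; exists (r^-1 - (Num.floor (ratr r : R)^-1)%:~R) => //.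
by rewrite rmorphB/= ratr_int fmorphV.
Qed.

Lemma irr01_mobius a n s : (forall i, 0 < a i.+1)%N -> irr01 s ->
  irr01 (mobius a n s : R).
Proof.
move=> a0 Os; have s01 : 0 < s < 1 by rewrite irr01_gt0 ?irr01_lt1.
split; first by rewrite /= in_itv/= mobius_01.
move=> ry; have [_ ir] := Os; apply: ir.
have [_ <-] := mobius_digits n a0 s01.
by elim: n {s01 Os s a0} (mobius a n s) ry => // n IH y ry;
  apply: rational_gauss; exact: IH.
Qed.

Definition den_one V n : set R :=
  [set y | irr01 y /\ (cf_den (cf_digit y) n = 1 %[mod V])%N].

Lemma adapted_den_one V n : adapted n (den_one V n).
Proof.
apply: (@adapted_pred _ _ (fun a => cf_den a n = 1 %[mod V])%N) => a b ab.
by rewrite (cf_den_ext ab).1.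
Qed.

Lemma measurable_den_one V n : measurable (den_one V n).
Proof. exact: adapted_measurable (adapted_den_one V n). Qed.

(** Two more digits, both at most [V], steer the denominator into the class of
    one: the first makes it coprime to [V], the second solves the congruence.
    Bounded digits cost a bounded factor of probability. *)
Lemma mu_cyl_den_one V n x : (0 < V)%N -> (0 < n)%N -> irr01 x ->
  mu (cyl x n) <= (2 * V.+1 ^ 4)%:R * mu (cyl x n `&` den_one V n.+2).
Proof.
move=> V0 n0 Ox; have a0 := cf_digit_gt0 Ox; set a := cf_digit x in a0.
set q := cf_den a n; set q' := cf_den_pred a n.
have q0 : (0 < q)%N by exact: cf_den_gt0.
have q'0 : (0 < q')%N by rewrite /q'; case: (n) n0 => // k _; exact: cf_den_gt0.
have qq' : (q' <= q)%N by exact: cf_den_pred_le.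
have [b1 /andP[b10 b1V] cb1] := coprime_shift V0 q'0 (cf_den_coprime a n :
  coprime q q').
set u := (b1 * q + q')%N in cb1.
have u0 : (0 < u)%N by rewrite addn_gt0 q'0 orbT.
have [b2 /andP[b20 b2V] cb2] := residue_one q V0 u0 cb1.
(* A point of the subcylinder is needed; the tail is [x] itself, which is
   irrational. *)
pose a' i := if i == n.+1 then b1 else if i == n.+2 then b2 else a i.
have a'0 i : (0 < a' i.+1)%N by rewrite /a'; do 2?case: ifP => //.
have aa' i : (0 < i <= n)%N -> a' i = a i.
  by move=> /andP[_ i_n]; rewrite /a' !ltn_eqF// ltnS// ltnW.
pose y := mobius a' n.+2 x; have Oy : irr01 y by exact: irr01_mobius.
have x01 : 0 < x < 1 by rewrite irr01_gt0 ?irr01_lt1.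
have [ya' _] := mobius_digits n.+2 a'0 x01; rewrite -/y in ya'.
have qn : cf_den a' n = q /\ cf_den_pred a' n = q' by exact: cf_den_ext.
have qn1 : cf_den a' n.+1 = u by rewrite cf_denS qn.1 qn.2 /a' eqxx.
have qn2 : cf_den a' n.+2 = (b2 * u + q)%N.
  by rewrite cf_denS qn1 /cf_den_pred qn.1 /a' eqxx gtn_eqF.
have [yq yq'] := cf_den_ext ya'.
have sub : cyl y n.+2 `<=` cyl x n `&` den_one V n.+2.
  move=> z [Oz zy]; have za' i : (0 < i <= n.+2)%N -> cf_digit z i = a' i.
    by move=> ni; rewrite zy// ya'.
  split; split=> //.
    move=> i /andP[i0 i_n]; rewrite za' ?aa' ?i0//.
    by rewrite (leq_trans i_n)// -addn2 leq_addr.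
  by rewrite (cf_den_ext za').1 qn2.
have mz : measurable (cyl x n `&` den_one V n.+2).
  by apply: measurableI; [exact: measurable_cyl|exact: measurable_den_one].
apply: (@le_trans _ _ ((2 * V.+1 ^ 4)%:R * mu (cyl y n.+2))); last first.
  rewrite ler_pM2l ?ltr0n ?muln_gt0 ?expn_gt0//; apply: mu_mono => //.
    exact: measurable_cyl.
  by move=> z [/sub].
rewrite !mu_cyl// -/a -/q -/q' yq yq' qn2 [cf_den_pred a' n.+2]qn1.
rewrite -!natrD -!natrM ler_pdivlMr ?ltr0n; last first.
  have w0 : (0 < b2 * u + q)%N by rewrite (leq_trans q0) ?leq_addl.
  by rewrite muln_gt0 w0 (leq_trans w0) ?leq_addr.
rewrite mulrC ler_pdivrMr ?ltr0n; last by rewrite muln_gt0 addn_gt0 q0.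
rewrite -natrM ler_nat.
have uq : (u <= V.+1 * q)%N by rewrite mulSn addnC leq_add// leq_mul.
have wq : (b2 * u + q <= V.+1 ^ 2 * q)%N.
  apply: (@leq_trans (V * (V.+1 * q) + q)); first by rewrite leq_add2r leq_mul.
  by rewrite mulnA -mulSnr leq_mul2r; apply/orP; right;
    rewrite expnS expn1 mulSn addnC; lia.
have uw : (u <= b2 * u + q)%N by rewrite (leq_trans _ (leq_addr _ _))//
  leq_pmull.
set w := (b2 * u + q)%N in wq uw *.
apply: (@leq_trans (w * (w + w))); first by rewrite leq_mul2l leq_add2l uw orbT.
rewrite addnn -mul2n mulnCA -mulnA leq_mul2l/=.
apply: (@leq_trans ((V.+1 ^ 2 * q) * (V.+1 ^ 2 * q))); first exact: leq_mul.
rewrite mulnACA -expnD leq_mul2l; apply/orP; right.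
by rewrite leq_mul2l leq_addr orbT.
Qed.

Lemma mu_den_one V m n I : adapted m I -> (0 < V)%N -> (0 < m <= n)%N ->
  mu I <= (2 * V.+1 ^ 4)%:R * mu (I `&` den_one V n.+2).
Proof.
move=> adI V0 /andP[m0 mn]; rewrite -[X in mu X <= _](setIT I).
have adn := adapted_le mn adI.
apply: (mu_adapted_le adn) => //; first exact: measurable_den_one.
move=> x Ix; rewrite setIT mu_cyl_den_one//; first exact: leq_trans mn.
by case: adI => + _; exact.
Qed.

End Residues.

(** * Denominators that bring an irrational multiple close to an integer *)

Section NearIntegers.
Variable R : realType.
Implicit Types (a : nat -> nat) (x y d e : R) (A B E F I : set R) (m n q : nat).

Definition near_int e d q : Prop := exists k : int, `|q%:R * d - k%:~R| < e.

Lemma near_int_le e e' d q : e <= e' -> near_int e d q -> near_int e' d q.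
Proof. by move=> ee' [k h]; exists k; exact: lt_le_trans ee'. Qed.

Lemma nonint_dist x : x \isn't a Num.int ->
  exists2 e, 0 < e & forall k : int, e <= `|x - k%:~R|.
Proof.
move=> xn; have /andP[f1 f2] := floor_itv x.
have f0 : (Num.floor x)%:~R < x.
  by rewrite lt_neqAle f1 andbT; apply: contra xn => /eqP <-; exact: intr_int.
exists (Num.min (x - (Num.floor x)%:~R) ((Num.floor x + 1)%:~R - x)).
  by rewrite lt_min !subr_gt0 f0.
move=> k; rewrite ge_min; have [kx|kx] := leP k (Num.floor x).
  have h : k%:~R <= (Num.floor x)%:~R :> R by rewrite ler_int.
  by rewrite ger0_norm ?subr_ge0 ?(le_trans h)// lerD2l lerN2 h.
have h : (Num.floor x + 1)%:~R <= k%:~R :> R by rewrite ler_int lezD1.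
rewrite distrC ger0_norm ?subr_ge0 ?(le_trans _ h) ?(ltW f2)//.
by rewrite lerD2r h orbT.
Qed.

Lemma not_near_initial d M : (forall v, (0 < v)%N ->
  v%:R * d \isn't a Num.int) ->
  exists2 e, 0 < e & forall r, (0 < r < M)%N -> ~ near_int (2 * e) d r.
Proof.
move=> irr; elim: M => [|M [e e0 IH]]; first by exists 1 => // r;
  rewrite ltn0 andbF.
have [->|M0] := posnP M; first by exists 1 => // r /andP[r0];
  rewrite ltnS leqn0 => /eqP r0'; rewrite r0' in r0.
have [e' e'0 h] := nonint_dist (irr M M0).
exists (Num.min e (e' / 2)) => [|r /andP[r0]];
  first by rewrite lt_min e0 divr_gt0.
rewrite ltnS leq_eqVlt => /predU1P[->|rM].
  move=> [k]; rewrite ltNge; apply/negP/negPn; apply: le_trans (h k).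
  by rewrite mulrC -ler_pdivlMr// ge_min lexx orbT.
move/near_int_le => /(_ (2 * e)) h2; apply: (IH r); first by rewrite r0.
by apply: h2; rewrite ler_pM2l// ge_min lexx.
Qed.

(** Two such [q] at distance less than [M] would make their difference violate
    [sep], so each block of length [M] contains at most one. *)
Lemma near_sum_block e d M j :
  (forall r, (0 < r < M)%N -> ~ near_int (2 * e) d r) -> (0 < M)%N ->
    (0 < j)%N ->
  \sum_(j * M <= q < j.+1 * M | `[< near_int e d q >]) (q%:R^-1 : R) <= (j *
    M)%:R^-1.
Proof.
move=> sep M0 j0; have jM0 : (0 < j * M)%N by rewrite muln_gt0 j0.
have [[q [qr nq]]|none] := pselect (exists q, (j * M <= q < j.+1 * M)%N /\
  near_int e d q); last first.
  rewrite big_nat_cond big_pred0 ?invr_ge0// => q; apply/negP =>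
    /andP[qr /asboolP nq].
  by apply: none; exists q.
have far q1 q2 : (q1 < q2)%N -> (q2 - q1 < M)%N -> near_int e d q1 ->
  near_int e d q2 -> False.
  move=> q12 q2M [k1 h1] [k2 h2]; apply: (sep (q2 - q1)%N);
    first by rewrite subn_gt0 q12.
  exists (k2 - k1); rewrite natrB ?(ltnW q12)// intrB.
  by move: h1 h2; rewrite !ltr_norml => /andP[? ?] /andP[? ?]; lra.
rewrite big_mkcond (bigD1_seq q) ?iota_uniq ?mem_index_iota//= asboolT//.
rewrite big_seq_cond big1 ?addr0; last first.
  move=> q' /andP[]; rewrite mem_index_iota => q'r qq'.
  case: ifP => // /asboolP nq'; exfalso.
  move: qr q'r; rewrite !mulSn => /andP[q1 q2] /andP[q3 q4].
  case: (ltngtP q' q) qq' => // lt _; first by apply: (far q' q) => //; lia.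
  by apply: (far q q') => //; lia.
by rewrite lef_pV2 ?posrE ?ltr0n ?ler_nat ?(leq_trans jM0)//; case/andP: qr.
Qed.

(** One term per block of length [M] leaves the harmonic sum divided by [M]. *)
Lemma near_sum e d M r :
  (forall r, (0 < r < M)%N -> ~ near_int (2 * e) d r) -> (0 < M)%N -> 0 <= e ->
  \sum_(1 <= q < 2 ^ r * M | `[< near_int e d q >]) (q%:R^-1 : R) <= r%:R /
    M%:R.
Proof.
move=> sep M0 e0.
suff H j : \sum_(1 <= q < j.+1 * M | `[< near_int e d q >]) (q%:R^-1 : R) <=
    (\sum_(1 <= i < j.+1) i%:R^-1) / M%:R.
  have := H (2 ^ r).-1; rewrite prednK ?expn_gt0// => /le_trans; apply.
  by rewrite ler_pM2r ?invr_gt0 ?ltr0n// sum_inv_pow2.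
elim: j => [|j IH].
  rewrite mul1n [X in _ <= X / _]big_geq// mul0r big_nat_cond big_pred0// => q.
  apply/negP => /andP[/andP[q0 qM] /asboolP nq].
  by apply: (sep q); rewrite ?q0// ; apply: near_int_le nq;
    rewrite mulrC ler_peMr// ler1n.
rewrite (@big_cat_nat _ _ _ (j.+1 * M))/= ?muln_gt0 ?M0 ?leq_mul2r ?leqnSn
  ?orbT//.
rewrite [X in _ <= X / _]big_nat_recr//= mulrDl; apply: lerD => //.
by rewrite -invfM -natrM; exact: near_sum_block.
Qed.

Lemma mu_itv_le (c r : R) : 0 < r -> mu `]c - r, c + r[%classic <= 2 * r.
Proof.
move=> r0; rewrite -lee_fin muE//.
apply: (@le_trans _ _ (lebesgue_measure `]c - r, c + r[%classic)).
  by apply: le_measure; rewrite ?inE//; apply: measurableI => //;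
    exact: measurable_irr01.
rewrite lebesgue_measure_itv/= lte_fin ltrBlDr -addrA ltrDl addr_gt0//.
rewrite -EFinB lee_fin; lra.
Qed.

(** The length of the surrounding interval equals the measure of the cylinder. *)
Lemma cyl_in_itv x m : irr01 x -> exists l, forall y, cyl x m y ->
  l < y < l + mu (cyl x m).
Proof.
move=> Ox; rewrite mu_cyl//.
have h01 : 0 < (1 : R) <= 1 by rewrite ltr01 lexx.
have E := cyl_itv m Ox h01; cbv zeta in E; rewrite -cyl_tail1 !mul1r in E.
move: E; set q : R := (cf_den _ _)%:R; set q' : R := (cf_den_pred _ _)%:R.
set c : R := _ / q; set w : R := _^-1 => E.
exists (if odd m then c - w else c) => y; rewrite E => -[_ /=].
by rewrite -signr_odd; case: (odd m); rewrite ?expr1 ?expr0; lra.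
Qed.

(** About [q] times the length of the cylinder fractions [p/q] lie near it,
    each with a neighbourhood of length [2/q^2]. *)
Lemma mu_rational_nbhd x m q B : irr01 x -> measurable B -> B `<=` cyl x m ->
  (0 < q)%N -> 3 <= q%:R * mu (cyl x m) ->
  (forall y, B y -> exists p : int, `|y - p%:~R / q%:R| < (q%:R ^+ 2)^-1) ->
  mu B <= 4 * mu (cyl x m) / q%:R.
Proof.
move=> Ox mB BI q0 ql Bp; have [l lI] := cyl_in_itv m Ox.
set L := mu (cyl x m) in ql lI *.
have Q0 : 0 < q%:R :> R by rewrite ltr0n.
have Q1 : 1 <= q%:R :> R by rewrite ler1n.
pose K := Num.truncn (q%:R * L + 2).
have K1 : K%:R <= q%:R * L + 2 by rewrite truncn_le addr_ge0// (le_trans _ ql).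
pose F (j : nat) : set R := `](Num.floor (q%:R * l) + j)%:~R / q%:R - (q%:R ^+
  2)^-1,
   (Num.floor (q%:R * l) + j)%:~R / q%:R + (q%:R ^+ 2)^-1[%classic.
have Q2 : 0 < (q%:R ^+ 2)^-1 :> R by rewrite invr_gt0 exprn_gt0.
have mF j : measurable (F j) by exact: measurable_itv.
have := @mu_markov R _ (iota 0 K.+1) F B 1 mB mF.
rewrite mul1r => /(_ _)/le_trans; apply => //.
- move=> y By _; have [p pB] := Bp y By; have /andP[ly yl] := lI y (BI y By).
  have /andP[f1 f2] := floor_itv (q%:R * l).
  have p1 : `|q%:R * y - p%:~R| < 1.
    rewrite -(ltr_pM2l Q0) -[X in X * `|_|](gtr0_norm Q0) in pB *.
    move: pB; rewrite -normrM mulrBr [X in _ - X]mulrCA divff ?gt_eqF// mulr1.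
    move=> /lt_le_trans; apply; rewrite expr2 invfM mulrA divff ?gt_eqF// mul1r.
    by rewrite invf_le1.
  have ly' : q%:R * l < q%:R * y by rewrite ltr_pM2l.
  have yl' : q%:R * y < q%:R * l + q%:R * L by rewrite -mulrDr ltr_pM2l.
  move: p1; rewrite ltr_norml => /andP[p1 p2].
  have pf : (Num.floor (q%:R * l) <= p)%R.
    rewrite -ltzD1 -(ltr_int R) intrD; rewrite intrD in f2; lra.
  pose j := `|p - Num.floor (q%:R * l)|%N.
  have jE : Num.floor (q%:R * l) + j = p by rewrite /j gez0_abs ?subr_ge0//
    addrCA subrr addr0.
  have jK : (j < K.+1)%N.
    rewrite ltnS /K -ltnS.
    rewrite -(ltr_nat R); apply: lt_trans (truncnS_gt _).
    have : (j%:R : R) = p%:~R - (Num.floor (q%:R * l))%:~R.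
      by rewrite -jE intrD addrC addKr pmulrn.
    move=> ->; rewrite intrD in f2; lra.
  rewrite (bigD1_seq j) ?iota_uniq ?mem_iota//= asboolT// /F jE /= in_itv/=.
  by move: pB; rewrite ltr_norml; lra.
- apply: (@le_trans _ _ (\sum_(j <- iota 0 K.+1) (2 * (q%:R ^+ 2)^-1))).
    apply: ler_sum => j _; apply: le_trans (mu_itv_le ((Num.floor (q%:R * l) +
      j)%:~R / q%:R) Q2).
    by apply: (mu_mono (measurableI _ _ mB (mF j)) (mF j)) => z [[_ Fz] _].
  rewrite big_const_seq count_predT size_iota iter_addr_0 -[X in X <=
    _]mulr_natr.
  rewrite ler_pdivlMr//; rewrite expr2 invfM.
  have -> : 2 * (q%:R^-1 / q%:R) * K.+1%:R * q%:R = 2 * K.+1%:R / q%:R :> R.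
    by field; rewrite gt_eqF.
  rewrite ler_pdivrMr// -natr1; lra.
Qed.

Lemma convergent_near x n : irr01 x ->
  `|x - (cf_nums (cf_digit x) n).1%:R / (cf_den (cf_digit x) n)%:R| <
  ((cf_den (cf_digit x) n)%:R ^+ 2)^-1.
Proof.
move=> Ox; have a0 := cf_digit_gt0 Ox.
have Ot := irr01_iter n Ox; have t0 := irr01_gt0 Ot; have t1 := irr01_lt1 Ot.
have := mobius_sub n a0 (ltW t0); rewrite -(cf_tail_mobius n Ox) => ->.
set q : R := (cf_den _ _)%:R; set q' : R := (cf_den_pred _ _)%:R.
have q0 : 0 < q by rewrite ltr0n cf_den_gt0.
have q'0 : 0 <= q' by [].
set t := iter _ _ _ in t0 t1 *.
have d0 : 0 < q + t * q' by rewrite ltr_pwDl// mulr_ge0// ltW.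
rewrite normrM normrX normrN1 expr1n mul1r ger0_norm ?divr_ge0 ?mulr_ge0//
  ?ltW//.
rewrite ltr_pdivrMr ?mulr_gt0// expr2 invfM -mulrA mulKf ?gt_eqF//.
rewrite ltr_pdivlMl// (lt_le_trans (_ : _ < q))//; first by rewrite gtr_pMr.
by rewrite lerDl mulr_ge0// ltW.
Qed.

(** A given [q] is a denominator with probability [O(1/q)], whatever its
    index; summing over the sparse set of bad [q] gives a bound that is small
    when [M] is large. *)
Lemma mu_near_den x m e d M r N0 N1 : irr01 x ->
  (forall k, (0 < k < M)%N -> ~ near_int (2 * e) d k) -> (0 < M)%N -> 0 <= e ->
  (0 < N0)%N -> 3 <= N0%:R * mu (cyl x m) ->
  \sum_(N0 <= n < N1) mu (cyl x m `&` [set y | irr01 y /\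
     ((cf_den (cf_digit y) n < 2 ^ r * M)%N /\
       near_int e d (cf_den (cf_digit y) n))]) <=
  4 * (r%:R / M%:R) * mu (cyl x m).
Proof.
move=> Ox sep M0 e0 N00 N0I; set I := cyl x m in N0I *; set X := (2 ^ r * M)%N.
pose Bad n := [set y : R | irr01 y /\ ((cf_den (cf_digit y) n < X)%N /\
  near_int e d (cf_den (cf_digit y) n))].
pose G q n := [set y : R | irr01 y /\ cf_den (cf_digit y) n = q].
pose B q := I `&` [set y : R | irr01 y /\ exists2 n,
  (N0 <= n < N1)%N & cf_den (cf_digit y) n = q].
have adG q n : adapted n (G q n).
  apply: (@adapted_pred _ _ (fun a => cf_den a n = q)) => a b ab.
  by rewrite (cf_den_ext ab).1.
have mI : measurable I by exact: measurable_cyl.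
have mG q n : measurable (G q n) by exact: adapted_measurable (adG q n).
have mB q : measurable (B q).
  apply: measurableI => //; apply: (@adapted_measurable _ N1).
  apply: (@adapted_pred _ _ (fun a => exists2 n,
    (N0 <= n < N1)%N & cf_den a n = q)).
  move=> a b ab [n /andP[n0 n1] <-]; exists n; first by rewrite n0.
  by symmetry; apply: (cf_den_ext _).1 => i /andP[i0 i_n];
    rewrite ab// i0 (leq_trans i_n)// ltnW.
have mBad n : measurable (Bad n).
  apply: (@adapted_measurable _ n).
  apply: (@adapted_pred _ _ (fun a => (cf_den a n < X)%N /\
    near_int e d (cf_den a n))).
  by move=> a b ab; rewrite (cf_den_ext ab).1.
pose P q := `[< near_int e d q >] && (N0 <= q)%N.
apply: (@le_trans _ _ (\sum_(N0 <= n < N1) \sum_(1 <= q < X | P q) mu (I `&` G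
  q n))).
  rewrite big_nat [leRHS]big_nat; apply: ler_sum => n /andP[n0 n1].
  have := @mu_markov R _ [seq q <- index_iota 1 X | P q] (G^~ n) (I `&` Bad n) 1
    (measurableI _ _ mI (mBad n)) (mG^~ n).
  rewrite mul1r => /(_ _)/le_trans; apply.
    move=> y [_ [Oy [qX nq]]] _; have a0 := cf_digit_gt0 Oy.
    rewrite (bigD1_seq (cf_den (cf_digit y) n)) ?filter_uniq ?iota_uniq//=;
      first by rewrite asboolT.
    rewrite mem_filter mem_index_iota qX cf_den_gt0// /P asboolT//=.
    by rewrite (leq_trans n0)// cf_den_ge.
  rewrite big_filter; apply: ler_sum => q _; apply: mu_mono.
  - by apply: measurableI => //; exact: measurableI.
  - exact: measurableI.
  - by move=> z [[[]]].
rewrite exchange_big/=.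
apply: (@le_trans _ _ (\sum_(1 <= q < X | P q) (4 * mu I / q%:R))).
  apply: ler_sum => q /andP[_ N0q]; have q0 : (0 < q)%N by exact: leq_trans N0q.
  apply: (@le_trans _ _ (mu (B q))); last first.
    apply: (mu_rational_nbhd Ox (mB q)) => //; first by move=> y [].
      by apply: le_trans N0I _; rewrite ler_wpM2r ?mu_ge0// ler_nat.
    move=> y [_ [Oy [n _ <-]]]; exists (cf_nums (cf_digit y) n).1%:Z.
    by rewrite -pmulrn; exact: convergent_near.
  apply: le_trans (mu_sum_disjoint (m := N0) (N := N1) (mB q) (mG q) _).
    rewrite big_nat [leRHS]big_nat; apply: ler_sum => n n01; apply: mu_mono.
    - exact: measurableI.
    - exact: measurableI.
    - by move=> y [[Iy [Oy yn]] _]; split; [split=> //; split=> //; exists n|].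
  move=> i j y N0i ij jN [Oy yi] [_ yj]; have a0 := cf_digit_gt0 Oy.
  case: i N0i ij yi => [|i]; first by rewrite leqn0 => /eqP N00';
    rewrite N00' in N00.
  case: j jN yj => // j jN yj _ ij yi.
  by move: ij; rewrite (@cf_den_inj _ i j a0) ?ltnn// yi yj.
rewrite -mulr_sumr -mulrA -[leRHS]mulrA ler_pM2l// [leRHS]mulrC ler_wpM2l
  ?mu_ge0//.
apply: le_trans (near_sum r sep M0 e0).
rewrite big_mkcond [leRHS]big_mkcond; apply: ler_sum => q _.
by rewrite /P; case: ifP => [/andP[->]//|]; case: ifP => // _ _;
  rewrite invr_ge0.
Qed.

End NearIntegers.

(** * Frequency of good denominators *)

Section GoodDenominators.
Variable R : realType.
Implicit Types (a : nat -> nat) (x y d e : R) (A B E F I : set R) (m n q : nat)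
  (ds : seq R).

Lemma common_multiple ds : exists2 V, (0 < V)%N & forall d, d \in ds ->
  (exists2 v, (0 < v)%N & v%:R * d \is a Num.int) -> V%:R * d \is a Num.int.
Proof.
elim: ds => [|d ds [V V0 IH]]; first by exists 1%N.
have [[v v0 vd]|nv] := pselect (exists2 v,
  (0 < v)%N & v%:R * d \is a Num.int); last first.
  exists V => // d'; rewrite inE => /predU1P[->//|]; exact: IH.
exists (v * V)%N; first by rewrite muln_gt0 v0.
move=> d'; rewrite inE => /predU1P[-> _|d'ds h].
  by rewrite natrM mulrAC mulrC rpredM// rpred_nat.
by rewrite natrM -mulrA rpredM ?rpred_nat// IH.
Qed.

(** One [e] serves all entries: for the rational ones, [q d] will be congruent
    to [d], which keeps its distance to the integers; for the irrational ones,
    the near multiples will be at least [M] apart. *)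
Lemma common_gap ds M : (forall d, d \in ds -> d \isn't a Num.int) ->
  exists2 e, 0 < e & forall d, d \in ds ->
    ~ near_int e d 1 /\
    ((forall v, (0 < v)%N -> v%:R * d \isn't a Num.int) ->
     forall k, (0 < k < M)%N -> ~ near_int (2 * e) d k).
Proof.
elim: ds => [|d ds IH] dn; first by exists 1.
have [|e e0 he] := IH; first by move=> d' dd; apply: dn; rewrite inE dd orbT.
have [e1 e10 h1] := nonint_dist (dn d (mem_head _ _)).
have [e2 e20 h2] : exists2 e, 0 < e & (forall v, (0 < v)%N ->
  v%:R * d \isn't a Num.int) ->
     forall k, (0 < k < M)%N -> ~ near_int (2 * e) d k.
  have [irr|nirr] := pselect (forall v, (0 < v)%N ->
    v%:R * d \isn't a Num.int); last by exists 1.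
  by have [e2 e20 h2] := not_near_initial M irr; exists e2.
exists (Num.min e (Num.min e1 e2)); first by rewrite !lt_min e0 e10.
have le1 : Num.min e (Num.min e1 e2) <= e by rewrite ge_min lexx.
have le2 : Num.min e (Num.min e1 e2) <= e1 by rewrite !ge_min lexx orbT.
have le3 : Num.min e (Num.min e1 e2) <= e2 by rewrite !ge_min lexx !orbT.
move=> d'; rewrite inE => /predU1P[->|/he[p1 p2]].
  split.
    by move=> [k]; rewrite mul1r ltNge; apply/negP/negPn;
      exact: le_trans (h1 k).
  move=> irr k kM /near_int_le h; apply: (h2 irr k kM); apply: h.
  by rewrite ler_pM2l.
split; first by move/near_int_le => h; apply: p1; exact: h.
move=> irr k kM /near_int_le h; apply: (p2 irr k kM); apply: h.
by rewrite ler_pM2l.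
Qed.


(** The index is even so that [alpha] lies to the right of the convergent and
    the rotation by [q_n alpha] moves forward. *)
Definition good_den e ds n a : Prop :=
  ~~ odd n /\ forall d, d \in ds -> ~ near_int e d (cf_den a n).

Lemma good_den_ext e ds n a b : (forall i, (0 < i <= n)%N -> a i = b i) ->
  good_den e ds n a -> good_den e ds n b.
Proof. by move=> ab; rewrite /good_den (cf_den_ext ab).1. Qed.

Lemma sum_even (a b : nat) : (a <= b)%N ->
  (\sum_(a.*2 <= n < b.*2) ~~ odd n)%N = (b - a)%N.
Proof.
elim: b => [|b IH]; first by rewrite leqn0 => /eqP->; rewrite big_geq.
rewrite leq_eqVlt => /predU1P[->|]; first by rewrite big_geq// subnn.
rewrite ltnS => ab; rewrite doubleS big_nat_recr/=;
  last by rewrite leqW// leq_double.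
rewrite big_nat_recr/= ?leq_double// IH// odd_double/= addn0 addn1.
by rewrite subSn.
Qed.

Definition good_at e ds C J n : set R :=
  [set y | irr01 y /\ (tame C J (cf_digit y) /\ good_den e ds n (cf_digit y))].

Lemma adapted_good_at e ds C J n : (n <= 2 ^ J.+1)%N ->
  adapted (2 ^ J.+1) (good_at e ds C J n).
Proof.
move=> nJ; apply: (@adapted_pred _ _ (fun a => tame C J a /\
  good_den e ds n a)) => a b ab.
move=> [/(tame_ext ab) h1 h2]; split=> //; apply: good_den_ext h2 =>
  i /andP[i0 i_n].
by rewrite ab// i0 (leq_trans i_n).
Qed.

(** Among the even indices of a dyadic block, the class of one modulo [V] has
    probability at least [1/k] with [k = 2 (V+1)^4]; the atypical numbers and
    the irrational entries of [ds] each remove at most a quarter of this. *)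
Lemma many_good ds : (forall d, d \in ds -> d \isn't a Num.int) ->
  exists e c C, [/\ 0 < e, 0 < c <= 1, (0 < C)%N & forall x m, irr01 x ->
    exists J0, forall J, (J0 <= J)%N ->
      c * (2 ^ J)%:R * mu (cyl x m) <=
      \sum_(2 ^ J <= n < 2 ^ J.+1) mu (cyl x m `&` good_at e ds C J n)].
Proof.
move=> dn; have [V V0 hV] := common_multiple ds.
pose kn := (2 * V.+1 ^ 4)%N; pose k : R := kn%:R.
have kn0 : (0 < kn)%N by rewrite muln_gt0 expn_gt0.
have k0 : 0 < k by rewrite ltr0n.
have k1 : 1 <= k by rewrite ler1n.
have [C C0 hC] : exists2 C, (0 < C)%N & forall x m, irr01 x -> exists J0,
  forall J, (J0 <= J)%N ->
  mu (cyl x m `&` [set y | irr01 y /\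
    ~ tame C J (cf_digit y)]) <= (4 * k)^-1 * mu (cyl x m).
  by apply: mu_tame; rewrite invr_gt0 mulr_gt0.
pose irr d := `[< forall v, (0 < v)%N -> v%:R * d \isn't a Num.int >].
pose ds' := [seq d <- ds | irr d].
(* The irrational entries cost [4 (size ds) C 2^J / M], which must not exceed
   [2^J / (8 k)]. *)
pose M := (2 + 32 * kn * size ds * C)%N.
have [e e0 he] := common_gap M dn.
exists e, (4 * k)^-1, C; split=> //.
  by rewrite invr_gt0 mulr_gt0//= invf_le1 ?mulr_gt0// (le_trans k1)// ler_peMl
    ?ler1n// ltW.
move=> x m Ox; have [J0 hJ] := hC x m Ox; set I := cyl x m in hJ *.
have mI : measurable I by exact: measurable_cyl.
have muI : 0 < mu I.
  rewrite /I mu_cyl// invr_gt0 mulr_gt0 ?ltr_pwDl// ltr0n cf_den_gt0//;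
    exact: cf_digit_gt0.
exists (maxn J0 (maxn m.+3 (Num.truncn (3 / mu I)).+1)) => J.
rewrite !geq_max => /and3P[/hJ{}hJ Jm JI].
have J2J : (J < 2 ^ J)%N by rewrite ltn_expl.
set NT := [set y | _] in hJ.
pose NB d n := [set y : R | irr01 y /\
  ((cf_den (cf_digit y) n < 2 ^ (C * 2 ^ J) * M)%N /\
  near_int e d (cf_den (cf_digit y) n))].
have mNB d n : measurable (NB d n).
  apply: (@adapted_measurable _ n).
  apply: (@adapted_pred _ _ (fun a => (cf_den a n < 2 ^ (C * 2 ^ J) * M)%N /\
    near_int e d (cf_den a n))).
  by move=> a b ab; rewrite (cf_den_ext ab).1.
have mNT : measurable NT.
  apply: (@adapted_measurable _ (2 ^ J.+1)).
  apply: (@adapted_pred _ _ (fun a => ~ tame C J a)) => a b ab na nb.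
  by apply: na; apply: tame_ext nb => i /ab.
have J3I : 3 <= (2 ^ J)%:R * mu I.
  rewrite -ler_pdivrMr//; apply: le_trans (ltW (truncnS_gt _)) _.
  by rewrite ler_nat (leq_trans JI)// ltnW.
have step n : (2 ^ J <= n < 2 ^ J.+1)%N ->
    (~~ odd n)%:R * (k^-1 * mu I) <= mu (I `&` good_at e ds C J n) +
      ((~~ odd n)%:R * ((4 * k)^-1 * mu I) + \sum_(d <- ds') mu (I `&` NB d n)).
  move=> /andP[n1 n2]; have [on|en] := boolP (odd n).
    by rewrite !mul0r add0r addr_ge0 ?mu_ge0// sumr_ge0// => d _; exact: mu_ge0.
  rewrite !mul1r; have mGA : measurable (good_at e ds C J n).
    by apply: (adapted_measurable (adapted_good_at _ _ _ _)); exact: ltnW.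
  have mn : (0 < m.+1 <= n - 2)%N by lia.
  have nE : n = (n - 2).+2 by lia.
  have adI : adapted m.+1 I by exact: adapted_le (adapted_cyl x m).
  have := mu_den_one adI V0 mn; rewrite -nE -/kn -/k.
  rewrite -ler_pdivrMl// => /le_trans; apply.
  have mD := measurableI _ _ mI (@measurable_den_one R V n).
  set D := I `&` _ in mD *; have mD1 := measurableD mD mGA.
  have mD2 := measurableD mD1 mNT.
  rewrite (mu_split mD mGA) (mu_split mD1 mNT); apply: lerD; [|apply: lerD].
  - apply: mu_mono; [exact: measurableI|exact: measurableI|].
    by move=> y [[[Iy _] Gy] _].
  - apply: le_trans hJ; apply: mu_mono;
    [exact: measurableI|exact: measurableI|].
    by move=> y [[[[Iy _] _] Gy] _].
  - have := @mu_markov R _ ds' (NB^~ n) _ 1 mD2 (mNB^~ n).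
    rewrite mul1r => /(_ _)/le_trans; apply; last first.
      apply: ler_sum => d _; apply: mu_mono;
        [exact: measurableI|exact: measurableI|].
      by move=> y [[[[[]]]]].
    move=> y [[[Iy [Oy y1]] nG] nNT] _.
    have ty : tame C J (cf_digit y).
      by apply: contrapT => nt; apply: nNT.
    have a0 := cf_digit_gt0 Oy.
    have [d dds nd] : exists2 d, d \in ds & near_int e d (cf_den (cf_digit y)
      n).
      apply: contrapT => nex; apply: nG; split=> //; split=> //; split=>
        // d dds nd.
      by apply: nex; exists d.
    have di : irr d.
      apply/asboolP => v v0; apply/negP => vd.
      have [h _] := he d dds; apply: h.
      have Vd : V%:R * d \is a Num.int by apply: hV => //; exists v.
      have q0 := cf_den_gt0 n a0.
      move/intrP: Vd => [z Vd]; move/eqP: y1; rewrite eqn_mod_dvd// =>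
        /dvdnP[j qE].
      move: nd => [p]; rewrite -(subnKC q0) qE natrD natrM mulrDl mul1r -mulrA
        Vd => h.
      exists (p - j%:Z * z); rewrite mul1r intrB intrM opprB addrA -pmulrn.
      by [].
    have dd' : d \in ds' by rewrite mem_filter di.
    apply: leq_trans (_ : 1 <= `[< NB d n y >])%N _.
      rewrite asboolT//; split=> //; split=> //.
      apply: leq_ltn_trans (cf_den_mono a0 (ltnW n2)) _.
      apply: leq_ltn_trans ty.2 _.
      by rewrite ltn_Pmulr// expn_gt0.
    by rewrite (big_rem d)//= leq_addr.
have : \sum_(2 ^ J <= n < 2 ^ J.+1) ((~~ odd n)%:R * (k^-1 * mu I)) <=
    \sum_(2 ^ J <= n < 2 ^ J.+1) mu (I `&` good_at e ds C J n) +
    (\sum_(2 ^ J <= n < 2 ^ J.+1) ((~~ odd n)%:R * ((4 * k)^-1 * mu I)) +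
    \sum_(d <- ds') \sum_(2 ^ J <= n < 2 ^ J.+1) mu (I `&` NB d n)).
  rewrite [X in _ + (_ + X)]exchange_big/= -!big_split/=.
  by rewrite big_nat [leRHS]big_nat; apply: ler_sum => n nJ; exact: step.
have evens : \sum_(2 ^ J <= n < 2 ^ J.+1) (~~ odd n)%:R = 2^-1 * (2 ^ J)%:R :>
  R.
  rewrite -natr_sum; case: (J) Jm => // J' _.
  have -> : (2 ^ J'.+2 = (2 ^ J').*2.*2)%N by rewrite !expnS !mul2n.
  have -> : (2 ^ J'.+1 = (2 ^ J').*2)%N by rewrite expnS mul2n.
  rewrite sum_even; last by rewrite -addnn leq_addl.
  by rewrite -[X in (X - _)%N]addnn addnK -mul2n natrM mulKf.
rewrite -!mulr_suml evens.
have : \sum_(d <- ds') \sum_(2 ^ J <= n < 2 ^ J.+1) mu (I `&` NB d n) <=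
    (8 * k)^-1 * (2 ^ J)%:R * mu I.
  apply: (@le_trans _ _ (\sum_(d <- ds') (4 * ((C * 2 ^ J)%:R / M%:R) * mu I))).
    rewrite big_seq [leRHS]big_seq; apply: ler_sum => d; rewrite mem_filter.
    move=> /andP[/asboolP di dds]; apply: mu_near_den => //.
    - by move=> j jM; exact: (he d dds).2.
    - exact: ltW.
    - by rewrite expn_gt0.
  rewrite big_const_seq count_predT iter_addr_0 -[X in X <= _]mulr_natl mulrA.
  apply: ler_wpM2r; first exact: mu_ge0.
  have s' : (size ds')%:R <= (size ds)%:R :> R by rewrite ler_nat size_filter
    count_size.
  apply: (@le_trans _ _ ((size ds)%:R * (4 * ((C * 2 ^ J)%:R / M%:R)))).
    by rewrite ler_wpM2r// mulr_ge0// divr_ge0.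
  rewrite natrM mulrCA -!mulrA [C%:R * _]mulrCA ?mulrA.
  have M0 : 0 < M%:R :> R by rewrite ltr0n.
  have -> : 4 * (size ds)%:R * (2 ^ J)%:R * C%:R / M%:R =
     (2 ^ J)%:R * (4 * (size ds)%:R * C%:R / M%:R) :> R by field;
       rewrite gt_eqF.
  rewrite [leRHS]mulrC ler_wpM2l// ler_pdivrMr// ler_pdivlMl ?mulr_gt0//.
  by rewrite /k -!natrM ler_nat /M; lia.
set S := \sum_(2 ^ J <= n < _) _; set Q := \sum_(d <- ds') _.
set D : R := (2 ^ J)%:R; set L := mu I in muI *.
have -> : (8 * k)^-1 = 8^-1 * k^-1 by rewrite invfM.
have -> : (4 * k)^-1 = 4^-1 * k^-1 by rewrite invfM.
lra.
Qed.

End GoodDenominators.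

(** * A large digit after a good denominator *)

Section FirstSuccess.
Variable R : realType.
Implicit Types (a : nat -> nat) (x y d e : R) (A B E F I U : set R) (m n : nat)
  (ds : seq R).

Definition success e ds K n a : Prop :=
  good_den e ds n a /\ (K * digit_sum a n <= a n.+1)%N.

Lemma success_ext e ds K n a b : (forall i, (0 < i <= n.+1)%N -> a i = b i) ->
  success e ds K n a -> success e ds K n b.
Proof.
move=> ab; have ab' i : (0 < i <= n)%N -> a i = b i.
  by move=> /andP[i0 i_n]; rewrite ab// i0 leqW.
by move=> [g s]; split; [exact: good_den_ext g|rewrite -(digit_sum_ext ab')
  -ab// leqnn].
Qed.

Definition failure_before e ds K N0 n : set R :=
  [set y | irr01 y /\ forall i, (N0 <= i < n)%N ->
    ~ success e ds K i (cf_digit y)].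

Definition failure e ds K N0 : set R :=
  [set y | irr01 y /\ forall i, (N0 <= i)%N -> ~ success e ds K i (cf_digit y)].

Lemma adapted_failure_before e ds K N0 n : adapted n (failure_before e ds K N0
  n).
Proof.
apply: (@adapted_pred _ _ (fun a => forall i, (N0 <= i < n)%N ->
  ~ success e ds K i a)) => a b ab na.
move=> i i_n sb; apply: (na i i_n); apply: success_ext sb => j /andP[j0 ji].
by rewrite ab// j0 (leq_trans ji)//; case/andP: i_n.
Qed.

Lemma measurable_failure e ds K N0 : measurable (failure e ds K N0).
Proof.
have -> : failure e ds K N0 = \bigcap_n failure_before e ds K N0 n.
  apply/seteqP; split => y.
    by move=> [Oy h] n _; split=> // i /andP[/h].
  move=> h; split; first by have [] := h 0%N I.
  by move=> i Ni; have [_] := h i.+1 I; apply; rewrite Ni ltnSn.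
by apply: bigcapT_measurable => n;
  exact: adapted_measurable (adapted_failure_before _ _ _ _ _).
Qed.

(** The state at time [n] in which a first success needs only one large digit. *)
Definition opportunity e ds K N0 s n : set R :=
  failure_before e ds K N0 n `&`
  [set y | irr01 y /\ (good_den e ds n (cf_digit y) /\
    (digit_sum (cf_digit y) n <= s)%N)].

Lemma adapted_opportunity e ds K N0 (s : nat) n : adapted n (opportunity e ds K
  N0 s n).
Proof.
apply: adaptedI; first exact: adapted_failure_before.
apply: (@adapted_pred _ _ (fun a => good_den e ds n a /\
  (digit_sum a n <= s)%N)) => a b ab.
by move=> [h1 h2]; split; [exact: good_den_ext h1|rewrite -(digit_sum_ext ab)].
Qed.

(** First successes at different times exclude each other, and the next digit
    reaches [K s] with conditional probability at least [1/(K s)]. *)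
Lemma sum_opportunity e ds K N0 (s : nat -> nat) N : (0 < K)%N ->
  (forall n, (N0 <= n)%N -> 0 < s n)%N ->
  \sum_(N0 <= n < N) mu (opportunity e ds K N0 (s n) n) / (K * s n)%:R <= 1.
Proof.
move=> K0 s0.
pose F n := opportunity e ds K N0 (s n) n `&` @digit_ge R n (K * s n).
have mF n : measurable (F n).
  apply: measurableI; last exact: measurable_digit_ge.
  exact: adapted_measurable (adapted_opportunity _ _ _ _ _ _).
apply: (@le_trans _ _ (\sum_(N0 <= n < N) mu (@irr01 R `&` F n))).
  rewrite big_nat [leRHS]big_nat; apply: ler_sum => n /andP[Nn _].
  have Ks : (0 < K * s n)%N by rewrite muln_gt0 K0 s0.
  have := mu_digit_ge_lower (adapted_opportunity e ds K N0 (s n) n) Ks.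
  rewrite ler_pdivrMr ?ltr0n// => /le_trans; apply; rewrite mulrC ler_wpM2r//.
  apply: mu_mono; [exact: mF|by apply: measurableI => //;
    exact: measurable_irr01|].
  by move=> y [Fy Oy].
rewrite -(mu_irr01 R); apply: mu_sum_disjoint => //;
  first exact: measurable_irr01.
move=> i j y Ni ij jN [[_ [Oy [gi si]]] [_ Ki]] [[[_ fj] _] _].
apply: (fj i); rewrite ?Ni//; split=> //.
by apply: leq_trans Ki; rewrite leq_mul2l si orbT.
Qed.

Lemma harmonic_block (a k : nat) : \sum_(2 ^ a <= J < 2 ^ (a + k)) (J%:R^-1 :
  R) >= k%:R / 2.
Proof.
elim: k => [|k IH]; first by rewrite addn0 big_geq// mul0r.
rewrite addnS (@big_cat_nat _ _ _ (2 ^ (a + k)))/= ?leq_exp2l ?leq_addr//.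
rewrite -natr1 mulrDl mul1r; apply: lerD => //.
apply: (@le_trans _ _ (\sum_(2 ^ (a + k) <= J < 2 ^ (a + k).+1) ((2 ^ (a +
  k).+1)%:R^-1 : R))).
  rewrite sumr_const_nat expnS mul2n -addnn addnK -[leRHS]mulr_natr.
  have n0 : (2 ^ (a + k))%:R != 0 :> R by rewrite pnatr_eq0 -lt0n expn_gt0.
  by rewrite addnn -mul2n natrM invfM mulfVK.
rewrite [leLHS]big_nat [leRHS]big_nat; apply: ler_sum => J /andP[J1 J2].
by rewrite lef_pV2 ?posrE ?ltr0n ?expn_gt0 ?(leq_trans _ J1) ?expn_gt0//
  ler_nat ltnW.
Qed.

Lemma sum_dyadic (g : nat -> R) J1 L : (J1 <= L)%N ->
  \sum_(J1 <= J < L) \sum_(2 ^ J <= n < 2 ^ J.+1) g n = \sum_(2 ^ J1 <= n < 2 ^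
    L) g n.
Proof.
elim: L => [|L IH]; first by rewrite leqn0 => /eqP->; rewrite !big_geq.
rewrite leq_eqVlt => /predU1P[->|]; first by rewrite !big_geq.
rewrite ltnS => JL; rewrite big_nat_recr//= IH//.
by rewrite -big_cat_nat ?leq_exp2l.
Qed.

(** If failures had more than the proportion [1 - c] of the cylinder, the
    opportunities among them would have a frequency bounded below, and their
    weights [1/(K s_n)], of order [1/(J 2^J)] in the block of [2^J], would sum
    to infinity. *)
Lemma mu_failure_cyl e ds (c : R) C x m K N0 : 0 < c -> (0 < C)%N ->
  (0 < K)%N -> irr01 x ->
  (exists J0, forall J, (J0 <= J)%N -> c * (2 ^ J)%:R * mu (cyl x m) <=
      \sum_(2 ^ J <= n < 2 ^ J.+1) mu (cyl x m `&` good_at e ds C J n)) ->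
  mu (cyl x m `&` failure e ds K N0) <= (1 - c) * mu (cyl x m).
Proof.
move=> c0 C0 K0 Ox [J0 hJ]; set I := cyl x m in hJ *.
have mI : measurable I by exact: measurable_cyl.
have mN := measurable_failure e ds K N0.
pose delta := c * mu I - mu (I `\` failure e ds K N0).
suff : delta <= 0 by rewrite /delta (mu_split mI mN); lra.
rewrite leNgt; apply/negP => delta0.
pose b := maxn J0 N0.
(* Blocks start at [2^b], itself a power of two, for the lower bound on the
   harmonic sum. *)
pose s n := (C * (trunc_log 2 n * 2 ^ trunc_log 2 n))%N.
have bk J : (2 ^ b <= J)%N -> (J0 <= J)%N && (N0 <= 2 ^ J)%N && (0 < J)%N.
  have b2 : (b < 2 ^ b)%N by rewrite ltn_expl.
  move=> bJ; have J2 : (J < 2 ^ J)%N by rewrite ltn_expl.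
  rewrite (leq_trans (leq_maxl J0 N0))//;
    last by rewrite -/b (leq_trans (ltnW b2)).
  rewrite (leq_trans (leq_maxr J0 N0)) ?(leq_trans _ bJ) ?expn_gt0//.
  by rewrite -/b (leq_trans (ltnW b2))// (leq_trans bJ)// ltnW.
have key J : (2 ^ b <= J)%N -> delta / (K * C)%:R * J%:R^-1 <=
   \sum_(2 ^ J <= n < 2 ^ J.+1) mu (opportunity e ds K (2 ^ 2 ^ b) (s n) n) /
     (K * s n)%:R.
  move=> /bk/andP[/andP[J0J N0J] Jpos].
  have KCJ : 0 < (K * (C * (J * 2 ^ J)))%:R :> R by rewrite ltr0n !muln_gt0 K0
    C0 Jpos expn_gt0.
  apply: (@le_trans _ _ (\sum_(2 ^ J <= n < 2 ^ J.+1)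
     (mu (I `&` good_at e ds C J n) - mu (I `\` failure e ds K N0)) / (K * (C *
       (J * 2 ^ J)))%:R)).
    rewrite -mulr_suml ler_pdivlMr// sumrB sumr_const_nat expnS mul2n -addnn
      addnK.
    have -> : delta / (K * C)%:R / J%:R * (K * (C * (J * 2 ^ J)))%:R = delta *
      (2 ^ J)%:R.
      by rewrite !natrM; field; rewrite !pnatr_eq0 -!lt0n K0 C0 Jpos.
    rewrite /delta mulrBl -[X in _ <= _ - X]mulr_natr.
    have := hJ J J0J; rewrite expnS mul2n -addnn; lra.
  rewrite big_nat [leRHS]big_nat; apply: ler_sum => n /andP[n1 n2].
  have -> : s n = (C * (J * 2 ^ J))%N by rewrite /s (trunc_log_eq _ (_ : 2 ^ J
    <= n < 2 ^ J.+1)%N) ?n1.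
  rewrite ler_pM2r ?invr_gt0// lerBlDr.
  have mG : measurable (good_at e ds C J n).
    by apply: (adapted_measurable (adapted_good_at _ _ _ _)); exact: ltnW.
  have mIG : measurable (I `&` good_at e ds C J n) by exact: measurableI.
  rewrite (mu_split mIG mN); apply: lerD; apply: mu_mono.
  - exact: measurableI.
  - exact: adapted_measurable (adapted_opportunity _ _ _ _ _ _).
  - move=> y [[[_ [_ [[ty _] gy]]] [_ fy]] Oy]; split; split=> //.
      move=> i /andP[i1 _]; apply: fy; apply: leq_trans i1.
      by rewrite (leq_trans _ (ltnW (ltn_expl _ _)))// (leq_trans _ (ltnW
        (ltn_expl _ _)))// leq_maxr.
    split=> //; apply: leq_trans ty; apply: digit_sum_mono; exact: ltnW.
  - by apply: measurableD.
  - exact: measurableD.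
  - by move=> y [[[Iy _] ny] _].
have all k : delta / (K * C)%:R * (k%:R / 2) <= 1.
  have KC0 : 0 < (K * C)%:R :> R by rewrite ltr0n muln_gt0 K0.
  have spos n : (2 ^ 2 ^ b <= n)%N -> (0 < s n)%N.
    move=> bn; rewrite /s !muln_gt0 C0 expn_gt0 andbT/=.
    apply: (@leq_trans (2 ^ b)); first by rewrite expn_gt0.
    by apply: trunc_log_max.
  apply: le_trans (sum_opportunity e ds (2 ^ 2 ^ (b + k)) K0 spos).
  rewrite -sum_dyadic ?leq_exp2l ?leq_addr//.
  apply: (@le_trans _ _ (\sum_(2 ^ b <= J < 2 ^ (b + k)) delta / (K * C)%:R *
    J%:R^-1)).
    by rewrite -mulr_sumr ler_wpM2l ?harmonic_block// divr_ge0// ltW.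
  by rewrite big_nat [leRHS]big_nat; apply: ler_sum => J /andP[bJ _];
    exact: key.
have KC0 : 0 < (K * C)%:R :> R by rewrite ltr0n muln_gt0 K0.
have := all (Num.truncn (2 * (K * C)%:R / delta)).+1.
rewrite leNgt => /negP; apply.
rewrite mulrA ltr_pdivlMr// mul1r mulrAC ltr_pdivlMr// -ltr_pdivrMl// mulrC.
exact: truncnS_gt.
Qed.

End FirstSuccess.

(** * Almost every number succeeds infinitely often *)

Section NullSets.
Variable R : realType.
Implicit Types (a : nat -> nat) (x y d e : R) (A B E F I U : set R) (m n : nat)
  (ds : seq R).

(** Countable additivity, stated through the partial sums. *)
Lemma mu_countable_le A (F : nat -> set R) (v : R) : measurable A ->
  (forall i, measurable (F i)) -> trivIset [set: nat] F ->
  A `&` @irr01 R `<=` \bigcup_i F i ->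
  (forall N, \sum_(0 <= i < N) mu (A `&` F i) <= v) -> mu A <= v.
Proof.
move=> mA mF tF AF Fv; rewrite -lee_fin muE//.
have -> : A `&` @irr01 R = \bigcup_i (A `&` F i `&` @irr01 R).
  apply/seteqP; split => y; last by case=> i _ [[]].
  by move=> [Ay Oy]; have [i _ Fi] := AF y (conj Ay Oy); exists i.
have mAF i : measurable (A `&` F i `&` @irr01 R).
  by apply: measurableI; [exact: measurableI|exact: measurable_irr01].
rewrite (measure_bigcup (@lebesgue_measure R) [set: nat] (fun k =>
  A `&` F k `&` @irr01 R)).
- apply: lime_le; first by apply: is_cvg_nneseries => k _ _; exact: measure_ge0.
  apply: nearW => N; rewrite (eq_bigl xpredT); last by move=> k;
    rewrite in_setT.
  rewrite (eq_bigr (fun k => (mu (A `&` F k))%:E)); last first.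
    by move=> k _; rewrite muE//; exact: measurableI.
  by rewrite sumEFin lee_fin.
- by move=> k _; exact: (mAF k).
- move=> i j _ _ [y [[[_ yi] _] [[_ yj] _]]].
  by apply: tF => //; exists y.
Qed.

Lemma cyl_sub_open x U : irr01 x -> open U -> U x -> exists n, cyl x n `<=` U.
Proof.
move=> Ox oU Ux; have /nbhs_ballP[r /= r0 rU] := open_nbhs_nbhs (conj oU Ux).
pose n := (Num.truncn r^-1).+1; exists n => y yx; apply: rU.
have [l hl] := cyl_in_itv n Ox; have := hl x (cyl_self n Ox); have := hl y yx.
have n0 : 0 < n%:R :> R by rewrite ltr0n.
have a0 := cf_digit_gt0 Ox.
have nq : n%:R <= (cf_den (cf_digit x) n)%:R :> R by rewrite ler_nat cf_den_ge.
have q1 : 1 <= (cf_den (cf_digit x) n)%:R :> R by rewrite ler1n cf_den_gt0.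
have small : mu (cyl x n) < r.
  rewrite mu_cyl// -[ltRHS]invrK ltf_pV2 ?posrE ?invr_gt0//; last first.
    by rewrite mulr_gt0 ?ltr_pwDl// (lt_le_trans _ q1).
  apply: lt_le_trans (truncnS_gt _) (le_trans nq _).
  by rewrite ler_peMr ?(le_trans _ q1)// (le_trans q1)// lerDl.
by rewrite -ball_normE/= ltr_norml; lra.
Qed.

(** A set that leaves a fixed proportion of every cylinder has no density
    point. Concretely: the maximal cylinders inside an open set that
    approximates [A] from outside form a partition of it, and [A] occupies at
    most the proportion [1 - c] of each. *)
Lemma mu_null_of_cyl A (c : R) : measurable A -> A `<=` @irr01 R ->
  0 < c <= 1 ->
  (forall x m, irr01 x -> mu (cyl x m `&` A) <= (1 - c) * mu (cyl x m)) ->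
    mu A = 0.
Proof.
move=> mA AO /andP[c0 c1] h; apply/eqP; rewrite eq_le mu_ge0 andbT leNgt;
  apply/negP => A0.
have lA : lebesgue_measure A = (mu A)%:E by rewrite muE// setIidl.
have eta0 : 0 < c * mu A by rewrite mulr_gt0.
have [|U [oU AU UA]] := lebesgue_regularity_outer mA _ eta0;
  first by move: (ltry (mu A)); rewrite -lA.
have mU : measurable U by exact: open_measurable.
have muU : mu U <= mu A + c * mu A.
  rewrite (mu_split mU mA) (_ : U `&` A = A); last by apply/setIidPr.
  rewrite lerD2l -lee_fin muE; last exact: measurableD.
  apply: le_trans (ltW UA); apply: le_measure; rewrite ?inE.
  - by apply: measurableI; [exact: measurableD|exact: measurable_irr01].
  - exact: measurableD.
  - by move=> z [].
(* The points whose largest cylinder inside [U] has order [n]. *)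
pose F n := [set x : R | irr01 x /\ (cyl x n `<=` U /\ forall k, (k < n)%N ->
  ~ cyl x k `<=` U)].
have cylE x y n k : cyl x n y -> irr01 x -> (k <= n)%N -> cyl x k = cyl y k.
  move=> [Oy xy] Ox kn; apply/seteqP; split => z [Oz zi]; split=>
    // i /andP[i0 ik].
    by rewrite zi ?i0// xy// i0 (leq_trans ik).
  by rewrite zi ?i0// xy// i0 (leq_trans ik).
have adF n : adapted n (F n).
  split; first by move=> x [].
  move=> x y [Ox [h1 h2]] xy; split; first by case: xy.
  split; first by rewrite -(cylE _ _ _ _ xy Ox (leqnn n)).
  by move=> k kn; rewrite -(cylE _ _ _ _ xy Ox (ltnW kn)); exact: h2.
have mF n : measurable (F n) by exact: adapted_measurable (adF n).
have dF i j r : (i < j)%N -> F i r -> ~ F j r.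
  by move=> ij [_ [iU _]] [_ [_ /(_ i ij)]].
have tF : trivIset [set: nat] F.
  move=> i j _ _ [y [Fi Fj]].
  by case: (ltngtP i j) => // lt; [case: (dF _ _ _ lt Fi)|case: (dF _ _ _ lt
    Fj)].
have : mu A <= (1 - c) * mu U.
  apply: (mu_countable_le mA mF tF).
    move=> y [Ay Oy]; have ex : exists n, `[< cyl y n `<=` U >].
      by have [n] := cyl_sub_open Oy oU (AU y Ay); exists n; exact/asboolP.
    exists (ex_minn ex) => //; case: ex_minnP => n /asboolP nU nmin; split=>
      //; split=> //.
    by move=> k kn /asboolP/nmin; rewrite leqNgt kn.
  move=> N; apply: (@le_trans _ _ (\sum_(0 <= i < N) (1 - c) * mu (U `&` F i))).
    apply: ler_sum => i _; rewrite setIC.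
    have FU : U `&` F i = F i `&` [set: R].
      rewrite setIT; apply/seteqP; split => y; first by case.
      by move=> [Oy [h1 h2]]; split=> //; apply: h1; exact: cyl_self.
    rewrite FU; apply: (mu_adapted_le (adF i)) => //; first by rewrite subr_ge0.
    by move=> x [Ox _]; rewrite setIT h.
  rewrite -mulr_sumr ler_wpM2l ?subr_ge0//; apply: mu_sum_disjoint => //.
  by move=> i j r _ ij _; exact: dF.
have : (1 - c) * mu U <= (1 - c) * (mu A + c * mu A) by rewrite ler_wpM2l
  ?subr_ge0.
have : 0 < c * (c * mu A) by rewrite mulr_gt0.
lra.
Qed.

Theorem ae_success ds : (forall d, d \in ds -> d \isn't a Num.int) ->
  exists e B, [/\ 0 < e, measurable B, mu B = 0 & forall x, irr01 x -> ~ B x ->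
    forall K N0, exists2 n, (N0 <= n)%N & success e ds K.+1 n (cf_digit x)].
Proof.
move=> /many_good[e [c [C [e0 /andP[c0 c1] C0 h]]]].
pose Bad : set R := \bigcup_K \bigcup_N0 failure e ds K.+1 N0.
have mBad : measurable Bad.
  by apply: bigcupT_measurable => K; apply: bigcupT_measurable => N0;
    exact: measurable_failure.
exists e, Bad; split=> //.
  have null : lebesgue_measure Bad = 0%E.
    apply/negligibleP => //; apply: negligible_bigcup => K;
      apply: negligible_bigcup => N0.
    apply/negligibleP; first exact: measurable_failure.
    have mf := measurable_failure e ds K.+1 N0.
    have fO : failure e ds K.+1 N0 `<=` @irr01 R by move=> y [].
    have E := muE mf; rewrite (setIidl fO) in E; apply: etrans (esym E) _;
      congr EFin.
    apply: (mu_null_of_cyl mf fO (c := c)); first by rewrite c0.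
    by move=> x m Ox; apply: (@mu_failure_cyl _ _ _ _ C) => //; exact: h.
  apply: EFin_inj; rewrite muE//; apply/eqP; rewrite eq_le measure_ge0 andbT.
  apply: (@le_trans _ _ (lebesgue_measure Bad)); last by rewrite null.
  by apply: le_measure; rewrite ?inE//; apply: measurableI => //;
    exact: measurable_irr01.
move=> x Ox nB K N0; apply: contrapT => none; apply: nB.
exists K => //; exists N0 => //; split=> // i Ni s; apply: none; by exists i.
Qed.

End NullSets.

(** * Sums of the sawtooth along a rotation *)

Section SawtoothSums.
Variable R : realType.
Implicit Types (x y s t u w z : R) (n m q p k j : nat).

Definition fpart x : R := x - (Num.floor x)%:~R.

Lemma fpart_itv x : 0 <= fpart x < 1.
Proof.
by have /andP[f1 f2] := floor_itv x; move: f2; rewrite intrD /fpart; lra.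
Qed.

Lemma fpart_int x (m : int) : fpart (x + m%:~R) = fpart x.
Proof.
by rewrite /fpart floorDrz ?intr_int// intrKfloor intrD opprD addrACA subrr
  addr0.
Qed.

(** The integer witness [m] avoids computing floors. *)
Lemma fpart_uniq x y (m : int) : 0 <= y < 1 -> x = y + m%:~R -> fpart x = y.
Proof.
move=> y01 ->; rewrite fpart_int /fpart.
have -> : Num.floor y = 0 by apply: floor_def; rewrite add0r.
by rewrite subr0.
Qed.

(** Multiplication by [p] and translation by [j] permute the residues modulo
    [q]. *)
Lemma sum_modn_affine (F : nat -> R) p q j : (0 < q)%N -> coprime p q ->
  \sum_(0 <= k < q) F ((k * p + j) %% q)%N = \sum_(0 <= k < q) F k.
Proof.
move=> q0 pq; rewrite !big_mkord.
pose h (k : 'I_q) := Ordinal (ltn_pmod (k * p + j) q0).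
rewrite [RHS](reindex_inj (h := h))//= => k1 k2 /(congr1 val)/= /eqP.
rewrite eqn_modDr => E; apply: val_inj => /=.
wlog k12 : k1 k2 E / (k1 <= k2)%N.
  move=> W; case/orP: (leq_total k1 k2) => [|/W]; first exact: W.
  by rewrite eq_sym => /(_ E).
move: E; rewrite eq_sym eqn_mod_dvd ?leq_mul2r ?k12 ?orbT// -mulnBl.
rewrite Gauss_dvdl; last by rewrite coprime_sym.
have : (k2 - k1 < q)%N by rewrite (leq_ltn_trans (leq_subr _ _)).
case: (posnP (k2 - k1)) => [/eqP k21 _ _|k0 kq /(dvdn_leq k0)].
  by apply/eqP; rewrite eqn_leq k12 -subn_eq0.
by rewrite leqNgt kq.
Qed.

Lemma sum_nat_id q : (\sum_(0 <= k < q) (k%:R : R)) = q%:R * (q%:R - 1) / 2.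
Proof.
elim: q => [|q IH]; first by rewrite big_geq// !mul0r.
by rewrite big_nat_recr//= IH -natr1; field.
Qed.

(** If [j/q <= {y} < (j+1)/q] with remainder [e], the fractional part of [y +
    k p/q] is [((k p + j) mod q)/q + e]. *)
Lemma sum_fpart_rational p q y : (0 < q)%N -> coprime p q ->
  \sum_(0 <= k < q) fpart (y + k%:R * (p%:R / q%:R)) =
  fpart (q%:R * y) + (q%:R - 1) / 2.
Proof.
move=> q0 pq; have Q0 : 0 < q%:R :> R by rewrite ltr0n.
have /andP[f0 f1] := fpart_itv y.
have qf0 : 0 <= q%:R * fpart y by rewrite mulr_ge0// ltW.
pose j := Num.truncn (q%:R * fpart y).
have /andP[j1 j2] := truncn_itv qf0; rewrite -/j -natr1 in j1 j2.
pose e := fpart y - j%:R / q%:R.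
have qe : q%:R * e = q%:R * fpart y - j%:R by rewrite /e; field; rewrite gt_eqF.
have E k : fpart (y + k%:R * (p%:R / q%:R)) = ((k * p + j) %% q)%N%:R / q%:R +
  e.
  apply: (@fpart_uniq _ _ (Num.floor y + ((k * p + j) %/ q)%N%:Z)).
    have M0 : 0 <= ((k * p + j) %% q)%N%:R :> R by [].
    have M1 : ((k * p + j) %% q)%N%:R + 1 <= q%:R :> R.
      by rewrite natr1 ler_nat ltn_pmod.
    have -> : ((k * p + j) %% q)%N%:R / q%:R + e = (((k * p + j) %% q)%N%:R +
      q%:R * e) / q%:R.
      by field; rewrite gt_eqF.
    by rewrite ler_pdivlMr// ltr_pdivrMr// mul0r mul1r; lra.
  have D : (k * p)%:R + j%:R = ((k * p + j) %/ q)%N%:R * q%:R + ((k * p + j) %%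
    q)%N%:R :> R.
    by rewrite -natrM -!natrD -divn_eq.
  rewrite intrD -pmulrn /e.
  have -> : ((k * p + j) %% q)%N%:R = (k * p)%:R + j%:R - ((k * p + j) %/
    q)%N%:R * q%:R :> R.
    by rewrite D; ring.
  by rewrite /fpart natrM; field; rewrite gt_eqF.
rewrite (eq_bigr _ (fun k _ => E k)).
rewrite (@sum_modn_affine (fun r => r%:R / q%:R + e))//.
rewrite big_split/= -mulr_suml sum_nat_id sumr_const_nat subn0 -[e *+
  q]mulr_natl qe.
rewrite (@fpart_uniq (q%:R * y) (q%:R * fpart y - j%:R) (q%:Z * Num.floor y +
  j%:Z)).
- by field; rewrite gt_eqF.
- by lra.
- by rewrite intrD intrM -!pmulrn /fpart; ring.
Qed.

(** The shift of the [k]-th point lies between [0] and [theta/q]. The floor is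
    monotone, so the integers crossed are at most those crossed when all
    points move by [theta/q], and [sum_fpart_rational] counts these. *)
Lemma sum_fpart_perturbed p q (alpha theta : R) y : (0 < q)%N -> coprime p q ->
  theta = q%:R * (q%:R * alpha - p%:R) -> 0 <= theta ->
  `|\sum_(0 <= k < q) (fpart (y + k%:R * alpha) - 2^-1) - (fpart (q%:R * y) -
    2^-1)|
  <= theta + ((Num.floor (q%:R * y + theta))%:~R - (Num.floor (q%:R * y))%:~R).
Proof.
move=> q0 pq thE th0; have Q0 : 0 < q%:R :> R by rewrite ltr0n.
pose sg := theta / q%:R; have sg0 : 0 <= sg by rewrite divr_ge0.
have qsg : q%:R * sg = theta by rewrite /sg; field; rewrite gt_eqF.
pose Y k := y + k%:R * (p%:R / q%:R).
pose sh k := k%:R * theta / q%:R ^+ 2.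
have aE : alpha = p%:R / q%:R + theta / q%:R ^+ 2.
  by rewrite thE; field; rewrite gt_eqF.
have YE k : y + k%:R * alpha = Y k + sh k by rewrite /Y /sh aE; ring.
have sh0 k : 0 <= sh k by rewrite /sh !mulr_ge0// invr_ge0 exprn_ge0.
have sh1 k : (k < q)%N -> sh k <= sg.
  move=> kq; rewrite /sh /sg expr2 invfM mulrA ler_pM2r ?invr_gt0//.
  by rewrite ler_pdivrMr// mulrC ler_wpM2l// ler_nat ltnW.
have S1 := sum_fpart_rational y q0 pq; have S2 :=
  sum_fpart_rational (y + sg) q0 pq.
rewrite mulrDr qsg in S2.
have lo : \sum_(0 <= k < q) (fpart (Y k) + sg) -
   (\sum_(0 <= k < q) (fpart (Y k) + sg - fpart (Y k + sg)) + theta) <=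
   \sum_(0 <= k < q) fpart (y + k%:R * alpha).
  rewrite -qsg mulr_natl -[X in sg *+ X]subn0 -sumr_const_nat -big_split/=
    -sumrB.
  rewrite [leLHS]big_nat [leRHS]big_nat; apply: ler_sum => k /andP[_ kq].
  rewrite YE /fpart.
  have : Num.floor (Y k + sh k) <= Num.floor (Y k + sg).
    by apply: le_floor; rewrite lerD2l sh1.
  rewrite -(ler_int R) => ?; have := sh0 k; lra.
have hi : \sum_(0 <= k < q) fpart (y + k%:R * alpha) <= \sum_(0 <= k < q)
  (fpart (Y k) + sg).
  rewrite [leLHS]big_nat [leRHS]big_nat; apply: ler_sum => k /andP[_ kq].
  rewrite YE /fpart.
  have : Num.floor (Y k) <= Num.floor (Y k + sh k) by apply: le_floor;
    rewrite lerDl.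
  rewrite -(ler_int R) => ?; have := sh1 k kq; lra.
have e1 : \sum_(0 <= k < q) (fpart (Y k) + sg) = fpart (q%:R * y) + (q%:R - 1)
  / 2 + theta.
  by rewrite big_split/= S1 sumr_const_nat subn0 -[sg *+ q]mulr_natl qsg.
have e2 : \sum_(0 <= k < q) (fpart (Y k) + sg - fpart (Y k + sg)) =
   fpart (q%:R * y) + theta - fpart (q%:R * y + theta).
  rewrite sumrB e1 (eq_bigr (fun k => fpart (y + sg + k%:R * (p%:R / q%:R)))).
    by rewrite S2; ring.
  by move=> k _; rewrite /Y addrAC.
rewrite e1 in hi lo; rewrite e2 in lo.
rewrite sumrB sumr_const_nat subn0 -[_ *+ q]mulr_natl ler_norml.
rewrite /fpart in hi lo *.
have : Num.floor (q%:R * y) <= Num.floor (q%:R * y + theta) by apply: le_floor;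
  rewrite lerDl.
rewrite -(ler_int R) => ?; lra.
Qed.

(** The block with index [j] starts at [q y + j theta] modulo one, so the
    counts of crossed integers telescope. *)
Lemma sum_fpart_blocks p q (alpha theta : R) y m : (0 < q)%N -> coprime p q ->
  theta = q%:R * (q%:R * alpha - p%:R) -> 0 <= theta ->
  `|\sum_(0 <= k < m * q) (fpart (y + k%:R * alpha) - 2^-1) -
    \sum_(0 <= j < m) (fpart (q%:R * y + j%:R * theta) - 2^-1)|
  <= m%:R * theta + ((Num.floor (q%:R * y + m%:R * theta))%:~R - (Num.floor
    (q%:R * y))%:~R).
Proof.
move=> q0 pq thE th0; elim: m => [|m IH].
  by rewrite mul0n !big_geq// !mul0r addr0 !subrr normr0 addr0.
rewrite mulSn addnC (@big_cat_nat _ _ _ (m * q))/= ?leq_addr//.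
rewrite -{2}[(m * q)%N]add0n big_addn addKn big_nat_recr//=.
have := sum_fpart_perturbed (y + (m * q)%:R * alpha) q0 pq thE th0.
have yE : q%:R * (y + (m * q)%:R * alpha) = (q%:R * y + m%:R * theta) + (m * q
  * p)%:Z%:~R.
  by rewrite thE -pmulrn !natrM; ring.
have fl (s t : R) (N : int) : (Num.floor (s + N%:~R))%:~R - (Num.floor (t +
  N%:~R))%:~R =
    (Num.floor s)%:~R - (Num.floor t)%:~R :> R.
  by rewrite !floorDrz ?intr_int// intrKfloor !intrD; ring.
rewrite yE fpart_int [_ + _%:~R + theta]addrAC fl.
rewrite (eq_bigr (fun k => fpart (y + (k + m * q)%:R * alpha) - 2^-1));
  last first.
  by move=> k _; congr (fpart _ - _); rewrite natrD mulrDl; ring.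
have -> : q%:R * y + m%:R * theta + theta = q%:R * y + m.+1%:R * theta.
  by rewrite -natr1; ring.
move=> h; rewrite opprD addrACA.
apply: le_trans (ler_normD _ _) _; apply: le_trans (lerD IH h) _.
by rewrite -natr1; lra.
Qed.

(** The periodic primitive of [{x} - 1/2]. *)
Definition saw x : R := (fpart x ^+ 2 - fpart x) / 2.

Lemma saw_bound x : - 2^-1 <= saw x <= 0.
Proof.
have /andP[f0 f1] := fpart_itv x; rewrite /saw; move: (fpart x) f0 f1 =>
  f f0 f1.
have h : 0 <= f * (1 - f) by rewrite mulr_ge0// subr_ge0 ltW.
have := sqr_ge0 f; move=> f2; apply/andP; split; lra.
Qed.

Lemma saw_int x (m : int) : saw (x + m%:~R) = saw x.
Proof. by rewrite /saw fpart_int. Qed.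

Lemma saw_lip x y : `|saw x - saw y| <= 2^-1 * `|x - y|.
Proof.
wlog xy : x y / x <= y.
  by move=> W; case/orP: (le_total x y) => [/W//|/W];
    rewrite distrC [`|y - x|]distrC.
rewrite [`|x - y|]distrC [`|y - x|]ger0_norm ?subr_ge0//.
have /andP[x0 x1] := fpart_itv x; have /andP[y0 y1] := fpart_itv y.
have fxy : Num.floor x <= Num.floor y by exact: le_floor.
move: fxy; rewrite le_eqVlt => /predU1P[e|lt].
  have yx : y - x = fpart y - fpart x by rewrite /fpart e; ring.
  have ba : 0 <= fpart y - fpart x by rewrite -yx subr_ge0.
  rewrite yx /saw; move: (fpart x) (fpart y) ba x0 x1 y0 y1 =>
    a b ba a0 a1 b0 b1.
  have h1 : 0 <= (b - a) * (a + b) by rewrite mulr_ge0// addr_ge0.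
  have h2 : 0 <= (b - a) * (2 - a - b) by rewrite mulr_ge0//; lra.
  by rewrite ler_norml; apply/andP; split; lra.
have : (Num.floor x + 1)%:~R <= (Num.floor y)%:~R :> R by rewrite ler_int lezD1.
rewrite intrD => h.
have -> : y - x = fpart y - fpart x + ((Num.floor y)%:~R - (Num.floor x)%:~R).
  by rewrite /fpart; ring.
rewrite /saw; move: (fpart x) (fpart y) x0 x1 y0 y1 => a b a0 a1 b0 b1.
have h1 : 0 <= (1 - a) * (1 + a) by rewrite mulr_ge0//; lra.
have h2 : 0 <= b * (2 - b) by rewrite mulr_ge0//; lra.
have := sqr_ge0 (1 - a); have := sqr_ge0 b => ? ?.
by rewrite ler_norml; apply/andP; split; lra.
Qed.

(** Between integers the error is exactly [theta^2/2]; if an integer is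
    crossed, both terms are at most [theta/2]. *)
Lemma saw_step t theta : 0 <= theta ->
  `|theta * (fpart t - 2^-1) - (saw (t + theta) - saw t)| <=
  theta ^+ 2 / 2 + theta * ((Num.floor (t + theta))%:~R - (Num.floor t)%:~R).
Proof.
move=> th0.
have fxy : Num.floor t <= Num.floor (t + theta) by apply: le_floor;
  rewrite lerDl.
have /andP[x0 x1] := fpart_itv t.
move: fxy; rewrite le_eqVlt => /predU1P[e|lt].
  have fE : fpart (t + theta) = fpart t + theta by rewrite /fpart -e; ring.
  rewrite e subrr mulr0 addr0 /saw fE.
  have -> : theta * (fpart t - 2^-1) - (((fpart t + theta) ^+ 2 - (fpart t +
    theta)) / 2 -
     (fpart t ^+ 2 - fpart t) / 2) = - (theta ^+ 2 / 2) by field.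
  by rewrite normrN ger0_norm// divr_ge0// sqr_ge0.
have : (Num.floor t + 1)%:~R <= (Num.floor (t + theta))%:~R :> R by rewrite
  ler_int lezD1.
rewrite intrD => h; have := saw_lip (t + theta) t.
rewrite addrAC subrr add0r (ger0_norm th0) => l.
apply: le_trans (ler_normB _ _) _.
have : `|theta * (fpart t - 2^-1)| <= theta * 2^-1.
  rewrite normrM (ger0_norm th0) ler_wpM2l// ler_norml; lra.
have := sqr_ge0 theta; have : theta * 1 <= theta * ((Num.floor (t + theta))%:~R
  - (Num.floor t)%:~R).
  rewrite ler_wpM2l//; lra.
lra.
Qed.

Lemma saw_sum u theta m : 0 <= theta ->
  `|theta * (\sum_(0 <= j < m) (fpart (u + j%:R * theta) - 2^-1)) -
    (saw (u + m%:R * theta) - saw u)| <=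
  m%:R * theta ^+ 2 / 2 + theta * ((Num.floor (u + m%:R * theta))%:~R -
    (Num.floor u)%:~R).
Proof.
move=> th0; elim: m => [|m IH].
  by rewrite big_geq// !mul0r mulr0 addr0 !subrr mulr0 normr0 addr0.
rewrite big_nat_recr//= mulrDr.
have := saw_step (u + m%:R * theta) th0.
have -> : u + m%:R * theta + theta = u + m.+1%:R * theta by rewrite -natr1;
  ring.
have -> : m.+1%:R * theta ^+ 2 / 2 = m%:R * theta ^+ 2 / 2 + theta ^+ 2 / 2.
  by rewrite -natr1; field.
by move: IH; rewrite !ler_norml => /andP[i1 i2] /andP[h1 h2]; apply/andP;
  split; lra.
Qed.

End SawtoothSums.

(** * Birkhoff sums at convergent denominators *)

Section BirkhoffAsymptotics.
Variable R : realType.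
Implicit Types (x y t u w z c : R) (n m q p k j a : nat).

(** The scale [theta] of the rotation and the scale [1/a] of the statement
    differ by a factor [1 + O(1/a)], and the sum itself is bounded after
    multiplication by [theta]. The integer [N] allows any lift of the circle
    point [q y]. *)
Lemma sum_fpart_saw p q a (alpha theta rho : R) y z c (N : int) :
  (0 < q)%N -> coprime p q -> (0 < a)%N ->
  theta = q%:R * (q%:R * alpha - p%:R) ->
  (a%:R + 2)^-1 <= theta <= a%:R^-1 -> 0 <= c <= 1 ->
  `|q%:R * y + N%:~R - z| <= rho ->
  `|(\sum_(0 <= k < Num.truncn (c * a%:R) * q) (fpart (y + k%:R * alpha) -
    2^-1)) / a%:R
     - (saw (z + c) - saw z)| <= rho + 25 / a%:R.
Proof.
move=> q0 pq a0 thE /andP[th1 th2] /andP[c0 c1] yz.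
have A0 : 0 < a%:R :> R by rewrite ltr0n.
have A1 : 1 <= a%:R :> R by rewrite ler1n.
have th0 : 0 < theta by apply: lt_le_trans th1; rewrite invr_gt0; lra.
have ca0 : 0 <= c * a%:R by rewrite mulr_ge0// ltW.
have /andP[m1 m2] := truncn_itv ca0; set m := Num.truncn _ in m1 m2 *.
rewrite -natr1 in m2.
have tha : theta * a%:R <= 1 by rewrite -ler_pdivlMr// mul1r.
have tha2 : 1 <= theta * (a%:R + 2) by rewrite -ler_pdivrMr ?mul1r//; lra.
have mth0 : 0 <= m%:R * theta by rewrite mulr_ge0// ltW.
have mthc : m%:R * theta <= c.
  apply: (@le_trans _ _ (c * a%:R * theta)); first by rewrite ler_wpM2r// ltW.
  by rewrite -mulrA ler_piMr// mulrC.
have tha' : theta <= 1 by apply: le_trans th2 _; rewrite invf_le1.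
(* Rounding [c a] down costs one step [theta], and [theta a >= 1 - 2 theta]
   costs two. *)
have mthc2 : c - 3 * theta <= m%:R * theta.
  have h1 : (c * a%:R - 1) * theta <= m%:R * theta by rewrite ler_wpM2r ?(ltW
    th0)//; lra.
  have h2 : c * 1 <= c * (theta * (a%:R + 2)) by rewrite ler_wpM2l.
  have h3 : c * theta <= 1 * theta by rewrite ler_wpM2r// ltW.
  lra.
set T := \sum_(0 <= k < _) _.
have blocks := sum_fpart_blocks y m q0 pq thE (ltW th0); rewrite -/T in blocks.
have saws := saw_sum (q%:R * y) m (ltW th0).
set u := q%:R * y in yz blocks saws; set S :=
  \sum_(0 <= j < m) _ in blocks saws.
set W := saw (u + m%:R * theta) - saw u in saws.
set D : R := (Num.floor (u + m%:R * theta))%:~R - (Num.floor u)%:~R in blocks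
  saws.
have D1 : D <= m%:R * theta + 1.
  have /andP[+ _] := floor_itv (u + m%:R * theta); have /andP[_] := floor_itv u.
  by rewrite intrD /D; lra.
have mth1 : m%:R * theta <= 1 by lra.
have TW : `|theta * T - W| <= 6 * theta.
  have h1 : `|theta * T - theta * S| <= theta * (m%:R * theta + D).
    by rewrite -mulrBr normrM gtr0_norm// ler_wpM2l// ltW.
  have h2 : theta * D <= theta * 2 by rewrite ler_wpM2l ?(ltW th0)//; lra.
  have h3 : theta * (m%:R * theta) <= theta * 1 by rewrite ler_wpM2l// ltW.
  apply: le_trans (ler_distD (theta * S) _ _) _; rewrite expr2 in saws; lra.
have W1 : `|W| <= 1.
  have /andP[s1 s2] := saw_bound (u + m%:R * theta); have /andP[s3 s4] :=
    saw_bound u.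
  by rewrite ler_norml /W; apply/andP; split; lra.
have thT : `|theta * T| <= 7.
  rewrite -[theta * T](subrK W); apply: le_trans (ler_normD _ _) _; lra.
(* Here [1/theta] exceeds [a] by at most two, and [theta T] is at most seven. *)
have Ta : `|T / a%:R - theta * T| <= 14 / a%:R.
  have -> : T / a%:R - theta * T = theta * T * ((theta^-1 - a%:R) / a%:R).
    by field; rewrite !gt_eqF.
  have th3 : 0 <= theta^-1 - a%:R <= 2.
    have tV : theta^-1 * theta = 1 by rewrite mulVf// gt_eqF.
    have tV0 : 0 < theta^-1 by rewrite invr_gt0.
    have h1 : theta^-1 * (theta * a%:R) <= theta^-1 * 1 by rewrite ler_wpM2l//
      ltW.
    have h2 : theta^-1 * 1 <= theta^-1 * (theta * (a%:R + 2)) by rewrite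
      ler_wpM2l// ltW.
    by rewrite mulrA tV mul1r in h1; rewrite mulrA tV mul1r in h2; apply/andP;
      split; lra.
  have /andP[th4 th5] := th3.
  rewrite mulrA normrM normfV (gtr0_norm A0) ler_pM2r ?invr_gt0// normrM
    (ger0_norm th4).
  have -> : 14 = 7 * 2 :> R by lra.
  by apply: ler_pM.
have WZ : `|W - (saw (z + c) - saw z)| <= rho + 2 / a%:R.
  have uN : saw u = saw (u + N%:~R) by rewrite saw_int.
  have uN' : saw (u + m%:R * theta) = saw (u + N%:~R + m%:R * theta).
    by rewrite addrAC saw_int.
  rewrite /W uN uN'.
  have l1 := saw_lip (u + N%:~R + m%:R * theta) (z + c).
  have l2 := saw_lip (u + N%:~R) z.
  have l3 : `|u + N%:~R + m%:R * theta - (z + c)| <= rho + 3 / a%:R.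
    have -> : u + N%:~R + m%:R * theta - (z + c) = (u + N%:~R - z) + (m%:R *
      theta - c) by ring.
    apply: le_trans (ler_normD _ _) _; apply: lerD => //.
    rewrite ler_norml; have : 3 * theta <= 3 / a%:R by rewrite ler_pM2l.
    have : 0 < a%:R^-1 :> R by rewrite invr_gt0.
    by move=> ? ?; apply/andP; split; lra.
  have aV : 0 < a%:R^-1 :> R by rewrite invr_gt0.
  rewrite opprD opprK addrACA [- saw _ + _]addrC.
  apply: le_trans (ler_normD _ _) _; rewrite [`|saw z - _|]distrC; lra.
have aV : 0 < a%:R^-1 :> R by rewrite invr_gt0.
have th6 : 6 * theta <= 6 * a%:R^-1 by rewrite ler_pM2l.
apply: le_trans (ler_distD W _ _) _.
have := ler_distD (theta * T) (T / a%:R) W.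
lra.
Qed.

(** The quantity is the reciprocal of [a + t' + q'/q], where [t'] is the next
    tail and [q'] the previous denominator. *)
Lemma theta_bounds x n : irr01 x -> ~~ odd n ->
  let q : R := (cf_den (cf_digit x) n)%:R in
  let p : R := (cf_nums (cf_digit x) n).1%:R in
  let a : R := (cf_digit x n.+1)%:R in
  (a + 2)^-1 <= q * (q * x - p) <= a^-1.
Proof.
move=> Ox ne; cbv zeta; have a0 := cf_digit_gt0 Ox.
set q : R := (cf_den _ _)%:R; set p : R := _.1%:R; set a : R :=
  (cf_digit x n.+1)%:R.
have Ot := irr01_iter n Ox; have t0 := irr01_gt0 Ot.
have tE := cf_digitE n Ox; have Ot' := irr01_iter n.+1 Ox.
have := mobius_sub n a0 (ltW t0); rewrite -(cf_tail_mobius n Ox).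
rewrite -signr_odd (negbTE ne) expr0 mul1r -/q -/p.
set q' : R := (cf_den_pred _ _)%:R; set t := iter n _ x in t0 tE *.
have q0 : 0 < q by rewrite ltr0n cf_den_gt0.
have q'0 : 0 <= q' by [].
have qq' : q' <= q by rewrite ler_nat cf_den_pred_le.
have A0 : 0 < a by rewrite ltr0n.
have d0 : 0 < q + t * q' by rewrite ltr_pwDl// mulr_ge0// ltW.
have t'0 := irr01_gt0 Ot'; have t'1 := irr01_lt1 Ot'.
set t' := iter n.+1 _ x in tE t'0 t'1.
move=> E; have -> : q * (q * x - p) = q ^+ 2 * (x - p / q) by field;
  rewrite gt_eqF.
rewrite E.
have -> : q ^+ 2 * (t / (q * (q + t * q'))) = (a + t' + q' / q)^-1.
  have ta : t * (a + t') = 1 by rewrite -tE divff// gt_eqF.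
  have -> : a + t' = t^-1 by rewrite tE.
  by field; rewrite !gt_eqF//= ltr_pwDl// mulr_ge0// ltW.
have q'q0 : 0 <= q' / q by rewrite divr_ge0// ltW.
have q'q1 : q' / q <= 1 by rewrite ler_pdivrMr// mul1r.
by rewrite !lef_pV2 ?posrE; lra.
Qed.

End BirkhoffAsymptotics.

(** * Integrals of the sawtooth *)

Section SawtoothIntegral.
Variable R : realType.
Implicit Types (x y c X g : R).
Let leb := @lebesgue_measure R.

Lemma measurable_fpart X : measurable_fun setT (fun y : R => fpart (y + X)).
Proof.
rewrite /fpart; apply: measurable_funB; first exact: measurable_funD.
apply: nondecreasing_measurable => // s t st.
by rewrite ler_int le_floor// lerD2r.
Qed.

Lemma lebesgue_cc c : 0 <= c -> leb `[0, c]%classic = c%:E.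
Proof.
rewrite le_eqVlt => /predU1P[<-|c0];
  rewrite /leb lebesgue_measure_itv/= lte_fin.
  by rewrite ltxx.
by rewrite c0 sube0.
Qed.

Lemma integrable_bounded c (h : R -> R) : 0 <= c -> measurable_fun setT h ->
  (forall y, 0 <= h y <= 1) -> leb.-integrable `[0, c]%classic (EFin \o h).
Proof.
move=> c0 mh h01; apply: measurable_bounded_integrable => //.
- by move: (ltry c); rewrite -(lebesgue_cc c0).
- exact: measurable_funS mh.
- exists 1; split=> // r r1 y _ /=.
  by have /andP[h0 h1] := h01 y; rewrite ger0_norm// (le_trans h1)// ltW.
Qed.

Lemma integrable_fpart c X : 0 <= c ->
  leb.-integrable `[0, c]%classic (EFin \o (fun y => fpart (y + X))).
Proof.
move=> c0; apply: integrable_bounded => //; first exact: measurable_fpart.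
by move=> y; have /andP[-> /ltW ->] := fpart_itv (y + X).
Qed.

Lemma integral_id c : 0 <= c -> \int[leb]_(y in `[0, c]) y = c ^+ 2 / 2.
Proof.
rewrite le_eqVlt => /predU1P[<-|c0].
  by rewrite set_itv1 Rintegral_set1 expr0n mul0r.
have dF (y : R) : is_derive y 1 (fun z : R => z ^+ 2 / 2) y.
  by apply: is_derive_eq; rewrite /GRing.scale/= ; field.
have cF : continuous (fun z : R => z ^+ 2 / 2).
  move=> y; apply: differentiable_continuous; apply/derivable1_diffP.
  by have [] := dF y.
rewrite /Rintegral (@continuous_FTC2 _ _ (fun z => z ^+ 2 / 2))//=.
- by rewrite expr0n mul0r subr0.
- by apply: continuous_subspaceT => y; exact: cvg_id.
- split.
  + by move=> y _; have [] := dF y.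
  + exact: cvg_at_right_filter (cF 0).
  + exact: cvg_at_left_filter (cF c).
- by move=> y _; rewrite derive1E; have [_ ->] := dF y.
Qed.

(** For [X] in the unit interval and [y <= 1], the fractional part of [y + X]
    is [y + X] minus the indicator of [y >= 1 - X]. *)
Lemma integral_fpart c X : 0 <= c <= 1 ->
  \int[leb]_(y in `[0, c]) fpart (y + X) = saw (X + c) - saw X + c / 2.
Proof.
move=> /andP[c0 c1].
wlog X01 : X / 0 <= X < 1.
  move=> W; have XE : X = fpart X + (Num.floor X)%:~R by rewrite /fpart subrK.
  have -> : saw (X + c) = saw (fpart X + c) by rewrite {1}XE addrAC saw_int.
  have -> : saw X = saw (fpart X) by rewrite {1}XE saw_int.
  rewrite -W ?fpart_itv//; apply: eq_Rintegral => y _.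
  by rewrite {1}XE addrA fpart_int.
have /andP[X0 X1] := X01.
pose E : set R := `[1 - X, +oo[%classic.
have mE : measurable E by exact: measurable_itv.
have fE y : 0 <= y <= c -> fpart (y + X) = (y + X) - \1_E y.
  move=> /andP[y0 yc]; rewrite indicE; have [yE|yE] := boolP (y \in E).
    move: yE; rewrite inE /E/= in_itv/= andbT => yE.
    by apply: (@fpart_uniq _ _ _ 1); [lra|rewrite subrK].
  have {}yE : y < 1 - X.
    by rewrite ltNge; apply: contra yE => h; rewrite inE /E/= in_itv/= h.
  by apply: (@fpart_uniq _ _ _ 0); [rewrite subr0; lra|rewrite subr0 addr0].
have iE : leb.-integrable `[0, c]%classic (EFin \o (\1_E : R -> R)).
  apply: integrable_bounded => //.
  by move=> y; rewrite indicE; case: (_ \in _); rewrite ?lexx ?ler01.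
have iid : leb.-integrable `[0, c]%classic (EFin \o (fun y : R => y)).
  apply: measurable_bounded_integrable => //; first by move: (ltry c);
    rewrite -(lebesgue_cc c0).
  exists 1; split=> // r r1 y /=; rewrite in_itv/= => /andP[y0 yc].
  by rewrite ger0_norm//; lra.
have iX : leb.-integrable `[0, c]%classic (EFin \o (cst X)).
  apply: integrable_bounded => //.
  by move=> y /=; rewrite X0 ltW.
have iidX : leb.-integrable `[0, c]%classic (EFin \o ((fun y : R =>
  y) \+ cst X)).
  by apply: (@integrableD _ _ _ leb _ _ (EFin \o id) (EFin \o cst X)).
rewrite (@eq_Rintegral _ _ _ leb _ (fun y => ((fun y : R =>
  y) \+ cst X) y - \1_E y)); last first.
  by move=> y; rewrite inE/= in_itv/= => /fE.
rewrite RintegralB// RintegralD// integral_id// Rintegral_cst//.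
rewrite [fine _](_ : _ = c); last by rewrite -[LHS]/(fine (leb _)) lebesgue_cc.
rewrite /Rintegral integral_indic//.
have SX : saw X = (X ^+ 2 - X) / 2 by rewrite /saw (@fpart_uniq _ X X 0)//
  addr0.
have [cX|cX] := ltP c (1 - X).
  have -> : E `&` `[0, c] = set0.
    by apply/seteqP; split=> // y []; rewrite /E/= !in_itv/=; lra.
  rewrite measure0/= subr0 SX /saw (@fpart_uniq _ (X + c) (X + c) 0) ?addr0//;
    last by lra.
  by field.
have -> : E `&` `[0, c] = `[1 - X, c]%classic.
  by apply/seteqP; split=> y; rewrite /E/= !in_itv/=; lra.
have -> : fine (leb `[1 - X, c]%classic) = c - (1 - X).
  rewrite /leb lebesgue_measure_itv/= lte_fin; move: cX; rewrite le_eqVlt =>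
    /predU1P[->|->].
    by rewrite ltxx subrr.
  by [].
rewrite SX /saw (@fpart_uniq _ (X + c) (X + c - 1) 1);
  [|by lra|by rewrite subrK].
by field.
Qed.

(** The closed indicator differs from [g + {y + X - g} - {y + X}] only when [y
    + X - g] is an integer, which is a null set. *)
Lemma integral_fpart_le c X g : 0 <= c <= 1 -> 0 <= g < 1 ->
  \int[leb]_(y in `[0, c]) (\1_(`[0, g] : set R) (fpart (y + X))) =
  c * g + (saw (X - g + c) - saw (X - g)) - (saw (X + c) - saw X).
Proof.
move=> c01 /andP[g0 g1]; have /andP[c0 c1] := c01.
pose h y : R := g + fpart (y + (X - g)) - fpart (y + X).
have mh : measurable_fun setT h.
  apply: measurable_funB; last exact: measurable_fpart.
  by apply: measurable_funD => //; exact: measurable_fpart.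
have mi : measurable_fun setT (fun y => \1_(`[0,
  g] : set R) (fpart (y + X)) : R).
  have mI : measurable_fun setT (\1_(`[0, g] : set R) : R ->
    R) by exact: measurable_indic.
  exact: (measurableT_comp mI (measurable_fpart X)).
have E : {ae leb, forall y, `[0, c]%classic y ->
   (EFin \o (fun y => \1_(`[0, g] : set R) (fpart (y + X)))) y = (EFin \o h) y}.
  exists (range (fun m : int => g - X + m%:~R)); split.
  - apply: countable_measurable => //;
    exact: sub_countable (card_image_le _ _) (countableP _).
  - apply: countable_lebesgue_measure0;
    exact: sub_countable (card_image_le _ _) (countableP _).
  - move=> y /= /not_implyP[_ ne]; apply: contrapT => nr; apply: ne; congr EFin.
    have /andP[f0 f1] := fpart_itv (y + X).
    have fg : fpart (y + X) != g.
      apply/eqP => fg; apply: nr; exists (Num.floor (y + X)) => //.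
      by rewrite -fg /fpart; ring.
    rewrite /h indicE; case: ltgtP fg => // fg _.
      rewrite mem_set/=; last by rewrite in_itv/= f0 ltW.
      rewrite (@fpart_uniq _ (y + (X - g)) (fpart (y + X) - g + 1) (Num.floor
        (y + X) - 1)).
      + by ring.
      + by lra.
      + by rewrite intrB /fpart; ring.
    rewrite memNset/=; last by rewrite in_itv/= f0/= leNgt fg.
    rewrite (@fpart_uniq _ (y + (X - g)) (fpart (y + X) - g) (Num.floor (y +
      X))).
    + by ring.
    + by lra.
    + by rewrite /fpart; ring.
have ig : leb.-integrable `[0, c]%classic (EFin \o (cst g)).
  apply: integrable_bounded => //.
  by move=> y /=; rewrite g0 ltW.
have igf : leb.-integrable `[0, c]%classic (EFin \o (cst g \+ (fun y =>
  fpart (y + (X - g))))).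
  by apply: (@integrableD _ _ _ leb _ _ (EFin \o cst g) (EFin \o (fun y =>
    fpart (y + (X - g))))) => //;
    exact: integrable_fpart.
have -> : \int[leb]_(y in `[0, c]) (\1_(`[0, g] : set R) (fpart (y + X))) =
   \int[leb]_(y in `[0, c]) ((cst g \+ (fun y =>
     fpart (y + (X - g)))) y - fpart (y + X)).
  rewrite /Rintegral; congr fine; apply: ae_eq_integral => //.
  - by apply/measurable_EFinP; exact: measurable_funS mi.
  - by apply/measurable_EFinP; exact: measurable_funS mh.
rewrite RintegralB//; last exact: integrable_fpart.
rewrite RintegralD//; last exact: integrable_fpart.
rewrite Rintegral_cst// [fine _](_ : _ = c);
  last by rewrite -[LHS]/(fine (leb _)) lebesgue_cc.
by rewrite !integral_fpart//; ring.
Qed.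

End SawtoothIntegral.

(** * The circle *)

Section Circle.
Variable R : realType.
Implicit Types (x y : R) (u v b : circle R).

Lemma circle_rep_projE x : circle_rep (circle_proj x) = fpart x.
Proof. exact: circle_rep_proj. Qed.

Lemma circle_rep_itv u : 0 <= circle_rep u < 1.
Proof. by rewrite -[u]circle_repK circle_rep_projE fpart_itv. Qed.

Lemma circle_proj0 : circle_proj 0 = 0 :> circle R.
Proof.
by apply: (@addrI _ (circle_proj 0)); rewrite -circle_projD !addr0.
Qed.

Lemma circle_projN x : circle_proj (- x) = - circle_proj x :> circle R.
Proof.
by apply: (@addrI _ (circle_proj x)); rewrite -circle_projD !subrr circle_proj0.
Qed.

Lemma circle_projB x y : circle_proj (x - y) = circle_proj x - circle_proj y :>
  circle R.
Proof. by rewrite circle_projD circle_projN. Qed.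

Lemma circle_projMn x n : circle_proj (x *+ n) = circle_proj x *+ n :> circle R.
Proof.
elim: n => [|n IH]; first exact: circle_proj0.
by rewrite !mulrS circle_projD IH.
Qed.

Lemma circle_rep_affine u v n : circle_rep (u + v *+ n) = fpart (circle_rep u +
  n%:R * circle_rep v).
Proof.
rewrite -circle_rep_projE circle_projD circle_repK mulr_natl circle_projMn.
by rewrite circle_repK.
Qed.

Lemma circle_repB u v : circle_rep (u - v) = fpart (circle_rep u - circle_rep
  v).
Proof. by rewrite -circle_rep_projE circle_projB !circle_repK. Qed.

Lemma circle_rep_mulrn u n : exists m : int,
  circle_rep (u *+ n) = n%:R * circle_rep u + m%:~R.
Proof.
exists (- Num.floor (n%:R * circle_rep u)).
by rewrite -[u *+ n]add0r circle_rep_affine -circle_proj0 circle_rep_projE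
  /fpart floor0 subr0 add0r intrN.
Qed.

Lemma circle_rep_int_inj u v : circle_rep u - circle_rep v \is a Num.int ->
  u = v.
Proof. by move/circle_projP; rewrite !circle_repK. Qed.

Lemma circle_itvcoE b u :
  circle_itvco b u - circle_rep b = circle_rep (u - b) - circle_rep u.
Proof.
have /andP[b0 b1] := circle_rep_itv b; have /andP[u0 u1] := circle_rep_itv u.
rewrite circle_repB /circle_itvco indicE.
have [ub|bu] := ltP (circle_rep u) (circle_rep b).
  rewrite mem_set/=; last by rewrite in_itv/= u0.
  rewrite (@fpart_uniq _ _ (circle_rep u - circle_rep b + 1) (- 1));
    first by ring.
    by lra.
  by rewrite intrN; ring.
rewrite memNset/=; last by rewrite in_itv/= u0/= ltNge bu.
rewrite (@fpart_uniq _ _ (circle_rep u - circle_rep b) 0); first by ring.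
  by lra.
by rewrite addr0.
Qed.

(** The set where the representative exceeds [x >= 0] lifts to a union of open
    intervals, because the jump of the representative is downwards; so it is
    open. *)
Lemma measurable_circle_rep : measurable_fun setT (@circle_rep R).
Proof.
apply: (measurability _ (RGenOInfty.measurableE R)) => //.
move=> _ [_ [x ->] <-]; rewrite setTI.
have [x0|x0] := leP 0 x; last first.
  rewrite [X in measurable X](_ : _ = setT)//; apply/seteqP; split=> // u _ /=.
  by rewrite in_itv/= andbT (lt_le_trans x0)//; case/andP: (circle_rep_itv u).
apply: sub_sigma_algebra.
suff : open (@circle_proj R @^-1` (@circle_rep R @^-1` `]x,
  +oo[%classic)) by [].
have -> : @circle_proj R @^-1` (@circle_rep R @^-1` `]x, +oo[%classic) =
   \bigcup_(m : int) `]x + m%:~R, m%:~R + 1[%classic.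
  apply/seteqP; split => y /=; rewrite in_itv/= andbT circle_rep_projE.
    move=> h; exists (Num.floor y) => //=; rewrite in_itv/=.
    by have /andP[f0 f1] := fpart_itv y; move: h f0 f1; rewrite /fpart; lra.
  move=> [m _]; rewrite /= in_itv/= => /andP[y1 y2].
  rewrite (@fpart_uniq _ y (y - m%:~R) m) ?subrK//; lra.
by apply: bigcup_open => m _; exact: interval_open.
Qed.

(** The Haar measure of a set of representatives is its Lebesgue measure in
    [[0, 1)]. *)
Lemma ae_circle (B : set R) (P : R -> Prop) : measurable B -> mu B = 0 ->
  (forall x, irr01 x -> ~ B x -> P x) ->
  \forall alpha \ae @circle_haar R, P (circle_rep alpha).
Proof.
move=> mB B0 OP; pose N := ~` @irr01 R `|` B.
have mN : measurable N.
  by apply: measurableU => //; apply: measurableC; exact: measurable_irr01.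
exists (@circle_rep R @^-1` N); split.
- by rewrite -[X in measurable X]setTI; exact: measurable_circle_rep.
- rewrite /circle_haar /pushforward /mrestr.
  have -> : @circle_proj R @^-1` (@circle_rep R @^-1` N) `&` `[0,
    1[ = N `&` `[0, 1[.
    apply/seteqP; split => y /= [Ny]; rewrite in_itv/= => y01.
      by move: Ny; rewrite /= circle_rep_projE (@fpart_uniq _ y y 0)// addr0.
    by rewrite /= circle_rep_projE (@fpart_uniq _ y y 0)// addr0.
  have mNI : measurable (N `&` `[0, 1[) by exact: measurableI.
  rewrite -(lebesgue_irrational mNI).
  apply: (@etrans _ _ (mu B)%:E); last by rewrite B0.
  rewrite muE//; congr lebesgue_measure.
  apply/seteqP; split => y.
    move=> [[Ny]]; rewrite /= in_itv/= => /andP[y0 y1] iy.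
    have Oy : irr01 y.
      split=> //; rewrite /= in_itv/= y1 andbT lt_neqAle y0 andbT eq_sym.
      by apply/eqP => e; apply: (@irrational_neq _ _ 0 1 iy); rewrite e mul0r.
    by case: Ny.
  move=> [By Oy]; split; last by case: Oy.
  by split; [right|rewrite /= in_itv/= ltW ?irr01_gt0// irr01_lt1].
- move=> al /= nP; apply: contrapT => /not_orP[/contrapT Oa nB];
  exact: nP (OP _ Oa nB).
Qed.

Lemma homo_ltn_geid (phi : nat -> nat) : {homo phi : m n / (m < n)%N} ->
  forall n, (n <= phi n)%N.
Proof. by move=> h; elim=> // n IH; exact: leq_ltn_trans (h _ _ (ltnSn n)). Qed.

(** Successive extractions, one for each entry of [r]. *)
Lemma common_subsequence (I : eqType) (r : seq I) (w : I -> nat -> R) :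
  (forall i l, 0 <= w i l < 1) ->
  exists2 phi : nat -> nat, {homo phi : m n / (m < n)%N} &
    forall i, i \in r -> cvgn (w i \o phi).
Proof.
move=> w01; elim: r => [|i r [phi phim IH]]; first by exists id.
have [|psi psim cpsi] := @bolzano_weierstrass R (w i \o phi).
  exists 1; split=> // e e1 l _ /=; have /andP[w0 w1] := w01 i (phi l).
  by rewrite ger0_norm// ltW// (lt_trans w1).
have psim' : {homo psi : m n / (m < n)%N}.
  by move=> m n mn; rewrite ltnNge; have := psim n m; rewrite !leEnat => ->;
    rewrite -ltnNge.
exists (phi \o psi); first by move=> m n /psim'/phim.
move=> j; rewrite inE => /predU1P[->|jr]; first exact: cpsi.
have psicv : psi @ \oo --> \oo.
  move=> A [N _ NA]; exists N => // n /= Nn; apply: NA => /=;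
    apply: leq_trans Nn _.
  exact: homo_ltn_geid.
have := IH j jr => /cvg_ex[l wl]; apply/cvg_ex; exists l.
exact: (cvg_comp _ _ psicv wl).
Qed.

End Circle.

(** * From the circle to the sawtooth *)

Section Assembly.
Variable R : realType.
Implicit Types (c X : R).

(** The factor [K] grows along the sequence, which gives the limit zero of the
    ratio of digit sum and next digit. *)
Lemma success_sequence e ds a :
  (forall K N0, exists2 n, (N0 <= n)%N & @success R e ds K.+1 n a) ->
  exists n : nat -> nat, [/\ forall l, (0 < n l)%N, {homo n : l m / (l < m)%N}
    & forall l, success e ds l.+1 (n l) a].
Proof.
move=> H; pose g K N0 : nat := s2val (cid2 (H K N0)).
have g1 K N0 : (N0 <= g K N0)%N by exact: s2valP (cid2 (H K N0)).
have g2 K N0 : success e ds K.+1 (g K N0) a by exact: s2valP' (cid2 (H K N0)).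
pose n := fix n l := if l is l'.+1 then g l (n l').+1 else g 0%N 1%N.
exists n; split.
- by case=> [|l] /=; [exact: g1|apply: leq_trans (g1 _ _)].
- by apply: homo_ltn => [y x z|l] /=; [exact: ltn_trans|exact: g1].
- by case=> [|l] /=; exact: g2.
Qed.

Lemma birkhoff_sawtooth (nu : nat) (H : 'I_nu -> R) (gamma : 'I_nu -> circle R)
    (f : circle R -> R) :
  (forall x : circle R,
       f x = (\sum_(i < nu) H i) * (circle_rep x - 2^-1) +
             \sum_(i < nu) H i *
               (circle_itvco (gamma i) x - circle_rep (gamma i))) ->
  forall N alpha x0, birkhoff_sum N f alpha x0 =
    \sum_(i < nu) H i * \sum_(0 <= k < N)
      (fpart (circle_rep x0 - circle_rep (gamma i) + k%:R * circle_rep alpha) -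
        2^-1).
Proof.
move=> fE N alpha x0; rewrite /birkhoff_sum.
under [RHS]eq_bigr do rewrite mulr_sumr.
rewrite exchange_big/=; apply: eq_bigr => k _.
rewrite fE mulr_suml -big_split/=; apply: eq_bigr => i _.
rewrite circle_itvcoE -mulrDr; congr (_ * _).
rewrite circle_repB circle_rep_affine.
set w := circle_rep x0 + _ * _.
have -> : circle_rep x0 - circle_rep (gamma i) + k%:R * circle_rep alpha =
   w - circle_rep (gamma i) by rewrite /w addrAC.
have -> : fpart (fpart w - circle_rep (gamma i)) = fpart (w - circle_rep (gamma
  i)).
  rewrite -(fpart_int (fpart w - circle_rep (gamma i)) (Num.floor w));
    congr fpart.
  by rewrite /fpart; ring.
by ring.
Qed.

(** The closed interval in place of the half-open one does not change the
    integral, so [circle_itvcoE] applies here too. *)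
Lemma limit_sawtooth (nu : nat) (H g : 'I_nu -> R) c X : 0 <= c <= 1 ->
  (\sum_(i < nu) H i) *
    ((\int[@lebesgue_measure R]_(y in `[0, c])
       circle_rep (circle_proj y + circle_proj X)) - c / 2)
  + \sum_(i < nu) H i *
    ((\int[@lebesgue_measure R]_(y in `[0, c])
       circle_itvcc (circle_proj (g i)) (circle_proj y + circle_proj X))
     - c * circle_rep (circle_proj (g i))) =
  \sum_(i < nu) H i * (saw (X - g i + c) - saw (X - g i)).
Proof.
move=> c01.
have E1 : \int[@lebesgue_measure R]_(y in `[0, c])
    circle_rep (circle_proj y + circle_proj X) = saw (X + c) - saw X + c / 2.
  rewrite -(integral_fpart X c01); apply: eq_Rintegral => y _.
  by rewrite -circle_projD circle_rep_projE.
rewrite E1 mulr_suml -big_split/=; apply: eq_bigr => i _; rewrite -mulrDr;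
  congr (_ * _).
have gi : 0 <= fpart (g i) < 1 by exact: fpart_itv.
have E2 : \int[@lebesgue_measure R]_(y in `[0, c])
       circle_itvcc (circle_proj (g i)) (circle_proj y + circle_proj X) =
    c * fpart (g i) + (saw (X - g i + c) - saw (X - g i)) - (saw (X + c) - saw
      X).
  have -> : saw (X - g i + c) = saw (X - fpart (g i) + c).
    by rewrite -(saw_int (X - g i + c) (Num.floor (g i))); congr saw;
      rewrite /fpart; ring.
  have -> : saw (X - g i) = saw (X - fpart (g i)).
    by rewrite -(saw_int (X - g i) (Num.floor (g i))); congr saw;
      rewrite /fpart; ring.
  rewrite -(integral_fpart_le X c01 gi); apply: eq_Rintegral => y _.
  by rewrite /circle_itvcc -circle_projD !circle_rep_projE.
by rewrite E2 circle_rep_projE; ring.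
Qed.

Lemma birkhoff_error (alpha x0 gam : circle R) n c X g :
  irr01 (circle_rep alpha) -> ~~ odd n -> 0 <= c <= 1 ->
  let a := cf_digit (circle_rep alpha) in let q := cf_den a n in
  `|(\sum_(0 <= k < Num.truncn (c * (a n.+1)%:R) * q)
       (fpart (circle_rep x0 - circle_rep gam + k%:R * circle_rep alpha) -
         2^-1)) / (a n.+1)%:R
    - (saw (X - g + c) - saw (X - g))| <=
  `|circle_rep (x0 *+ q) - X| + `|circle_rep (gam *+ q) - g| + 25 / (a n.+1)%:R.
Proof.
move=> Oa ne c01; cbv zeta; set a := cf_digit _; set q := cf_den a n.
have a0 : forall i, (0 < a i.+1)%N := cf_digit_gt0 Oa.
have [m1 E1] := circle_rep_mulrn x0 q; have [m2 E2] := circle_rep_mulrn gam q.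
apply: (sum_fpart_saw (cf_den_gt0 n a0) (cf_coprime a n) (a0 n) erefl
  (theta_bounds Oa ne) c01
  (N := m1 - m2)).
have -> : q%:R * (circle_rep x0 - circle_rep gam) + (m1 - m2)%:~R - (X - g) =
  (circle_rep (x0 *+ q) - X) - (circle_rep (gam *+ q) - g).
  by rewrite E1 E2 intrB; ring.
exact: ler_normB.
Qed.

End Assembly.

(** * The limit of the rescaled Birkhoff sums *)

Theorem lemma3p7 (R : realType) (nu : nat) (nu_gt0 : (0 < nu)%N)
    (H : 'I_nu -> R) (gamma : 'I_nu -> circle R) (gamma_inj : injective gamma)
    (f : circle R -> R)
    (fE : forall x : circle R,
       f x = (\sum_(i < nu) H i) * (circle_rep x - 2^-1) +
             \sum_(i < nu) H i *
               (circle_itvco (gamma i) x - circle_rep (gamma i))) :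
  let i1 := Ordinal nu_gt0 in
  \forall alpha \ae @circle_haar R,
    let a := cf_digit (circle_rep alpha) in
    let q := cf_den a in
    irrational (circle_rep alpha) /\
    forall x0 : circle R, exists n : nat -> nat,
      [/\ (forall l, 0 < n l)%N,
          {homo n : l m / (l < m)%N},
          forall l, convergent_denominator (circle_rep alpha) (q (n l)),
          (\sum_(1 <= i < (n l).+1) a i)%N%:R / (a (n l).+1)%:R
            @[l --> \oo] --> (0 : R)
        & exists (x0bar : circle R) (gammabar : 'I_nu -> circle R),
          [/\ x0 *+ q (n l) @[l --> \oo] --> x0bar,
              forall i, gamma i *+ q (n l) @[l --> \oo] --> gammabar i,
              forall i, i != i1 -> gammabar i <> gammabar i1,
              gamma i1 <> 0 -> gammabar i1 <> 0
            & ereal_sup [set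
                (`| birkhoff_sum (Num.truncn (c * (a (n l).+1)%:R) * q (n l))%N
                      f alpha x0 / (a (n l).+1)%:R
                  - ((\sum_(i < nu) H i) *
                       ((\int[@lebesgue_measure R]_(y in `[0, c])
                           circle_rep (circle_proj y + x0bar)) - c / 2)
                     + \sum_(i < nu) H i *
                       ((\int[@lebesgue_measure R]_(y in `[0, c])
                           circle_itvcc (gammabar i) (circle_proj y + x0bar))
                        - c * circle_rep (gammabar i))) |)%:E
                | c in `[0, 1]] @[l --> \oo] --> 0%E]].
Proof.
pose i1 : 'I_nu := Ordinal nu_gt0.
pose cr (u : circle R) : R := circle_rep u.
(* The multiples of these numbers must stay away from the integers. *)
pose ds := [seq cr (gamma i) - cr (gamma i1) | i <- enum 'I_nu & i != i1] ++
  (if cr (gamma i1) == 0 then [::] else [:: cr (gamma i1)]).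
have ds_nonint d : d \in ds -> d \isn't a Num.int.
  rewrite mem_cat => /orP[/mapP[i]|].
    rewrite mem_filter => /andP[ii1 _] ->; apply: contra ii1 =>
      /circle_rep_int_inj.
    by move/gamma_inj => ->.
  case: ifPn => // g0; rewrite inE => /eqP ->; apply: contra g0 => gint.
  have /andP[h0 h1] := circle_rep_itv (gamma i1).
  move/intrP: gint => [m gm]; move: h0 h1;
    rewrite -[circle_rep _]/(cr (gamma i1)) gm.
  by rewrite ler0z ltrz1; case: m {gm} => [[|]|].
have [e [B [e0 mB B0 suc]]] := ae_success ds_nonint.
cbv zeta.
apply: filterS (ae_circle mB B0 (P := fun x => irr01 x /\
  forall K N0, exists2 n, (N0 <= n)%N & success e ds K.+1 n (cf_digit x)) _);
    last first.
  by move=> x Ox nB; split=> //; exact: suc.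
move=> alpha [Oa Hs]; set a := cf_digit (circle_rep alpha).
have a0 : forall i, (0 < a i.+1)%N := cf_digit_gt0 Oa.
split; first by case: Oa.
move=> x0; have [n0 [n0_gt0 n0_homo n0_suc]] := success_sequence Hs.
(* The index [None] stands for [x0]. *)
pose w (j : option 'I_nu) l := circle_rep ((if j is Some i then gamma i else
  x0) *+ cf_den a (n0 l)).
have [phi phi_homo cphi] := common_subsequence (enum {: option 'I_nu})
  (fun j l => circle_rep_itv _ : 0 <= w j l < 1).
pose n l := n0 (phi l).
have n_suc l : success e ds (phi l).+1 (n l) a by exact: n0_suc.
pose X := lim (w None \o phi @ \oo); pose g i := lim (w (Some i) \o phi @ \oo).
have cX : circle_rep (x0 *+ cf_den a (n l)) @[l --> \oo] --> X.
  by apply: (cphi None); rewrite mem_enum.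
have cg i : circle_rep (gamma i *+ cf_den a (n l)) @[l --> \oo] --> g i.
  by apply: (cphi (Some i)); rewrite mem_enum.
(* The lifts [r l] of [q_n d] keep the distance [e] from every integer, hence
   so does their limit. *)
have far d (r : nat -> R) (L : R) : d \in ds -> r l @[l --> \oo] --> L ->
    (forall l, exists m : int, r l = (cf_den a (n l))%:R * d + m%:~R) ->
    forall m : int, L <> m%:~R.
  move=> dds rL rE m Lm.
  move/cvgrPdist_lt: rL => /(_ e e0)[N _ /(_ N (leqnn N))]; have [m' ->] :=
    rE N.
  have [[_ nd] _] := n_suc N; rewrite Lm distrC => h; apply: (nd d dds).
  by exists (m - m'); rewrite intrB opprB addrA.
have ratio l : (digit_sum a (n l))%:R / (a (n l).+1)%:R <= (harmonic l : R).
  have [_ h] := n_suc l.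
  rewrite ler_pdivrMr ?ltr0n ?a0// /harmonic ler_pdivlMl ?ltr0n// -natrM
    ler_nat.
  apply: leq_trans h; rewrite leq_mul2r ltnS; apply/orP; right.
  exact: homo_ltn_geid.
have c_ratio : (digit_sum a (n l))%:R / (a (n l).+1)%:R @[l --> \oo] -->
  (0 : R).
  apply: (squeeze_cvgr _ (cvg_cst 0) (@cvg_harmonic R)).
  by apply: nearW => l; rewrite ratio divr_ge0.
have c_inv : 25 / (a (n l).+1)%:R @[l --> \oo] --> (0 : R).
  rewrite -[X in _ --> X](mulr0 25); apply: cvgMr.
  apply: (squeeze_cvgr _ (cvg_cst 0) c_ratio).
  apply: nearW => l; rewrite invr_ge0 ler0n/= ler_peMl ?invr_ge0// ler1n.
  by apply: leq_trans (digit_sum_ge _ a0); rewrite n0_gt0.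
exists n; split.
- by move=> l; exact: n0_gt0.
- by move=> l m lm; apply: n0_homo; exact: phi_homo.
- move=> l; exists (n l), (cf_nums a (n l)).1; split.
  + exact: cf_den_gt0.
  + exact: cf_coprime.
  + exact: convergentE.
- exact: c_ratio.
exists (circle_proj X), (fun i => circle_proj (g i)).
have proj_cvg (u : circle R) (L : R) :
    circle_rep (u *+ cf_den a (n l)) @[l --> \oo] --> L ->
    u *+ cf_den a (n l) @[l --> \oo] --> circle_proj L.
  move=> uL.
  have -> : (fun l => u *+ cf_den a (n l)) =
      @circle_proj R \o (fun l => circle_rep (u *+ cf_den a (n l))).
    by apply/funext => l /=; rewrite circle_repK.
  by apply: continuous_cvg uL; exact: circle_proj_continuous.
split.
- exact: proj_cvg.
- by move=> i; exact: proj_cvg.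
- move=> i ii1 /circle_projP/intrP[m].
  apply: (far (cr (gamma i) - cr (gamma i1)) _ _ _ (cvgB (cg i) (cg i1))).
    rewrite mem_cat; apply/orP; left; apply/mapP; exists i => //.
    by rewrite mem_filter ii1 mem_enum.
  move=> l; have [m1 E1] := circle_rep_mulrn (gamma i) (cf_den a (n l)).
  have [m2 E2] := circle_rep_mulrn (gamma i1) (cf_den a (n l)).
  exists (m1 - m2).
  rewrite -[LHS]/(circle_rep (gamma i *+ cf_den a (n l)) - circle_rep (gamma i1
    *+ cf_den a (n l))).
  by rewrite E1 E2 intrB /cr; ring.
- move=> g1; rewrite -circle_proj0 => /circle_projP/intrP[m]; rewrite subr0.
  apply: (far (cr (gamma i1)) _ _ _ (cg i1)); last first.
    by move=> l; exact: circle_rep_mulrn.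
  rewrite mem_cat; case: ifPn => [/eqP h|_]; last by rewrite mem_head orbT.
  by case: g1; rewrite -[gamma _]circle_repK -[circle_rep _]/(cr (gamma i1)) h
    circle_proj0.
pose err l : R := \sum_(i < nu) `|H i| * (`|circle_rep (x0 *+ cf_den a (n l)) -
  X| +
  `|circle_rep (gamma i *+ cf_den a (n l)) - g i| + 25 / (a (n l).+1)%:R).
have c_err : err l @[l --> \oo] --> (0 : R).
  have -> : (0 : R) = \sum_(i < nu) `|H i| * (`|X - X| + `|g i - g i| + 0).
    by rewrite big1// => i _; rewrite !subrr normr0 !addr0 mulr0.
  apply: cvg_big => [|i _]; first exact: add_continuous.
  apply: cvgMr; apply: cvgD => //; apply: cvgD; apply: cvg_norm;
    apply: cvgB => //; exact: cvg_cst.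
have c_errE : (err l)%:E @[l --> \oo] --> (0 : R)%:E.
  by apply: cvg_EFin; [exact: nearW|exact: c_err].
apply: (squeeze_cvge _ (cvg_cst 0%E) c_errE).
apply: nearW => l; apply/andP; split.
  apply: le_ereal_sup_tmp; eexists; first by exists 0 => //=;
    rewrite in_itv/= lexx ler01.
  by rewrite lee_fin.
apply: ge_ereal_sup => _ [c c01 <-]; rewrite lee_fin.
move: c01; rewrite /= in_itv/= => c01.
rewrite limit_sawtooth// (birkhoff_sawtooth fE) mulr_suml -sumrB.
apply: le_trans (ler_norm_sum _ _ _) _; apply: ler_sum => i _.
rewrite -mulrA -mulrBr normrM ler_wpM2l//.
apply: birkhoff_error => //.
by have [[]] := n_suc l.
Qed.
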